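(* Let $n\ge2$, $m\ge1$, let $\Omega=\mathbb{R}^n\setminus\overline{G}$, where $G$ is a convex subdomain of $\mathbb{R}^n$, and let $\boldsymbol{u}$ be a vector-valued function with $m$ bounded harmonic components in $\Omega$. Then for any point $x\in\Omega$ the inequality $$\max_{|\boldsymbol{\ell}|=1}\bigl|(\boldsymbol{\ell},\nabla)\boldsymbol{u}(x)\bigr|\le\frac{C_n}{d_x}\,\sup_\Omega|\boldsymbol{u}|$$ holds, where $$C_n=\frac{4(n-1)^{(n-1)/2}\,\omega_{n-1}}{n^{n/2}\,\omega_n}.$$
   Context: $|\cdot|$ is the Euclidean length of a vector or the absolute value of a scalar. $d_x$ is the distance from $x\in\Omega$ to $\partial\Omega$. $\omega_n$ is the area of the $(n-1)$-dimensional unit sphere in $\mathbb{R}^n$ (so $\omega_1=2$, $\omega_2=2\pi$). Functions are real-valued. For a unit vector $\boldsymbol{\ell}=(\ell_1,\dots,\ell_n)\in\mathbb{R}^n$, $(\boldsymbol{\ell},\nabla)\boldsymbol{u}=\sum_{j=1}^n\ell_j\,\partial\boldsymbol{u}/\partial x_j$ is the ($m$-component) derivative of the field $\boldsymbol{u}$ in the direction $\boldsymbol{\ell}$; the maximum is over all unit vectors $\boldsymbol{\ell}\in\mathbb{R}^n$. *)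

(* Defs.v *)
From HB Require Import structures.
From mathcomp Require Import all_boot all_order all_algebra.
From mathcomp Require Import all_classical all_reals all_analysis.

Set Implicit Arguments.
Unset Strict Implicit.
Unset Printing Implicit Defensive.
Import Order.TTheory GRing.Theory Num.Theory.
Import numFieldNormedType.Exports.
Local Open Scope classical_set_scope.
Local Open Scope ring_scope.

(* The library's norm on ['rV[R]_n] is the sup norm, hence this separate
   Euclidean length; both induce the library's topology. *)
Definition enorm (R : realType) (n : nat) (v : 'rV[R]_n) : R :=
  Num.sqrt (\sum_(j < n) v 0 j ^+ 2).

Definition unit_sphere (R : realType) (n : nat) : set 'rV[R]_n :=
  [set l | enorm l = 1].

Definition domain (R : realType) (n : nat) (G : set 'rV[R]_n) : Prop :=
  [/\ G !=set0, open G & connected G].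

Definition boundary (R : realType) (n : nat) (D : set 'rV[R]_n) :
  set 'rV[R]_n := closure D `\` interior D.

Definition boundary_dist (R : realType) (n : nat) (D : set 'rV[R]_n)
  (x : 'rV[R]_n) : R := inf [set enorm (x - y) | y in boundary D].

Definition partial (R : realType) (n : nat) (W : normedModType R)
  (j : 'I_n) (f : 'rV[R]_n -> W) : 'rV[R]_n -> W :=
  fun x => 'D_(delta_mx 0 j) f x.

Definition dir_deriv (R : realType) (n : nat) (W : normedModType R)
  (l : 'rV[R]_n) (f : 'rV[R]_n -> W) (x : 'rV[R]_n) : W :=
  \sum_(j < n) l 0 j *: partial j f x.

(* Meant for open [D], on which continuity and derivability at a point only
   depend on the restriction of [f] to [D]. *)
Fixpoint class_C (R : realType) (n : nat) (k : nat) (D : set 'rV[R]_n)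
  (f : 'rV[R]_n -> R) : Prop :=
  (forall y, D y -> {for y, continuous f}) /\
  (if k is k'.+1 then
     forall j : 'I_n, (forall y, D y -> derivable f y (delta_mx 0 j)) /\
                      class_C k' D (partial j f)
   else True).

Definition harmonic_on (R : realType) (n : nat) (D : set 'rV[R]_n)
  (f : 'rV[R]_n -> R) : Prop :=
  class_C 2 D f /\
  (forall y, D y -> \sum_(j < n) partial j (partial j f) y = 0).

(* Lebesgue measure on R^n as the n-fold product of [lebesgue_measure], with
   the integral of the measures of the sections that defines the library's
   product [\x]; only meaningful on Borel sets.  R^0 is a point of mass 1. *)
Fixpoint lebesgue_rV (R : realType) (n : nat) : set 'rV[R]_n -> \bar R :=
  match n with
  | 0 => fun A => (\1_A (0 : 'rV[R]_0))%:E
  | n'.+1 => fun A =>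
      (\int[lebesgue_measure]_t
         lebesgue_rV [set y : 'rV[R]_n' | A (row_mx (t%:M : 'rV[R]_1) y)])%E
  end.

(* Surface measure on the unit sphere of R^n, given by polar coordinates:
   n times the volume of the truncated cone spanned by [A]. *)
Definition sphere_measure (R : realType) (n : nat) (A : set 'rV[R]_n) :
  \bar R :=
  (n%:R%:E * lebesgue_rV [set r *: t | r in `]0%R, 1%R[ & t in A])%E.

Definition omega (R : realType) (n : nat) : R :=
  fine (sphere_measure (@unit_sphere R n)).

Definition grad_const (R : realType) (n : nat) : R :=
  4 * (n.-1)%:R `^ ((n.-1)%:R / 2) * omega R n.-1 /
  (n%:R `^ (n%:R / 2) * omega R n).

Definition is_maximum (R : realType) (A : set R) (M : R) : Prop :=
  A M /\ ubound A M.

(* Main.v *)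
Require Import Defs.
From HB Require Import structures.
From mathcomp Require Import all_boot all_order all_algebra.
From mathcomp Require Import all_classical all_reals all_analysis measurable_realfun.
From mathcomp Require Import ring lra.
Set Implicit Arguments.
Unset Strict Implicit.
Unset Printing Implicit Defensive.
Import Order.TTheory GRing.Theory Num.Theory.
Import numFieldNormedType.Exports.
Local Open Scope classical_set_scope.
Local Open Scope ring_scope.

(** Reduction to a half-space. Let xi be the point of the closure of G nearest
    to x, and nu the unit vector along x - xi. By convexity Omega contains the
    half-space beyond the hyperplane through xi orthogonal to nu, and this
    hyperplane is at distance d_x from x ([supporting_half_space]). If e is the
    direction of the vector (l, grad) u(x), the scalar function e.u is harmonic,
    bounded by sup |u|, and its derivative along l at x is |(l, grad) u(x)|. So
    it is enough to bound the derivative at 0, along a unit vector l, of a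
    scalar h that is harmonic with |h| <= U on the half-space y.nu > -d
    ([half_space_gradient_bound]).

    In a half-space one would differentiate Poisson's formula. As h need not
    have boundary values, the formula is replaced by an average of it over the
    layer d1 < - y.nu < d2 with d2 < d, proved by Green's formula with explicit
    test functions. Let g(y) = y.l / |y|^n, regularised near 0 so that its
    Laplacian is the derivative along l of a nonnegative bump of mass omega n
    ([exists_potential]); let E0 be a smooth function equal to 1 below d1 and to
    0 above d2, and E1 = - E0', E2 = E1'. The test functions are E0(- y.nu) g(y)
    and, for v >= 0, E1(v - y.nu) g(y - 2 v nu), multiplied by a cutoff of
    radius r. Where the cutoff is 1, the Laplacian of the second one is the
    v-derivative of E2(v - y.nu) g(y - 2 v nu), hence its integral over v cancels
    the term with E2 in the Laplacian of the first one ([seg_int_P]). With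
    g_nu = (nu, grad) g, what is left is

      integral of h (lap g) = - integral of 2 h E1(- y.nu) g_nu(y) dy + O(1/r)

    ([int_identity]). Integrating by parts, the left side is minus the integral
    of (l, grad) h against the bump, which tends to - omega_n (l, grad) h(0) as
    the bump shrinks. The right side only involves a second derivative of the
    fundamental solution, which splits into its pure second derivatives along
    w = nu + l and w = nu - l, with absolute values
    | |w|^2 |y|^2 - n (y.w)^2 | / |y|^(n+2) up to a common factor
    ([gnu_split]).

    The integral of such a kernel against a weight psi >= 0 is at most
    |w|^2 c kappa omega_(n-1), if c bounds the integral of psi over each ray
    with respect to dt / t ([int_dir_kernel]): by homogeneity it can be computed
    slice by slice along lines parallel to w, where for unit w the kernel is the
    absolute value of the derivative of t / (t^2 + r^2)^(n/2), r the distance of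
    the line to 0, whose total variation is kappa / r^(n-1) with kappa = 4 (n-1)^((n-1)/2) / n^(n/2) ([int_slice_kernel]). For the weight
    E1(- y.nu) one may take c = 1 / d1, halved by symmetry ([psi_dilation]), and
    |nu + l|^2 + |nu - l|^2 = 4 makes the outcome independent of l: it is
    U kappa omega_(n-1) / d1. Letting d1 tend to d gives the constant C_n.

    Integrals over R^n are iterated integrals of continuous functions of compact
    support; their invariance under isometries and dilations is obtained by
    comparison with radial bumps whose integrals are explicit, and the same
    integrals identify omega ([omegaE], [int_bump4_omega]). *)

(** * Directional derivatives *)

Section Deriv.
Variables (R : realType) (V : normedModType R).
Implicit Types (f g : V -> R) (x v : V).

Lemma isd_eq x v f (d d' : R) : is_derive x v f d -> d = d' -> is_derive x v f d'.
Proof. by move=> h <-. Qed.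

Lemma isd_cst x v (c : R) : is_derive x v (fun=> c) 0.
Proof. exact: is_derive_cst. Qed.

Lemma isd_add x v f g df dg : is_derive x v f df -> is_derive x v g dg ->
  is_derive x v (fun y => f y + g y) (df + dg).
Proof. by move=> hf hg; exact: (is_deriveD hf hg). Qed.

Lemma isd_sub x v f g df dg : is_derive x v f df -> is_derive x v g dg ->
  is_derive x v (fun y => f y - g y) (df - dg).
Proof. by move=> hf hg; exact: (is_deriveB hf hg). Qed.

Lemma isd_mul x v f g df dg : is_derive x v f df -> is_derive x v g dg ->
  is_derive x v (fun y => f y * g y) (df * g x + f x * dg).
Proof.
move=> hf hg; apply: isd_eq (is_deriveM hf hg) _.
by rewrite /GRing.scale /= addrC mulrC.
Qed.

Lemma isd_sum x v (I : finType) (F : I -> V -> R) (dF : I -> R) :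
  (forall i, is_derive x v (F i) (dF i)) ->
  is_derive x v (fun y => \sum_i F i y) (\sum_i dF i).
Proof.
move=> H; suff K (s : seq I) : is_derive x v (fun y => \sum_(i <- s) F i y) (\sum_(i <- s) dF i).
  exact: K.
elim: s => [|i s IH].
  by under eq_fun do rewrite big_nil; rewrite big_nil; exact: isd_cst.
by under eq_fun do rewrite big_cons; rewrite big_cons; exact: isd_add.
Qed.

(** Since [is_derive] only sees the restriction to a line, it can be carried
    between points, directions and spaces; the chain rule and the behaviour
    under translations reduce to this. *)
Lemma isd_line (W : normedModType R) x v (y w : W) f (g : W -> R) d :
  (forall h : R, g (h *: w + y) = f (h *: v + x)) ->
  is_derive x v f d -> is_derive y w g d.
Proof.
move=> H [dx ex].
have g0 : g y = f x by have := H 0; rewrite !scale0r !add0r.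
have E : (fun h : R => h^-1 *: ((g \o shift y) (h *: w) - g y)) =
         (fun h : R => h^-1 *: ((f \o shift x) (h *: v) - f x)).
  by apply/funext => h /=; rewrite H g0.
split; first by rewrite /derivable E.
by rewrite -ex /derive E.
Qed.

Lemma isd_cvg x v f d :
  (h^-1 *: (f (h *: v + x) - f x) @[h --> (0 : R)^'] --> d) -> is_derive x v f d.
Proof.
move=> H; split; first by apply: cvgP H.
by apply: cvg_lim H.
Qed.

Lemma isd_cvgP x v f d : is_derive x v f d ->
  h^-1 *: (f (h *: v + x) - f x) @[h --> (0 : R)^'] --> d.
Proof. by move=> [dx <-]. Qed.

Lemma isd_near x v f g d : (\forall y \near x, f y = g y) ->
  is_derive x v f d -> is_derive x v g d.
Proof.
move=> fg [dx ex]; split; first exact: near_eq_derivable dx.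
by rewrite -ex; apply/esym/near_eq_derive.
Qed.

End Deriv.

Section Deriv1.
Variable R : realType.
Implicit Types (f g : R -> R) (x : R).

Lemma isd_id x (v : R) : is_derive x v (fun y : R => y) v.
Proof. exact: is_derive_id. Qed.

Lemma isd_comp (V : normedModType R) (x v : V) (f : V -> R) g df dg :
  is_derive x v f df -> is_derive (f x) 1 g dg ->
  is_derive x v (fun y => g (f y)) (dg * df).
Proof.
move=> hf hg.
have hf' : is_derive (0 : R) 1 (fun h : R => f (h *: v + x)) df.
  by apply: isd_line hf => h; rewrite /GRing.scale /= mulr1 addr0.
have hg' : is_derive (f (0 *: v + x)) 1 g dg by rewrite scale0r add0r.
have := is_derive1_comp hg' hf'.
by apply: isd_line => h; rewrite /= /GRing.scale /= mulr1 addr0.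
Qed.

Lemma isd_inv (V : normedModType R) (x v : V) (f : V -> R) df :
  is_derive x v f df -> f x != 0 ->
  is_derive x v (fun y => (f y)^-1) (- df / f x ^+ 2).
Proof.
move=> hf f0; apply: isd_eq (isd_comp hf (@is_deriveV _ id (f x) _ 1 f0 (isd_id (f x) 1))) _.
by rewrite /GRing.scale /= mulr1 !mulNr mulrC.
Qed.

(** One-sided pieces with the same value and slope fit together; the
    piecewise functions below get their derivatives this way. *)
Lemma isd_glue (a : R) f g d : f a = g a -> is_derive a 1 f d ->
  is_derive a 1 g d -> is_derive a 1 (fun x => if x < a then f x else g x) d.
Proof.
move=> fga /isd_cvgP hf /isd_cvgP hg; apply: isd_cvg.
apply/cvgrPdist_lt => e e0.
move/cvgrPdist_lt : hf => /(_ _ e0) hf; move/cvgrPdist_lt : hg => /(_ _ e0) hg.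
by near=> h; rewrite ltxx; case: ifP => _; [rewrite -fga|]; near: h.
Unshelve. all: by end_near. Qed.

Lemma isd_continuous f (df : R -> R) : (forall x, is_derive x 1 f (df x)) ->
  continuous f.
Proof.
by move=> H x; apply/differentiable_continuous/derivable1_diffP; case: (H x).
Qed.

Lemma isd_exp n x : is_derive x 1 (fun y : R => y ^+ n) (n%:R * x ^+ n.-1).
Proof.
elim: n => [|n IH].
  by rewrite mul0r; under eq_fun do rewrite expr0; exact: isd_cst.
under eq_fun do rewrite exprS.
apply: isd_eq (isd_mul (isd_id x 1) IH) _.
case: n {IH} => [|n] /=; first by rewrite !expr0; ring.
by rewrite -[n.+2%:R]natr1 exprS; ring.
Qed.

End Deriv1.

(** * Uniform continuity on compact sets *)

Section Compactness.
Variable R : realType.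

Lemma nbhs_dist_lt (V : normedModType R) (z : V) (e : R) : 0 < e ->
  \forall z' \near z, `|z - z'| < e.
Proof. by move=> e0; apply: filterS (nbhsx_ballx z e e0) => z'; rewrite -ball_normE. Qed.

Lemma continuous_dist (V W : normedModType R) (f : V -> W) :
  (forall x (e : R), 0 < e ->
     exists2 d : R, 0 < d & forall y, `|x - y| < d -> `|f x - f y| < e) ->
  continuous f.
Proof.
move=> H x; apply/cvgrPdist_lt => e /(H x) [d d0 Hd].
by apply: filterS (nbhs_dist_lt x d0) => y /Hd.
Qed.

(** Heine-Cantor, in the form where only one of the two points is confined to
    the compact set. *)
Lemma compact_unif_continuous (V W : normedModType R) (f : V -> W) (A : set V) :
  compact A -> continuous f ->
  forall e : R, 0 < e -> exists2 d : R, 0 < d &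
    forall x y, A x -> `|x - y| < d -> `|f x - f y| < e.
Proof.
move=> /compact_near_coveringP cA cf e e0.
pose P (d : R) (x : V) := forall y, `|x - y| < d -> `|f x - f y| < e.
have : \forall d \near (0 : R)^'+, A `<=` P d.
  apply: cA => x Ax.
  have /cvgrPdist_lt /(_ (e / 2)) := cf x.
  rewrite divr_gt0 // => /(_ isT) /nbhs_normP [d /= d0 Hd].
  exists (ball x (d / 2), [set r : R | 0 < r < d / 2]) => /=.
    split; first by apply: nbhsx_ballx; rewrite divr_gt0.
    near=> r => /=; apply/andP; split; near: r.
      exact: nbhs_right_gt.
    by apply: nbhs_right_lt; rewrite divr_gt0.
  move=> [z r] /= []; rewrite -ball_normE /= => xz /andP[r0 rd] y zy.
  have H1 : `|f x - f z| < e / 2 by apply: Hd; rewrite /ball_ /=; lra.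
  have H2 : `|f x - f y| < e / 2.
    apply: Hd => /=.
    have := ler_distD z x y; rewrite /ball_ /=; lra.
  have := ler_distD (f x) (f z) (f y).
  rewrite (distrC (f z) (f x)); lra.
move=> H.
have : \forall d \near (0 : R)^'+, 0 < d /\ A `<=` P d.
  by near do split => //.
move=> /filter_ex [d [d0 Hd]]; exists d => // x y Ax; exact: Hd.
Unshelve. all: by end_near. Qed.

Lemma unif_param (U V : normedModType R) (F : U -> V -> R) (A : set U)
    (B : set V) :
  compact A -> compact B -> continuous (fun z : U * V => F z.1 z.2) ->
  forall e : R, 0 < e -> exists2 d : R, 0 < d &
    forall u u', A u -> `|u - u'| < d ->
      forall v, B v -> `|F u v - F u' v| < e.
Proof.
move=> cA cB cF e e0.
have [d d0 Hd] := compact_unif_continuous (compact_setX cA cB) cF e0.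
exists d => // u u' Au uu' v Bv.
apply: (Hd (u, v) (u', v)) => //=.
by rewrite prod_normE /= subrr normr0 gt_max uu'.
Qed.

(** A functional that is Lipschitz for the sup norm on a compact set preserves
    joint continuity in a parameter; [L] will be an integral. *)
Lemma continuous_param (U V : normedModType R) (F : U -> V -> R) (B : set V)
    (L : (V -> R) -> R) (C : R) :
  compact B -> continuous (fun z : U * V => F z.1 z.2) ->
  (forall u u' (e : R), (forall v, B v -> `|F u v - F u' v| <= e) ->
     `|L (F u) - L (F u')| <= C * e) ->
  continuous (fun u => L (F u)).
Proof.
move=> cB cF HL u.
apply/cvgrPdist_lt => e e0.
pose C' := Num.max C 1.
have C'0 : 0 < C' by rewrite lt_max ltr01 orbT.
have [d d0 Hd] := unif_param (@compact_set1 U u) cB cF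
  (divr_gt0 e0 (mulr_gt0 C'0 (ltr0n R 2))).
near=> u'.
have Hu : forall v, B v -> `|F u v - F u' v| <= e / (C' * 2).
  by move=> v Bv; apply/ltW/Hd => //; near: u'; exact: nbhs_dist_lt.
have e2 : 0 <= e / (C' * 2) by rewrite divr_ge0 ?mulr_ge0 // ltW.
apply: le_lt_trans (HL _ _ _ Hu) _.
apply: (@le_lt_trans _ _ (C' * (e / (C' * 2)))).
  by rewrite ler_wpM2r // le_max lexx.
have -> : C' * (e / (C' * 2)) = e / 2 by field; rewrite gt_eqF.
by rewrite ltr_pdivrMr // ltr_pMr // ltr1n.
Unshelve. all: by end_near. Qed.

Lemma compact_ball_rV n (M : R) : compact [set y : 'rV[R]_n | `|y| <= M].
Proof.
apply: bounded_closed_compact.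
  exists M; split; [exact: num_real|by move=> z Mz x /= /le_trans; apply; exact: ltW].
apply: (@closed_comp _ _ (fun y : 'rV[R]_n => `|y|) [set z : R | z <= M]).
  move=> x _; exact: norm_continuous.
exact: closed_le.
Qed.

End Compactness.

(** * Integrals on a segment and on the line *)

Section OneDim.
Variable R : realType.
Implicit Types (a b c : R) (f g : R -> R).
Local Notation mu := (@lebesgue_measure R).

Definition seg_int a b f : R := \int[mu]_(x in `[a, b]) f x.

Lemma seg_integrable a b f : continuous f -> mu.-integrable `[a, b] (EFin \o f).
Proof.
move=> cf; apply: continuous_compact_integrable; first exact: segment_compact.
exact: continuous_subspaceT.
Qed.

Lemma seg_intD a b f g : continuous f -> continuous g ->
  seg_int a b (fun x => f x + g x) = seg_int a b f + seg_int a b g.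
Proof. by move=> cf cg; rewrite /seg_int RintegralD //; exact: seg_integrable. Qed.

Lemma seg_intB a b f g : continuous f -> continuous g ->
  seg_int a b (fun x => f x - g x) = seg_int a b f - seg_int a b g.
Proof. by move=> cf cg; rewrite /seg_int RintegralB //; exact: seg_integrable. Qed.

Lemma seg_intZ a b c f : continuous f ->
  seg_int a b (fun x => c * f x) = c * seg_int a b f.
Proof. by move=> cf; rewrite /seg_int RintegralZl //; exact: seg_integrable. Qed.

Lemma eq_seg_int a b f g : (forall x, a <= x <= b -> f x = g x) ->
  seg_int a b f = seg_int a b g.
Proof.
by move=> fg; apply: eq_Rintegral => x; rewrite inE /= in_itv /=; exact: fg.
Qed.

Lemma le_seg_int a b f g : continuous f -> continuous g ->
  (forall x, a <= x <= b -> f x <= g x) -> seg_int a b f <= seg_int a b g.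
Proof.
move=> cf cg fg; apply: le_Rintegral => //; try exact: seg_integrable.
Qed.

Lemma seg_int_cst a b c : a <= b -> seg_int a b (fun=> c) = c * (b - a).
Proof.
move=> ab; rewrite /seg_int Rintegral_cst //=; congr (_ * _).
rewrite lebesgue_measure_itv /= lte_fin; move: ab; rewrite le_eqVlt.
by case/predU1P => [->|->] //; rewrite ltxx subrr.
Qed.

Lemma seg_int_bound a b c f : a <= b -> continuous f ->
  (forall x, a <= x <= b -> `|f x| <= c) -> `|seg_int a b f| <= c * (b - a).
Proof.
move=> ab cf fc; rewrite -seg_int_cst // ler_norml; apply/andP; split.
  have cc : continuous (fun _ : R => c) by move=> x; exact: cvg_cst.
  rewrite -mulN1r -seg_intZ //.
  have cN : continuous (fun _ : R => -1 * c) by move=> x; exact: cvg_cst.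
  apply: le_seg_int => // x /fc.
  by rewrite ler_norml mulN1r => /andP[].
have cc : continuous (fun _ : R => c) by move=> x; exact: cvg_cst.
by apply: le_seg_int => // x /fc; rewrite ler_norml => /andP[].
Qed.

Lemma seg_int_cat a c b f : continuous f -> a <= c <= b ->
  seg_int a b f = seg_int a c f + seg_int c b f.
Proof.
move=> cf /andP[ac cb]; apply/eqP; rewrite addrC -subr_eq; apply/eqP.
rewrite /seg_int (@Rintegral_itvB _ f (BLeft a) (BRight b) c) //.
- apply: Rintegral_itv_obnd_cbnd; apply: integrableS (seg_integrable c b cf) => //.
  by apply: subset_itv; rewrite bnd_simp.
- exact: seg_integrable.
Qed.

Lemma seg_int_FTC a b f (F : R -> R) : a <= b -> continuous f -> continuous F ->
  (forall x, a < x < b -> is_derive x 1 F (f x)) ->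
  seg_int a b f = F b - F a.
Proof.
rewrite le_eqVlt => /predU1P[->|ab] cf cF dF.
  by rewrite /seg_int set_itv1 Rintegral_set1 subrr.
rewrite /seg_int /Rintegral (@continuous_FTC2 _ f F) //.
- exact: continuous_subspaceT.
- split => //.
  + by move=> x; rewrite in_itv /= => /dF [].
  + exact: cvg_at_right_filter (cF a).
  + exact: cvg_at_left_filter (cF b).
- by move=> x; rewrite in_itv /= => /dF [dx <-]; rewrite derive1E.
Qed.

Definition line_int f : R := \int[mu]_x f x.

Lemma line_intE a b f : (forall x, ~ (a <= x <= b) -> f x = 0) ->
  line_int f = seg_int a b f.
Proof.
move=> f0; rewrite /seg_int /line_int [RHS]Rintegral_mkcond; apply: eq_Rintegral => x _.
rewrite patchE; case: ifPn => //; rewrite notin_setE /= in_itv /= => H.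
by rewrite f0.
Qed.

Lemma line_int0 : line_int (fun=> 0) = 0.
Proof. by rewrite (@line_intE 0 0) // /seg_int set_itv1 Rintegral_set1. Qed.

End OneDim.

(** * Iterated integrals of continuous functions *)

Section ConsRV.
Variable R : realType.

(** The same [row_mx] as in [lebesgue_rV], so that slices of sets and of
    functions agree by computation. *)
Definition cons_rV n (t : R) (y : 'rV[R]_n) : 'rV[R]_n.+1 :=
  row_mx (t%:M : 'rV_1) y.

Definition tail_rV n (y : 'rV[R]_n.+1) : 'rV[R]_n := \row_j y 0 (lift ord0 j).

Lemma cons_rV0 n t (y : 'rV[R]_n) : cons_rV t y 0 ord0 = t.
Proof.
have -> : ord0 = lshift n (ord0 : 'I_1) :> 'I_(1 + n) by apply/val_inj.
by apply: (etrans (row_mxEl (t%:M : 'rV_1) y _ _)); rewrite mxE eqxx mulr1n.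
Qed.

Lemma cons_rVS n t (y : 'rV[R]_n) j : cons_rV t y 0 (lift ord0 j) = y 0 j.
Proof.
have -> : lift ord0 j = rshift 1 j :> 'I_(1 + n) by apply/val_inj.
exact: (row_mxEr (t%:M : 'rV_1) y).
Qed.

Lemma cons_rVK n (y : 'rV[R]_n.+1) : cons_rV (y 0 ord0) (tail_rV y) = y.
Proof.
apply/rowP => j; case: (unliftP ord0 j) => [k ->|->]; last by rewrite cons_rV0.
by rewrite cons_rVS mxE.
Qed.

Lemma cons_rVD n t s (y z : 'rV[R]_n) :
  cons_rV t y + cons_rV s z = cons_rV (t + s) (y + z).
Proof.
apply/rowP => j; rewrite mxE; case: (unliftP ord0 j) => [k ->|->].
  by rewrite !cons_rVS mxE.
by rewrite !cons_rV0.
Qed.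

Lemma cons_rVZ n a t (y : 'rV[R]_n) : a *: cons_rV t y = cons_rV (a * t) (a *: y).
Proof.
apply/rowP => j; rewrite mxE; case: (unliftP ord0 j) => [k ->|->].
  by rewrite !cons_rVS mxE.
by rewrite !cons_rV0.
Qed.

Lemma cons_rVB n t s (y z : 'rV[R]_n) :
  cons_rV t y - cons_rV s z = cons_rV (t - s) (y - z).
Proof. by rewrite -scaleN1r cons_rVZ cons_rVD mulN1r scaleN1r. Qed.

Lemma big_cons_rV n (t : R) (y : 'rV[R]_n) (F : R -> 'I_n.+1 -> R) :
  \sum_j F (cons_rV t y 0 j) j = F t ord0 + \sum_j F (y 0 j) (lift ord0 j).
Proof.
rewrite big_ord_recl cons_rV0; congr (_ + _).
by apply: eq_bigr => j _; rewrite cons_rVS.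
Qed.

Lemma coord_norm n (y : 'rV[R]_n) j : `|y 0 j| <= `|y|.
Proof.
rewrite [leRHS]mx_normrE.
exact: (le_bigmax _ (fun ij => `|y ij.1 ij.2|) (0, j)).
Qed.

Lemma norm_rV_le n (y : 'rV[R]_n) c : 0 <= c -> (forall j, `|y 0 j| <= c) -> `|y| <= c.
Proof.
move=> c0 H; rewrite [leLHS]mx_normrE; apply: bigmax_le => // -[i j] _ /=.
by rewrite ord1.
Qed.

Lemma norm_cons_rV n t (y : 'rV[R]_n) : `|cons_rV t y| = Num.max `|t| `|y|.
Proof.
apply/le_anti/andP; split.
  apply: norm_rV_le => [|j]; first by rewrite le_max normr_ge0.
  case: (unliftP ord0 j) => [k ->|->]; last by rewrite cons_rV0 le_max lexx.
  by rewrite cons_rVS le_max coord_norm orbT.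
rewrite ge_max; apply/andP; split.
  by rewrite -{1}(cons_rV0 t y) coord_norm.
by apply: norm_rV_le => // j; rewrite -(cons_rVS t y j) coord_norm.
Qed.

Lemma continuous_cons_rV n :
  continuous (fun z : R * 'rV[R]_n => cons_rV z.1 z.2).
Proof.
move=> z; apply/cvgrPdist_lt => e e0.
apply: filterS (@nbhs_dist_lt R (R * 'rV[R]_n)%type z e e0) => z'.
by rewrite prod_normE cons_rVB norm_cons_rV.
Qed.

End ConsRV.

Section ContinuousFun.
Variables (R : realType) (U : topologicalType).
Implicit Types f g : U -> R.

Lemma cont_add f g : continuous f -> continuous g -> continuous (fun x => f x + g x).
Proof. by move=> cf cg x; exact: (cvgD (cf x) (cg x)). Qed.

Lemma cont_sub f g : continuous f -> continuous g -> continuous (fun x => f x - g x).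
Proof. by move=> cf cg x; exact: (cvgB (cf x) (cg x)). Qed.

Lemma cont_mul f g : continuous f -> continuous g -> continuous (fun x => f x * g x).
Proof. by move=> cf cg x; exact: (cvgM (cf x) (cg x)). Qed.

Lemma contV_add (W : normedModType R) (f g : U -> W) :
  continuous f -> continuous g -> continuous (fun x => f x + g x).
Proof. by move=> cf cg x; exact: (cvgD (cf x) (cg x)). Qed.

Lemma contV_sub (W : normedModType R) (f g : U -> W) :
  continuous f -> continuous g -> continuous (fun x => f x - g x).
Proof. by move=> cf cg x; exact: (cvgB (cf x) (cg x)). Qed.

Lemma contV_scale (W : normedModType R) (f : U -> R) (g : U -> W) :
  continuous f -> continuous g -> continuous (fun x => f x *: g x).
Proof. by move=> cf cg x; exact: (cvgZ (cf x) (cg x)). Qed.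

Lemma cont_id : continuous (fun x : U => x).
Proof. by move=> x; exact: cvg_id. Qed.

Lemma cont_cst (c : R) : continuous (fun _ : U => c).
Proof. exact: cst_continuous. Qed.

Lemma cont_comp (V W : topologicalType) (f : U -> V) (h : V -> W) :
  continuous f -> continuous h -> continuous (fun x => h (f x)).
Proof. by move=> cf ch x; apply: continuous_comp; [exact: cf|exact: ch]. Qed.

Lemma cont_sum (I : finType) (F : I -> U -> R) :
  (forall i, continuous (F i)) -> continuous (fun x => \sum_i F i x).
Proof.
move=> cF; suff H (s : seq I) : continuous (fun x => \sum_(i <- s) F i x) by exact: H.
elim: s => [|i s IH].
  by under eq_fun do rewrite big_nil; exact: cont_cst.
by under eq_fun do rewrite big_cons; exact: cont_add.
Qed.

End ContinuousFun.

Section IntRV.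
Variable R : realType.

(** Only meant for continuous functions of compact support, on which it is the
    Lebesgue integral: measure theory stays on the line, and exchanging
    integrals becomes a statement about continuous functions on compact sets. *)
Fixpoint int_rV n : ('rV[R]_n -> R) -> R :=
  match n with
  | 0 => fun f => f 0
  | n'.+1 => fun f => int_rV (fun y => line_int (fun t => f (cons_rV t y)))
  end.

(** The bound is in the sup norm, whose balls are boxes, so that slices inherit
    it with the same [M]. *)
Definition csupp n (M : R) (f : 'rV[R]_n -> R) :=
  continuous f /\ forall y, M < `|y| -> f y = 0.

Lemma continuous_comp2 (U V W : topologicalType) (T : topologicalType)
   (g : U -> V) (h : U -> W) (f : V * W -> T) :
  continuous g -> continuous h -> continuous f -> continuous (fun u => f (g u, h u)).
Proof.
move=> cg ch cf u; apply: (@continuous_comp _ _ _ (fun u => (g u, h u)) f); last exact: cf.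
exact: (cvg_pair (cg u) (ch u)).
Qed.

Lemma continuous_swap (U V : topologicalType) (F : U -> V -> R) :
  continuous (fun z : U * V => F z.1 z.2) ->
  continuous (fun z : V * U => F z.2 z.1).
Proof.
move=> cF; apply: (@continuous_comp2 _ _ _ _ snd fst (fun z => F z.1 z.2)) => //.
  by move=> ?; exact: cvg_snd.
by move=> ?; exact: cvg_fst.
Qed.

Lemma continuous_slice2 (U V W : topologicalType) (F : U -> V -> W) u :
  continuous (fun z : U * V => F z.1 z.2) -> continuous (F u).
Proof.
move=> cF; apply: (@continuous_comp2 _ _ _ _ (fun=> u) id (fun z => F z.1 z.2)).
- exact: cst_continuous.
- by move=> ?; exact: cvg_id.
- exact: cF.
Qed.

Lemma csupp_slice_t n M (f : 'rV[R]_n.+1 -> R) t : csupp M f ->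
  csupp M (fun y => f (cons_rV t y)).
Proof.
move=> [cf f0]; split => [y|y My]; last first.
  by apply: f0; rewrite norm_cons_rV lt_max My orbT.
apply: (@continuous_comp2 _ _ _ _ (fun=> t) id (fun z => f (cons_rV z.1 z.2))).
- exact: cst_continuous.
- by move=> ?; exact: cvg_id.
- by move=> z; apply: continuous_comp; [exact: continuous_cons_rV|exact: cf].
Qed.

Lemma continuous_slice_y n M (f : 'rV[R]_n.+1 -> R) y : csupp M f ->
  continuous (fun t => f (cons_rV t y)).
Proof.
move=> [cf f0].
apply: (@continuous_comp2 _ _ _ _ id (fun=> y) (fun z => f (cons_rV z.1 z.2))).
- by move=> ?; exact: cvg_id.
- exact: cst_continuous.
- by move=> z; apply: continuous_comp; [exact: continuous_cons_rV|exact: cf].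
Qed.

Lemma line_int_slice n M (f : 'rV[R]_n.+1 -> R) y : csupp M f ->
  line_int (fun t => f (cons_rV t y)) = seg_int (- M) M (fun t => f (cons_rV t y)).
Proof.
move=> [cf f0]; apply: line_intE => t nM; apply: f0.
rewrite norm_cons_rV lt_max; apply/orP; left; rewrite ltNge ler_norml.
exact/negP.
Qed.

(** Continuity holds because the integral over a segment is Lipschitz for the
    sup norm. *)
Lemma csupp_slice n M (f : 'rV[R]_n.+1 -> R) : 0 <= M -> csupp M f ->
  csupp M (fun y => line_int (fun t => f (cons_rV t y))).
Proof.
move=> M0 cf; split => [|y My]; last first.
  rewrite (_ : (fun t => _) = fun=> 0) ?line_int0 //; apply/funext => t.
  by apply: cf.2; rewrite norm_cons_rV lt_max My orbT.
rewrite (_ : (fun y => _) = (fun y => seg_int (- M) M (fun t => f (cons_rV t y)))); last first.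
  by apply/funext => y; rewrite -line_int_slice.
apply: (@continuous_param _ _ _ (fun y t => f (cons_rV t y)) `[- M, M]
  (seg_int (- M) M) (2 * M)).
- exact: segment_compact.
- move=> z; apply: (@continuous_comp _ _ _ (fun z : 'rV[R]_n * R => cons_rV z.2 z.1)); last exact: cf.1.
  apply: (@continuous_comp2 _ _ _ _ snd fst (fun z : R * 'rV[R]_n => cons_rV z.1 z.2)).
  + by move=> ?; exact: cvg_snd.
  + by move=> ?; exact: cvg_fst.
  + exact: continuous_cons_rV.
- move=> u u' e H; rewrite -seg_intB; try exact: (continuous_slice_y cf).
  rewrite mulrC [2 * M](_ : _ = M - - M); last by ring.
  apply: seg_int_bound; first by lra.
    by apply: cont_sub; exact: continuous_slice_y cf.
  by move=> t tM; apply: H; rewrite /= in_itv.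

Qed.

Lemma csuppD n M (f g : 'rV[R]_n -> R) : csupp M f -> csupp M g ->
  csupp M (fun y => f y + g y).
Proof.
move=> [cf f0] [cg g0]; split => [|y My]; last by rewrite f0 ?g0 ?addr0.
exact: cont_add.
Qed.

Lemma csuppZ n M c (f : 'rV[R]_n -> R) : csupp M f -> csupp M (fun y => c * f y).
Proof.
move=> [cf f0]; split => [|y My]; last by rewrite f0 ?mulr0.
by apply: cont_mul => //; exact: cont_cst.
Qed.

Lemma csuppB n M (f g : 'rV[R]_n -> R) : csupp M f -> csupp M g ->
  csupp M (fun y => f y - g y).
Proof.
move=> [cf f0] [cg g0]; split => [|y My]; last by rewrite f0 ?g0 ?subr0.
exact: cont_sub.
Qed.

Lemma csuppMr n M (f g : 'rV[R]_n -> R) : csupp M f -> continuous g ->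
  csupp M (fun y => f y * g y).
Proof.
move=> [cf f0] cg; split => [|y My]; last by rewrite f0 ?mul0r.
exact: cont_mul.
Qed.

Lemma csupp_le n M N (f : 'rV[R]_n -> R) : M <= N -> csupp M f -> csupp N f.
Proof. by move=> MN [cf f0]; split => // y Ny; apply/f0/(le_lt_trans MN). Qed.

Lemma int_rVD n M (f g : 'rV[R]_n -> R) : 0 <= M -> csupp M f -> csupp M g ->
  int_rV (fun y => f y + g y) = int_rV f + int_rV g.
Proof.
move=> M0; elim: n f g => [//|n IH] f g cf cg /=.
rewrite -IH; try exact: csupp_slice.
congr int_rV; apply/funext => y.
rewrite (line_int_slice y cf) (line_int_slice y cg).
rewrite (line_int_slice y (csuppD cf cg)) seg_intD //;
  by [exact: (continuous_slice_y cf)|exact: (continuous_slice_y cg)].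
Qed.

Lemma int_rVZ n M c (f : 'rV[R]_n -> R) : 0 <= M -> csupp M f ->
  int_rV (fun y => c * f y) = c * int_rV f.
Proof.
move=> M0; elim: n f => [//|n IH] f cf /=.
rewrite -IH; try exact: csupp_slice.
congr int_rV; apply/funext => y.
rewrite (line_int_slice y cf) (line_int_slice y (csuppZ c cf)) seg_intZ //.
exact: (continuous_slice_y cf).
Qed.

Lemma int_rVB n M (f g : 'rV[R]_n -> R) : 0 <= M -> csupp M f -> csupp M g ->
  int_rV (fun y => f y - g y) = int_rV f - int_rV g.
Proof.
move=> M0 cf cg; rewrite -mulN1r -(int_rVZ _ M0 cg) -(int_rVD M0 cf (csuppZ _ cg)).
by congr int_rV; apply/funext => y; rewrite mulN1r.
Qed.

Lemma int_rV0 n : int_rV (fun _ : 'rV[R]_n => 0) = 0.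
Proof.
elim: n => //= n IH; rewrite -[RHS]IH; congr int_rV; apply/funext => y.
by rewrite line_int0.
Qed.

Lemma le_int_rV n M (f g : 'rV[R]_n -> R) : 0 <= M -> csupp M f -> csupp M g ->
  (forall y, f y <= g y) -> int_rV f <= int_rV g.
Proof.
move=> M0; elim: n f g => [f g _ _ fg|n IH f g cf cg fg] /=; first exact: fg.
apply: IH; try exact: csupp_slice.
move=> y; rewrite (line_int_slice y cf) (line_int_slice y cg).
by apply: le_seg_int => //; [exact: (continuous_slice_y cf)|exact: (continuous_slice_y cg)].
Qed.

Lemma int_rV_bound n M C (f : 'rV[R]_n -> R) : 0 <= M -> csupp M f ->
  (forall y, `|f y| <= C) -> `|int_rV f| <= C * (2 * M) ^+ n.
Proof.
move=> M0; elim: n C f => [|n IH] C f cf fC /=; first by rewrite mulr1.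
rewrite exprS mulrA; apply: IH; first exact: csupp_slice.
move=> y; rewrite (line_int_slice y cf) [2 * M](_ : _ = M - - M); last by ring.
apply: seg_int_bound => //; first by lra.
exact: (continuous_slice_y cf).
Qed.

Lemma continuous_int_rV (U : normedModType R) n M (F : U -> 'rV[R]_n -> R) :
  0 <= M -> continuous (fun z : U * 'rV[R]_n => F z.1 z.2) ->
  (forall u y, M < `|y| -> F u y = 0) ->
  continuous (fun u => int_rV (F u)).
Proof.
move=> M0 cF F0.
have cs u : csupp M (F u).
  split; last exact: F0.
  exact: continuous_slice2.
apply: (@continuous_param _ _ _ _ [set y : 'rV[R]_n | `|y| <= M] (@int_rV n) ((2 * M) ^+ n)) => //.
  exact: compact_ball_rV.
move=> u u' e H; rewrite -(int_rVB M0 (cs u) (cs u')) mulrC.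
case: (leP 0 e) => [e0|e0].
  apply: int_rV_bound => //; first exact: csuppB.
  move=> y; have [yM|yM] := leP `|y| M; first exact: H.
  by rewrite !F0 // subrr normr0.
by have := H 0; rewrite /= normr0 => /(_ M0); rewrite leNgt (lt_le_trans e0).
Qed.

Lemma continuous_seg_int (U : normedModType R) a b (F : U -> R -> R) :
  a <= b -> continuous (fun z : U * R => F z.1 z.2) ->
  continuous (fun u => seg_int a b (F u)).
Proof.
move=> ab cF.
have cs u : continuous (F u).
  exact: continuous_slice2.
apply: (@continuous_param _ _ _ _ `[a, b] (seg_int a b) (b - a)) => //.
  exact: segment_compact.
move=> u u' e H; rewrite -seg_intB // mulrC; apply: seg_int_bound => //.
  by apply: cont_sub; exact: cs.

Qed.

End IntRV.

(** * Exchange of integrals *)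

Section Fubini.
Variable R : realType.

Lemma eq0_of_small (x C : R) : (forall e, 0 < e -> `|x| <= e * C) -> x = 0.
Proof.
move=> H; apply/eqP; rewrite -normr_eq0; apply/eqP/le_anti; rewrite normr_ge0 andbT.
have C0 : 0 <= C by have := H 1 ltr01; rewrite mul1r; exact: le_trans.
apply/ler_addgt0Pr => e e0; rewrite add0r.
have C1 : 0 < C + 1 by lra.
apply: le_trans (H (e / (C + 1)) (divr_gt0 e0 C1)) _.
by rewrite mulrAC ler_pdivrMr // ler_pM2l //; lra.
Qed.

(** Fubini for continuous integrands. The defect [D x x'] of the exchange on a
    segment is additive. On a short segment uniform continuity lets [F v] be
    replaced by [F x] at a cost [e], and the exchange is exact for a constant;
    summing, the defect on the whole segment is at most a multiple of every [e]. *)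
Lemma int_rV_seg n M a b (F : R -> 'rV[R]_n -> R) : 0 <= M -> a <= b ->
  continuous (fun z : R * 'rV[R]_n => F z.1 z.2) ->
  (forall v y, M < `|y| -> F v y = 0) ->
  seg_int a b (fun v => int_rV (F v)) = int_rV (fun y => seg_int a b (F^~ y)).
Proof.
move=> M0 ab cF F0.
have cF2 y : continuous (F^~ y).
  by apply: (@continuous_slice2 _ _ _ (fun y v => F v y)); exact: continuous_swap.
have csF v : csupp M (F v) by split; [exact: continuous_slice2|exact: F0].
have csS x x' : x <= x' -> csupp M (fun y => seg_int x x' (F^~ y)).
  move=> xx'; split => [|y My].
    by apply: (@continuous_seg_int _ _ _ _ (fun y v => F v y)) => //; exact: continuous_swap.
  rewrite (@eq_seg_int _ _ _ _ (fun=> 0)) ?seg_int_cst ?mul0r // => v _.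
  exact: F0.
have cI : continuous (fun v => int_rV (F v)) by exact: (continuous_int_rV M0).
pose D x x' := seg_int x x' (fun v => int_rV (F v)) -
  int_rV (fun y => seg_int x x' (F^~ y)).
have Dadd x y z : x <= y <= z -> D x z = D x y + D y z.
  move=> /andP[xy yz]; rewrite /D (@seg_int_cat _ x y z) ?xy //.
  have -> : (fun y0 => seg_int x z (F^~ y0)) =
      (fun y0 => seg_int x y (F^~ y0) + seg_int y z (F^~ y0)).
    by apply/funext => u; rewrite (@seg_int_cat _ x y z) ?xy.
  by rewrite (int_rVD M0 (csS _ _ xy) (csS _ _ yz)); ring.
suff : D a b = 0 by move/eqP; rewrite subr_eq0 => /eqP.
apply: (@eq0_of_small _ (2 * (2 * M) ^+ n * (b - a))) => e e0.
have [d d0 Hd] := unif_param (@segment_compact _ a b) (@compact_ball_rV R n M) cF e0.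
have Hd' v v' y : a <= v <= b -> `|v - v'| < d -> `|F v' y - F v y| <= e.
  move=> vab vv'; have [yM|yM] := leP `|y| M; last by rewrite !F0 // subrr normr0 ltW.
  by rewrite distrC; apply/ltW/Hd => //=; rewrite in_itv.
have small x x' : a <= x -> x <= x' -> x' <= b -> x' - x < d ->
    `|D x x'| <= e * (2 * (2 * M) ^+ n * (x' - x)).
  move=> ax xx' x'b x'xd.
  have near_x v : x <= v <= x' -> `|x - v| < d.
    move=> /andP[xv vx']; rewrite distrC ger0_norm ?subr_ge0 //; lra.
  have xab : a <= x <= b by rewrite ax (le_trans xx').
  have -> : D x x' = seg_int x x' (fun v => int_rV (F v) - int_rV (F x)) -
     int_rV (fun y => seg_int x x' (fun v => F v y - F x y)).
    rewrite /D seg_intB //; last exact: cont_cst.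
    rewrite seg_int_cst // -[int_rV (F x) * _]mulrC -(int_rVZ _ M0) //.
    have -> : (fun y => seg_int x x' (fun v => F v y - F x y)) =
       (fun y => seg_int x x' (F^~ y) - (x' - x) * F x y).
      apply/funext => y; rewrite seg_intB //; last exact: cont_cst.
      by rewrite seg_int_cst // [F x y * _]mulrC.
    by rewrite (int_rVB M0 (csS _ _ xx') (csuppZ (x' - x) (csF x))); ring.
  apply: le_trans (ler_normB _ _) _.
  have -> : e * (2 * (2 * M) ^+ n * (x' - x)) = e * (2 * M) ^+ n * (x' - x) +
     e * (x' - x) * (2 * M) ^+ n by ring.
  apply: lerD.
    apply: seg_int_bound => //; first by apply: cont_sub => //; exact: cont_cst.
    move=> v vx; rewrite -(int_rVB M0 (csF v) (csF x)); apply: int_rV_bound => //.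
      exact: csuppB.
    by move=> y; apply: Hd' => //; exact: near_x.
  apply: int_rV_bound => //.
    split => [|y My].
      apply: (@continuous_seg_int _ _ _ _ (fun y v => F v y - F x y)) => //.
      apply: cont_sub; first exact: continuous_swap.
      apply: (@cont_comp _ _ _ fst) => //; last exact: (csF x).1.
      by move=> ?; exact: cvg_fst.
    rewrite (@eq_seg_int _ _ _ _ (fun=> 0)) ?seg_int_cst ?mul0r // => v _.
    by rewrite !F0 // subrr.
  move=> y; apply: seg_int_bound => //.
    by apply: cont_sub => //; exact: cont_cst.
  by move=> v vx; apply: Hd' => //; exact: near_x.
pose N := (Num.trunc ((b - a) / d)).+1.
pose s := (b - a) / N%:R.
have N0 : 0 < N%:R :> R by rewrite ltr0n.
have s0 : 0 <= s by rewrite divr_ge0 ?subr_ge0 // ltW.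
have Ns : N%:R * s = b - a by rewrite /s mulrC divfK ?gt_eqF.
have sd : s < d.
  rewrite /s ltr_pdivrMr // mulrC -ltr_pdivrMr //.
  by apply: truncnS_gt.
have step k : (k <= N)%N -> `|D a (a + k%:R * s)| <= e * (2 * (2 * M) ^+ n * (k%:R * s)).
  have kb j : (j <= N)%N -> a + j%:R * s <= b.
    move=> jN; have : j%:R * s <= N%:R * s by rewrite ler_wpM2r // ler_nat.
    by rewrite Ns; lra.
  elim: k => [_|k IH kN].
    rewrite mul0r addr0 mulr0 mulr0 /D /seg_int set_itv1 Rintegral_set1.
    rewrite (_ : (fun y => _) = fun=> 0); last first.
      by apply/funext => y; rewrite Rintegral_set1.
    by rewrite int_rV0 subrr normr0.
  have ks0 : 0 <= k%:R * s by rewrite mulr_ge0.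
  have E : a + k.+1%:R * s = a + k%:R * s + s by rewrite -natr1; ring.
  rewrite (@Dadd _ (a + k%:R * s)) ?E ?lerDl ?ks0 ?s0 //.
  apply: le_trans (ler_normD _ _) _.
  apply: le_trans (lerD (IH (ltnW kN)) (@small _ _ _ _ _ _)) _.
  - by rewrite lerDl.
  - by rewrite lerDl.
  - by rewrite -E kb.
  - by rewrite addrC addKr.
  by rewrite le_eqVlt; apply/orP; left; apply/eqP; rewrite -natr1; ring.
have := step N (leqnn N).
by rewrite Ns addrC subrK.
Qed.

End Fubini.

(** * Translations and linear changes of variables *)

Section Invariance.
Variable R : realType.

Lemma seg_int_affine (a b l c : R) (g : R -> R) : 0 < l -> a <= b -> continuous g ->
  seg_int (l * a + c) (l * b + c) g = l * seg_int a b (fun x => g (l * x + c)).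
Proof.
move=> l0 ab cg.
have dF (x : R) : is_derive x 1 (fun x : R => l * x + c) l.
  apply: isd_eq (isd_add (isd_mul (isd_cst x 1 l) (isd_id x 1)) (isd_cst x 1 c)) _.
  by rewrite mul0r mulr1 addr0 add0r.
have F' : (fun x : R => l * x + c)^`()%classic = cst l.
  by apply/funext => x; rewrite derive1E; apply: derive_val; exact: dF.
have cF : continuous (fun x : R => l * x + c).
  by apply: cont_add; [apply: cont_mul => //; [exact: cont_cst|by move=> ?; exact: cvg_id]|exact: cont_cst].
rewrite -seg_intZ; last exact: cont_comp.
rewrite /seg_int /Rintegral.
rewrite (@integration_by_substitution_increasing _ (fun x : R => l * x + c) g a b) //.
- congr fine; apply: eq_integral => x _; rewrite F' /=.
  by rewrite /GRing.mul_fun /= mulrC.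
- by move=> x y _ _ xy; rewrite ltrD2r ltr_pM2l.
- by rewrite F' => x _; exact: cst_continuous.
- by rewrite F'; apply: is_cvg_cst.
- by rewrite F'; apply: is_cvg_cst.
- split => [x _||]; first by case: (dF x).
  + exact: cvg_at_right_filter (cF a).
  + exact: cvg_at_left_filter (cF b).
- exact: continuous_subspaceT.
Qed.

Lemma line_int_translation M c (g : R -> R) : 0 <= M -> continuous g ->
  (forall x, M < `|x| -> g x = 0) ->
  line_int (fun x => g (x + c)) = line_int g.
Proof.
move=> M0 cg g0; have Z x : ~ (- M <= x <= M) -> g x = 0.
  by move=> /negP; rewrite -ler_norml -ltNge; exact: g0.
rewrite (line_intE Z) (@line_intE _ (- M - c) (M - c)).
  have h : - M - c <= M - c by lra.
  have := seg_int_affine c ltr01 h cg.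
  rewrite !mul1r !subrK => ->; apply: eq_seg_int => x _.
  by rewrite mul1r.
move=> x nx; apply: Z => xM; apply: nx; lra.
Qed.

Lemma csupp_translation n M (f : 'rV[R]_n -> R) a : csupp M f ->
  csupp (M + `|a|) (fun y => f (y + a)).
Proof.
move=> [cf f0]; split => [|y My].
  by apply: (cont_comp _ cf); apply: contV_add; [exact: cont_id|exact: cst_continuous].
apply: f0; have := ler_normB (y + a) a; rewrite addrK; lra.
Qed.

Lemma cons_rV_split n (a : 'rV[R]_n.+1) t y :
  cons_rV t y + a = cons_rV (t + a 0 ord0) (y + tail_rV a).
Proof. by rewrite -{1}(cons_rVK a) cons_rVD. Qed.

Lemma int_rV_translation n M (f : 'rV[R]_n -> R) a : 0 <= M -> csupp M f ->
  int_rV (fun y => f (y + a)) = int_rV f.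
Proof.
move=> M0; elim: n f a => [|n IH] f a cf /=.
  by congr f; apply/rowP => -[].
rewrite -[RHS](IH _ (tail_rV a)); last exact: csupp_slice.
congr int_rV; apply/funext => y.
rewrite -[RHS](@line_int_translation M (a 0 ord0)) //.
- by congr line_int; apply/funext => t; rewrite cons_rV_split.
- exact: (continuous_slice_y cf).
- by move=> x Mx; apply: cf.2; rewrite norm_cons_rV lt_max Mx.
Qed.

Lemma int_rV_line n M (F : R -> 'rV[R]_n -> R) : 0 <= M ->
  continuous (fun z : R * 'rV[R]_n => F z.1 z.2) ->
  (forall t y, M < `|t| -> F t y = 0) ->
  (forall t y, M < `|y| -> F t y = 0) ->
  line_int (fun t => int_rV (F t)) = int_rV (fun y => line_int (F^~ y)).
Proof.
move=> M0 cF Ft Fy.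
have Z t : ~ (- M <= t <= M) -> M < `|t|.
  by move=> /negP; rewrite -ler_norml -ltNge.
rewrite (@line_intE _ (- M) M); last first.
  move=> t /Z Mt; rewrite (_ : F t = fun=> 0) ?int_rV0 //.
  by apply/funext => y; rewrite Ft.
rewrite (@int_rV_seg _ _ M) //; last by lra.
congr int_rV; apply/funext => y; apply/esym/line_intE => t /Z Mt.
by rewrite Ft.
Qed.

(** Induction on the second dimension: [int_rV_line] commutes one coordinate at
    a time past the other integral. *)
Lemma int_rV_swap n k M (F : 'rV[R]_n -> 'rV[R]_k -> R) : 0 <= M ->
  continuous (fun z : 'rV[R]_n * 'rV[R]_k => F z.1 z.2) ->
  (forall x y, M < `|x| -> F x y = 0) ->
  (forall x y, M < `|y| -> F x y = 0) ->
  int_rV (fun y => int_rV (F^~ y)) = int_rV (fun x => int_rV (F x)).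
Proof.
move=> M0; elim: k F => [//|k IH] F cF Fx Fy.
pose G x y := line_int (fun s => F x (cons_rV s y)).
have cF3 : continuous (fun z : 'rV[R]_n * (R * 'rV[R]_k) => F z.1 (cons_rV z.2.1 z.2.2)).
  apply: (@continuous_comp2 _ _ _ _ fst (fun z => cons_rV z.2.1 z.2.2) (fun z => F z.1 z.2)) => //.
    by move=> ?; exact: cvg_fst.
  apply: (@cont_comp _ _ _ snd (fun z : R * 'rV[R]_k => cons_rV z.1 z.2)).
    by move=> ?; exact: cvg_snd.
  exact: continuous_cons_rV.
have Z t : ~ (- M <= t <= M) -> M < `|t|.
  by move=> /negP; rewrite -ler_norml -ltNge.
have GE x y : G x y = seg_int (- M) M (fun s => F x (cons_rV s y)).
  by apply: line_intE => t /Z Mt; apply: Fy; rewrite norm_cons_rV lt_max Mt.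
have G0 := @line_int0 R.
transitivity (int_rV (fun y => int_rV (G^~ y))).
  rewrite /=; congr int_rV; apply/funext => y.
  apply: (@int_rV_line _ M (fun s x => F x (cons_rV s y))) => //.
  - apply: (@continuous_comp2 _ _ _ _ snd (fun z => (z.1, y)) (fun z => F z.1 (cons_rV z.2.1 z.2.2))) => //.
      by move=> ?; exact: cvg_snd.
    apply: (@continuous_comp2 _ _ _ _ fst (fun=> y) id).
    + by move=> ?; exact: cvg_fst.
    + exact: cst_continuous.
    + by move=> ?; exact: cvg_id.
  - by move=> t x Mt; apply: Fy; rewrite norm_cons_rV lt_max Mt.
  - by move=> t x Mx; exact: Fx.
rewrite IH //.
- rewrite (_ : (fun z => _) = (fun z => seg_int (- M) M (fun s => F z.1 (cons_rV s z.2)))); last first.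
    by apply/funext => z; rewrite GE.
  apply: (@continuous_seg_int _ ('rV[R]_n * 'rV[R]_k)%type _ _ (fun z s => F z.1 (cons_rV s z.2))).
    by lra.
  apply: (@continuous_comp2 _ _ _ _ (fun z => z.1.1) (fun z => (z.2, z.1.2)) (fun z => F z.1 (cons_rV z.2.1 z.2.2))) => //.
    by move=> z; apply: (@continuous_comp _ _ _ fst fst); exact: cvg_fst.
  apply: (@continuous_comp2 _ _ _ _ snd (fun z => z.1.2) id).
  + by move=> ?; exact: cvg_snd.
  + by move=> z; apply: (@continuous_comp _ _ _ fst snd); [exact: cvg_fst|exact: cvg_snd].
  + by move=> ?; exact: cvg_id.
- move=> x y Mx; rewrite /G (_ : (fun s => _) = fun=> 0) //.
  by apply/funext => s; rewrite Fx.
- move=> x y My; rewrite /G (_ : (fun s => _) = fun=> 0) //.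
  by apply/funext => s; rewrite Fy // norm_cons_rV lt_max My orbT.
Qed.

(** Uniqueness of a translation invariant integral, in the form used to change
    variables. The double integrals of f(A y) g(A y - x) and of
    g(A y) f(x + A y) agree, since for fixed [x] the integrands are translates
    of each other by [B x]; integrated in [x] first they are the two sides.
    Testing with a [g] whose two integrals are known yields the Jacobian. *)
Lemma int_rV_linear n M c (A B : 'rV[R]_n -> 'rV[R]_n) (f g : 'rV[R]_n -> R) :
  0 <= M -> 0 <= c -> csupp M f -> csupp M g -> (forall y, g (- y) = g y) ->
  (forall x y, A (x - y) = A x - A y) -> cancel A B -> cancel B A ->
  continuous A -> (forall y, `|B y| <= c * `|y|) ->
  int_rV (fun y => f (A y)) * int_rV g = int_rV f * int_rV (fun y => g (A y)).
Proof.
move=> M0 c0 cf cg gN AB AK BK cA Bc.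
pose M' := (c + 2) * M.
have M'0 : 0 <= M' by rewrite mulr_ge0 // addr_ge0.
have MM' : M <= M' by rewrite ler_peMl //; lra.
have Ay y : M' < `|y| -> M < `|A y|.
  move=> My; rewrite ltNge; apply/negP => AM.
  have := Bc (A y); rewrite AK => yc.
  have : c * `|A y| <= c * M by rewrite ler_wpM2l.
  by move: My; rewrite /M'; lra.
have csA (h : 'rV[R]_n -> R) : csupp M h -> csupp M' (fun y => h (A y)).
  by move=> [ch h0]; split => [|y /Ay /h0 //]; exact: cont_comp.
have cN (h : 'rV[R]_n -> R) : continuous h -> continuous (fun z : 'rV[R]_n * 'rV[R]_n => h (A z.2)).
  move=> ch; apply: (@cont_comp _ _ _ (fun z => A z.2)) => //.
  by apply: (@cont_comp _ _ _ snd) => // z; exact: cvg_snd.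
pose F1 (x y : 'rV[R]_n) := g (A y) * f (x + A y).
pose F2 (x y : 'rV[R]_n) := f (A y) * g (A y - x).
have cAs (s : R) : continuous (fun z : 'rV[R]_n * 'rV[R]_n => A z.2 + s *: z.1).
  apply: contV_add; last first.
    by apply: contV_scale; [exact: cst_continuous|move=> z; exact: cvg_fst].
  by apply: (@cont_comp _ _ _ snd A) => // z; exact: cvg_snd.
have bd x y : 2 * M < `|x| -> M < `|x + A y| \/ M < `|A y|.
  move=> Mx; case: (ltP M `|A y|); [by right|move=> AM; left].
  by have := ler_normB (x + A y) (A y); rewrite addrK; lra.
have M'2 : 2 * M <= M' by rewrite /M'; have := mulr_ge0 c0 M0; lra.
have swap1 := @int_rV_swap n n M' F1 M'0.
have swap2 := @int_rV_swap n n M' F2 M'0.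
(* the evenness of [g] gives the integral of [F2 x y] in [x] *)
transitivity (int_rV (fun y => int_rV (F2^~ y))).
  rewrite mulrC -(int_rVZ _ M'0 (csA _ cf)); congr int_rV; apply/funext => y.
  rewrite /F2 (@int_rVZ _ _ (M + `|- A y|)); last 2 first.
  - by rewrite addr_ge0.
  - rewrite (_ : (fun x => _) = (fun x => g (x + - A y))); first exact: csupp_translation.
    by apply/funext => x; rewrite -gN opprB.
  rewrite mulrC; congr (_ * _).
  rewrite -(int_rV_translation (- A y) M0 cg); congr int_rV; apply/funext => x.
  by rewrite -gN opprB.
transitivity (int_rV (fun y => int_rV (F1^~ y))); last first.
  rewrite -(int_rVZ _ M'0 (csA _ cg)); congr int_rV; apply/funext => y.
  rewrite /F1 (@int_rVZ _ _ (M + `|A y|)); last 2 first.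
  - by rewrite addr_ge0.
  - exact: csupp_translation.
  rewrite mulrC; congr (_ * _).
  exact: (int_rV_translation (A y) M0 cf).
rewrite swap1; last 3 first.
- apply: cont_mul; first exact: cN cg.1.
  rewrite (_ : (fun z => _) = (fun z => f (A z.2 + 1 *: z.1))); last first.
    by apply/funext => z; rewrite scale1r addrC.
  by apply: (cont_comp _ cf.1); exact: cAs.
- move=> x y Mx; rewrite /F1.
  case: (bd x y) => [|Mxy|My]; [exact: le_lt_trans Mx|by rewrite cf.2 // mulr0|].
  by rewrite cg.2 // mul0r.
- by move=> x y My; rewrite /F1 cg.2 ?mul0r //; exact: Ay.
rewrite swap2; last 3 first.
- apply: cont_mul; first exact: cN cf.1.
  rewrite (_ : (fun z => _) = (fun z => g (A z.2 + (-1) *: z.1))); last first.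
    by apply/funext => z; rewrite scaleN1r.
  by apply: (cont_comp _ cg.1); exact: cAs.
- move=> x y Mx; rewrite /F2; have := bd (- x) y; rewrite normrN addrC.
  case => [|Mxy|My]; [exact: le_lt_trans Mx|by rewrite cg.2 // mulr0|].
  by rewrite cf.2 // mul0r.
- by move=> x y My; rewrite /F2 cf.2 ?mul0r //; exact: Ay.
congr int_rV; apply/funext => x.
rewrite -(@int_rV_translation _ M' (F1 x) (- B x)) //.
  congr int_rV; apply/funext => y; rewrite /F1 /F2 AB BK.
  by rewrite mulrC [x + _]addrC subrK.
split; last by move=> y My; rewrite /F1 cg.2 ?mul0r //; exact: Ay.
apply: cont_mul; first exact: (cont_comp cA cg.1).
by apply: (cont_comp _ cf.1); apply: contV_add => //; exact: cst_continuous.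
Qed.

End Invariance.

(** * Partial derivatives, isometries and radial bumps *)

Section Partial.
Variable R : realType.

Lemma delta_rV0 n : delta_mx 0 ord0 = cons_rV 1 0 :> 'rV[R]_n.+1.
Proof.
apply/rowP => j; rewrite mxE eqxx /=; case: (unliftP ord0 j) => [k ->|->].
  by rewrite cons_rVS mxE.
by rewrite cons_rV0 eqxx.
Qed.

Lemma delta_rVS n (i : 'I_n) : delta_mx 0 (lift ord0 i) = cons_rV 0 (delta_mx 0 i) :> 'rV[R]_n.+1.
Proof.
apply/rowP => j; rewrite mxE eqxx /=; case: (unliftP ord0 j) => [k ->|->].
  by rewrite cons_rVS mxE eqxx (inj_eq lift_inj).
by rewrite cons_rV0.
Qed.

(** Integrating along the coordinate of differentiation first, a compactly
    supported partial derivative integrates to zero. *)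
Lemma int_rV_partial n M (j : 'I_n) (F F1 : 'rV[R]_n -> R) : 0 <= M ->
  csupp M F -> csupp M F1 ->
  (forall y, is_derive y (delta_mx 0 j) F (F1 y)) -> int_rV F1 = 0.
Proof.
move=> M0; elim: n j F F1 => [[]//|n IH] j F F1 cF cF1 dF.
case: (unliftP ord0 j) => [i ji|j0]; last first.
  rewrite /= -[RHS](@int_rV0 R n); congr int_rV; apply/funext => y.
  have MM : - (M + 1) <= M + 1 by lra.
  have cF1' := csupp_le (ler_wpDr ler01 (lexx M)) cF1.
  rewrite (line_int_slice y cF1').
  have -> : seg_int (- (M + 1)) (M + 1) (fun t => F1 (cons_rV t y)) =
      F (cons_rV (M + 1) y) - F (cons_rV (- (M + 1)) y).
    apply: (@seg_int_FTC _ _ _ _ (fun t => F (cons_rV t y))) => //.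
    - exact: (continuous_slice_y cF1).
    - exact: (continuous_slice_y cF).
    - move=> t _; apply: isd_line (dF (cons_rV t y)) => h.
      by rewrite j0 delta_rV0 cons_rVZ cons_rVD scaler0 add0r.
  have MM1 : M < `|M + 1| by rewrite ger0_norm ?ltrDl //; lra.
  by rewrite !cF.2 ?subrr // norm_cons_rV lt_max ?normrN MM1.
have F1l : continuous (fun z : R * 'rV[R]_n => F1 (cons_rV z.1 z.2)).
  by apply: cont_comp cF1.1; exact: continuous_cons_rV.
rewrite /= -(@int_rV_line _ _ M (fun t y => F1 (cons_rV t y))) //.
- rewrite (_ : (fun t => _) = fun=> 0); last first.
    apply/funext => t; apply: (IH i (fun y => F (cons_rV t y))).
    + exact: csupp_slice_t.
    + exact: csupp_slice_t.
    + move=> y; apply: isd_line (dF (cons_rV t y)) => h.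
      by rewrite ji delta_rVS cons_rVZ cons_rVD mulr0 add0r.
  by rewrite line_int0.
- by move=> t y Mt; apply: cF1.2; rewrite norm_cons_rV lt_max Mt.
- by move=> t y Mt; apply: cF1.2; rewrite norm_cons_rV lt_max Mt orbT.
Qed.

End Partial.

Section Bumps.
Variable R : realType.

Definition dot n (y w : 'rV[R]_n) : R := \sum_j y 0 j * w 0 j.
Definition sq n (y : 'rV[R]_n) : R := \sum_j y 0 j ^+ 2.

Lemma sq_cons n t (y : 'rV[R]_n) : sq (cons_rV t y) = t ^+ 2 + sq y.
Proof. by rewrite /sq (big_cons_rV t y (fun x _ => x ^+ 2)). Qed.

Lemma sq_ge0 n (y : 'rV[R]_n) : 0 <= sq y.
Proof. by apply: sumr_ge0 => j _; exact: sqr_ge0. Qed.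

Lemma sqE n (y : 'rV[R]_n) : sq y = dot y y.
Proof. by apply: eq_bigr => j _; rewrite expr2. Qed.

Lemma coord_sq n (y : 'rV[R]_n) j : y 0 j ^+ 2 <= sq y.
Proof. by rewrite /sq (bigD1 j) //= lerDl; apply: sumr_ge0 => i _; exact: sqr_ge0. Qed.

Lemma norm_le_sqrt_sq n (y : 'rV[R]_n) : `|y| <= Num.sqrt (sq y).
Proof.
apply: norm_rV_le => [|j]; first exact: sqrtr_ge0.
by rewrite -sqrtr_sqr ler_sqrt ?coord_sq // sq_ge0.
Qed.

Lemma sqrt_sq_le_norm n (y : 'rV[R]_n) : Num.sqrt (sq y) <= n%:R * `|y|.
Proof.
rewrite -[leRHS]ger0_norm ?mulr_ge0 // -sqrtr_sqr ler_sqrt ?sqr_ge0 //.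
apply: (@le_trans _ _ (\sum_(j < n) `|y| ^+ 2)).
  apply: ler_sum => j _; rewrite -real_normK ?num_real //.
  by rewrite lerXn2r ?nnegrE //; exact: coord_norm.
rewrite sumr_const card_ord -[leLHS]mulr_natl exprMn.
rewrite ler_wpM2r ?sqr_ge0 // -natrX ler_nat.
by case: n {y} => // n; rewrite leq_pmull.
Qed.

Lemma cont_coord n j : continuous (fun y : 'rV[R]_n => y 0 j).
Proof. exact: coord_continuous. Qed.

Lemma cont_exp (U : topologicalType) (f : U -> R) k : continuous f ->
  continuous (fun x => f x ^+ k).
Proof.
move=> cf; apply: (@cont_comp _ _ _ f (fun x : R => x ^+ k)) => // x.
exact: exprn_continuous.
Qed.

Lemma cont_sq n : continuous (@sq n).
Proof.
apply: (@cont_sum _ _ _ (fun j (y : 'rV[R]_n) => y 0 j ^+ 2)) => j.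
by apply: cont_exp; exact: cont_coord.
Qed.

Lemma cont_dot n w : continuous (fun y : 'rV[R]_n => dot y w).
Proof.
apply: (@cont_sum _ _ _ (fun j (y : 'rV[R]_n) => y 0 j * w 0 j)) => j.
by apply: cont_mul; [exact: cont_coord|exact: cont_cst].
Qed.

Definition beta k : R := seg_int (-1) 1 (fun t => Num.sqrt (1 - t ^+ 2) ^+ k).

(** The radial functions (rho - |y|^2)_+^(k/2): the square root supplies the
    positive part. *)
Definition bump n k (rho : R) (y : 'rV[R]_n) : R := Num.sqrt (rho - sq y) ^+ k.

Lemma cont_sqrt_exp (U : topologicalType) (f : U -> R) k : continuous f ->
  continuous (fun x => Num.sqrt (f x) ^+ k).
Proof.
move=> cf; apply: cont_exp; apply: (@cont_comp _ _ _ f (@Num.sqrt R)) => // x.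
exact: sqrt_continuous.
Qed.

Lemma cont_bump n k rho : continuous (@bump n k rho).
Proof. by apply/cont_sqrt_exp/cont_sub; [exact: cont_cst|exact: cont_sq]. Qed.

Lemma csupp_bump n k rho : csupp (Num.sqrt rho) (@bump n k.+1 rho).
Proof.
split; first exact: cont_bump.
move=> y rhoy; rewrite /bump ler0_sqrtr ?expr0n // subr_le0.
have H := lt_le_trans rhoy (norm_le_sqrt_sq y).
have s0 : 0 < sq y by rewrite -sqrtr_gt0 (le_lt_trans _ H) // sqrtr_ge0.
by rewrite ltr_sqrt // in H; exact: ltW.
Qed.

Lemma seg_int_bump k rho : 0 < rho ->
  seg_int (- Num.sqrt rho) (Num.sqrt rho) (fun t => Num.sqrt (rho - t ^+ 2) ^+ k) =
  Num.sqrt rho ^+ k.+1 * beta k.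
Proof.
move=> r0; set s := Num.sqrt rho; have sgt0 : 0 < s by rewrite sqrtr_gt0.
have cc (c : R) : continuous (fun t : R => Num.sqrt (c - t ^+ 2) ^+ k).
  by apply/cont_sqrt_exp/cont_sub; [exact: cont_cst|apply: cont_exp; exact: cont_id].
have h : (-1 : R) <= 1 by lra.
have := seg_int_affine 0 sgt0 h (cc rho).
rewrite !addr0 mulrN1 mulr1 => ->.
rewrite exprS -mulrA; congr (_ * _); rewrite /beta -seg_intZ //.
apply: eq_seg_int => t _.
rewrite -exprMn -sqrtrM; last exact: ltW.
congr (Num.sqrt _ ^+ _); rewrite addr0 exprMn sqr_sqrtr; last exact: ltW.
by ring.
Qed.

Lemma line_int_bump k rho :
  line_int (fun t => Num.sqrt (rho - t ^+ 2) ^+ k.+1) =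
  Num.sqrt rho ^+ k.+2 * beta k.+1.
Proof.
set s := Num.sqrt rho.
have s0 : 0 <= s by exact: sqrtr_ge0.
have Z t : ~ (- s <= t <= s) -> Num.sqrt (rho - t ^+ 2) ^+ k.+1 = 0.
  move=> /negP; rewrite -ler_norml -ltNge => st.
  rewrite ler0_sqrtr ?expr0n // subr_le0 -real_normK ?num_real //.
  have [r0|r0] := leP rho 0; first by rewrite (le_trans r0) ?sqr_ge0.
  by rewrite -[leLHS]sqr_sqrtr ?(ltW r0) // lerXn2r ?nnegrE // ltW.
rewrite (line_intE Z).
have [r0|r0] := leP rho 0; last exact: seg_int_bump.
rewrite /s ler0_sqrtr // oppr0 /seg_int set_itv1 Rintegral_set1.
by rewrite expr0n mul0r.
Qed.

(** Integrating out one coordinate of (rho - |y|^2)_+^(k/2) leaves a function of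
    the same kind with [k] raised by one. *)
Lemma int_bump n k rho : int_rV (@bump n k.+1 rho) =
  Num.sqrt rho ^+ (k.+1 + n) * \prod_(j < n) beta (k.+1 + j)%N.
Proof.
elim: n k rho => [|n IH] k rho.
  by rewrite /= big_ord0 mulr1 addn0 /bump /sq big_ord0 subr0.
rewrite /= (_ : (fun y => _) = (fun y => beta k.+1 * bump k.+2 rho y)); last first.
  apply/funext => y; rewrite mulrC -line_int_bump; congr line_int.
  by apply/funext => t; rewrite /bump sq_cons opprD addrCA addrC [_ - sq y]addrC addrAC addrC [- sq y + _]addrC.
rewrite (int_rVZ _ (sqrtr_ge0 rho)) ?IH; last exact: csupp_bump.
rewrite big_ord_recl addn0 addSnnS mulrCA; congr (_ * (_ * _)).
by apply: eq_bigr => j _; rewrite /bump /= addSnnS.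
Qed.

Lemma beta_gt0 k : 0 < beta k.
Proof.
have cf : continuous (fun t : R => Num.sqrt (1 - t ^+ 2) ^+ k).
  by apply/cont_sqrt_exp/cont_sub; [exact: cont_cst|apply: cont_exp; exact: cont_id].
have f0 a b : a <= b -> 0 <= seg_int a b (fun t : R => Num.sqrt (1 - t ^+ 2) ^+ k).
  move=> ab; rewrite -(mul0r (b - a)) -seg_int_cst //; apply: le_seg_int => //.
  exact: cont_cst.
rewrite /beta (@seg_int_cat _ _ 0) //; last by lra.
apply: ltr_wpDl; first by apply: f0; lra.
rewrite (@seg_int_cat _ _ (2^-1)) //; last by lra.
apply: ltr_pwDl; last by apply: f0; lra.
apply: (@lt_le_trans _ _ ((2^-1) ^+ k * (2^-1 - 0))).
  by rewrite mulr_gt0 ?exprn_gt0 //; lra.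
rewrite -seg_int_cst; last by lra.
apply: le_seg_int => //; first exact: cont_cst.
move=> t tt; rewrite lerXn2r ?nnegrE ?sqrtr_ge0 //.
rewrite -[leLHS]ger0_norm // -sqrtr_sqr ler_sqrt; nra.
Qed.

(** The derivative of t (1 - t^2)^((k+2)/2) combines the two integrands, and
    this function vanishes at both ends. *)
Lemma beta_rec k : (k + 3)%:R * beta k.+2 = (k + 2)%:R * beta k.
Proof.
have cf j : continuous (fun t : R => Num.sqrt (1 - t ^+ 2) ^+ j).
  by apply/cont_sqrt_exp/cont_sub; [exact: cont_cst|apply: cont_exp; exact: cont_id].
rewrite /beta -!seg_intZ //; apply/eqP; rewrite -subr_eq0 -seg_intB; last 2 first.
- by apply: cont_mul => //; exact: cont_cst.
- by apply: cont_mul => //; exact: cont_cst.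
pose F (t : R) := t * Num.sqrt (1 - t ^+ 2) ^+ k.+2.
apply/eqP; transitivity (F 1 - F (-1)); last first.
  by rewrite /F sqrrN expr1n subrr sqrtr0 !expr0n /= !mulr0 subrr.
apply: seg_int_FTC.
- by lra.
- by apply: cont_sub; apply: cont_mul => //; exact: cont_cst.
- by apply: cont_mul => //; exact: cont_id.
move=> t tt.
have t0 : 0 < 1 - t ^+ 2 by nra.
have s0 : 0 < Num.sqrt (1 - t ^+ 2) by rewrite sqrtr_gt0.
have d1 : is_derive t 1 (fun t : R => 1 - t ^+ 2) (- (2 * t)).
  by apply: isd_eq (isd_sub (isd_cst _ _ _) (isd_exp _ _)) _; rewrite sub0r expr1.
have d2 := isd_comp d1 (is_derive1_sqrt t0).
have d3 := isd_comp d2 (isd_exp k.+2 _).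
apply: isd_eq (isd_mul (isd_id t 1) d3) _.
have E : t ^+ 2 = 1 - Num.sqrt (1 - t ^+ 2) ^+ 2 by rewrite sqr_sqrtr; [ring|exact: ltW].
set s := Num.sqrt (1 - t ^+ 2) in E s0 *.
rewrite /= !exprS mul1r; transitivity (s * (s * s ^+ k) - k.+2%:R * t ^+ 2 * s ^+ k).
  by field; rewrite gt_eqF.
by rewrite E; ring.
Qed.

(** Raising the indices by four telescopes through [beta_rec]; it relates the
    integral of (1 - |y|^2)_+^2 to the volume of the ball. *)
Lemma prod_beta_rec n : ((n + 2) * (n + 4))%:R * \prod_(j < n) beta (4 + j)%N =
  8 * \prod_(j < n) beta j.
Proof.
elim: n => [|n IH]; first by rewrite !big_ord0.
rewrite !big_ord_recr /= [RHS]mulrA -IH.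
have H1 := beta_rec n; have H2 := beta_rec n.+2.
rewrite (_ : beta (4 + n) = beta n.+4) //.
set P := \prod_(j < n) beta (4 + j).
have n0 : (0 : R) <= n%:R by [].
have H3 : (n%:R + 3) * beta n.+2 = (n%:R + 2) * beta n by rewrite -!natrD.
have H4 : (n%:R + 5) * beta n.+4 = (n%:R + 4) * beta n.+2.
  by move: H2; rewrite !natrD -[n.+2%:R]natr1 -[n.+1%:R]natr1; lra.
transitivity ((n%:R + 3) * P * ((n%:R + 5) * beta n.+4)); first by ring.
rewrite H4.
transitivity ((n%:R + 4) * P * ((n%:R + 3) * beta n.+2)); first by ring.
by rewrite H3; ring.
Qed.

Lemma int_bump4_gt0 n rho : 0 < rho -> 0 < int_rV (@bump n 4 rho).
Proof.
move=> r0; rewrite int_bump mulr_gt0 ?exprn_gt0 ?sqrtr_gt0 //.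
by apply: prodr_gt0 => j _; exact: beta_gt0.
Qed.

Lemma bumpN n k rho (y : 'rV[R]_n) : bump k rho (- y) = bump k rho y.
Proof.
by congr (Num.sqrt (_ - _) ^+ _); apply: eq_bigr => j _; rewrite mxE sqrrN.
Qed.

Lemma csupp_bump1 n : csupp 1 (@bump n 4 1).
Proof. by have := @csupp_bump n 3 1; rewrite sqrtr1. Qed.

Lemma sqZ n a (y : 'rV[R]_n) : sq (a *: y) = a ^+ 2 * sq y.
Proof. by rewrite /sq mulr_sumr; apply: eq_bigr => j _; rewrite mxE exprMn. Qed.

(** Uniqueness of Haar measure: an isometry preserves the radial function
    [bump 4 1], hence all integrals. *)
Lemma int_rV_isometry n M (A B : 'rV[R]_n -> 'rV[R]_n) (f : 'rV[R]_n -> R) :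
  0 <= M -> csupp M f -> (forall x y, A (x - y) = A x - A y) ->
  (forall x, sq (A x) = sq x) -> cancel A B -> cancel B A ->
  int_rV (fun y => f (A y)) = int_rV f.
Proof.
move=> M0 cf AB Asq AK BK.
have M1 : 0 <= M + 1 by lra.
have H := @int_rV_linear _ n (M + 1) n%:R A B f (bump 4 1) M1 (ler0n _ _).
have := int_bump4_gt0 n ltr01 => /gt_eqF/negbT/mulIf; apply.
rewrite {}H //; last 5 first.
- by apply: csupp_le cf; lra.
- by apply: csupp_le (csupp_bump1 n); lra.
- by move=> y; exact: bumpN.
- apply: continuous_dist => x e e0.
  have n1 : 0 < n%:R + 1 :> R by rewrite ltr_wpDl.
  exists (e / (n%:R + 1)) => [|y xy]; first exact: divr_gt0.
  rewrite -AB; apply: le_lt_trans (norm_le_sqrt_sq _) _; rewrite Asq.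
  apply: le_lt_trans (sqrt_sq_le_norm _) _.
  move: xy; rewrite ltr_pdivlMr // mulrC; apply: le_lt_trans.
  by rewrite ler_wpM2r //; lra.
- move=> y; rewrite -{2}(BK y); apply: le_trans (norm_le_sqrt_sq _) _.
  rewrite -Asq; apply: le_trans (sqrt_sq_le_norm _) _.
  by rewrite BK.
by congr (_ * int_rV _); apply/funext => y; rewrite /bump Asq.
Qed.

Lemma int_rV_opp n M (f : 'rV[R]_n -> R) : 0 <= M -> csupp M f ->
  int_rV (fun y => f (- y)) = int_rV f.
Proof.
move=> M0 cf; apply: (int_rV_isometry (B := -%R) M0 cf).
- by move=> x y; rewrite opprD.
- by move=> x; apply: eq_bigr => j _; rewrite mxE sqrrN.
- exact: opprK.
- exact: opprK.
Qed.

(** As for isometries, the Jacobian is read off on [bump 4 1], whose dilates are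
    again bumps. *)
Lemma int_rV_scale n M l (f : 'rV[R]_n -> R) : 0 < l -> 0 <= M -> csupp M f ->
  int_rV (fun y => f (l^-1 *: y)) = l ^+ n * int_rV f.
Proof.
move=> l0 M0 cf.
have M1 : 0 <= M + 1 by lra.
have H := @int_rV_linear _ n (M + 1) l (fun y => l^-1 *: y) (fun y => l *: y) f (bump 4 1) M1 (ltW l0).
have := int_bump4_gt0 n ltr01 => /gt_eqF/negbT/mulIf; apply.
rewrite {}H //; last 8 first.
- by apply: csupp_le cf; lra.
- by apply: csupp_le (csupp_bump1 n); lra.
- by move=> y; exact: bumpN.
- by move=> x y; rewrite scalerBr.
- by move=> x; rewrite scalerA divff ?gt_eqF // scale1r.
- by move=> x; rewrite scalerA mulVf ?gt_eqF // scale1r.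
- by apply: contV_scale; [exact: cst_continuous|exact: cont_id].
- by move=> y; rewrite normrZ gtr0_norm.
rewrite mulrAC mulrC; congr (_ * _).
have E : (fun y : 'rV[R]_n => bump 4 1 (l^-1 *: y)) = (fun y => l ^- 4 * bump 4 (l ^+ 2) y).
  apply/funext => y; rewrite /bump sqZ -exprVn -exprMn; congr (_ ^+ _).
  have lV : 0 <= l^-1 by rewrite invr_ge0 ltW.
  rewrite -{2}(ger0_norm lV) -sqrtr_sqr -sqrtrM ?sqr_ge0 //; congr Num.sqrt.
  by rewrite exprVn; field; rewrite gt_eqF.
rewrite E (int_rVZ _ (sqrtr_ge0 (l ^+ 2))); last exact: csupp_bump.
rewrite !int_bump sqrtr_sqr gtr0_norm // sqrtr1 expr1n mul1r exprD mulrA mulrA mulVf ?mul1r //.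
by rewrite expf_neq0 // gt_eqF.
Qed.

End Bumps.

(** * The area of the sphere *)

Section Omega.
Variable R : realType.

Lemma lebesgue_rV0 n : lebesgue_rV (set0 : set 'rV[R]_n) = 0%E.
Proof.
elim: n => [|n IH] /=; first by rewrite indic0.
rewrite (_ : (fun t => _) = fun=> 0%E) ?integral0 //.
by apply/funext => t; rewrite -[RHS]IH.
Qed.

Definition ball_vol n : R := \prod_(j < n) beta R j.

Definition ball_slice n (rho t : R) : \bar R :=
  lebesgue_rV [set y : 'rV[R]_n | t ^+ 2 + sq y < rho].

Lemma ball_sliceE n (rho : R) :
  (forall r, 0 < r -> lebesgue_rV [set y : 'rV[R]_n | sq y < r] =
     (Num.sqrt r ^+ n * ball_vol n)%:E) -> 0 < rho ->
  ball_slice n rho = (fun t => (Num.sqrt (rho - t ^+ 2) ^+ n * ball_vol n)%:E) \_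
    `]- Num.sqrt rho, Num.sqrt rho[.
Proof.
move=> H r0; apply/funext => t; rewrite patchE.
have -> : (t \in (`]- Num.sqrt rho, Num.sqrt rho[%classic : set R)) = (t ^+ 2 < rho).
  apply/idP/idP.
    rewrite inE /= in_itv /= -ltr_norml => ts.
    rewrite -real_normK ?num_real // -[ltRHS]sqr_sqrtr ?(ltW r0) //.
    by rewrite ltrXn2r ?nnegrE ?sqrtr_ge0.
  move=> tr; rewrite inE /= in_itv /= -ltr_norml -sqrtr_sqr ltr_sqrt //.
case: ifPn => tr.
  rewrite -H ?subr_gt0 // /ball_slice; congr lebesgue_rV.
  by apply/seteqP; split => y /=; rewrite ltrBrDl.
rewrite /ball_slice (_ : [set _ | _] = set0) ?lebesgue_rV0 //.
apply/seteqP; split => y //= ty; move/negP: tr; apply.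
by apply: le_lt_trans ty; rewrite lerDl sq_ge0.
Qed.

Lemma continuous_ball_slice n (rho : R) : continuous (fun t : R => Num.sqrt (rho - t ^+ 2) ^+ n * ball_vol n).
Proof.
apply: cont_mul; last exact: cont_cst.
by apply/cont_sqrt_exp/cont_sub; [exact: cont_cst|apply: cont_exp; exact: cont_id].
Qed.

Lemma int_ball_slice n (rho : R) : 0 < rho ->
  (\int[lebesgue_measure]_(t in `](- Num.sqrt rho)%R, (Num.sqrt rho)%R[)
     (Num.sqrt (rho - t ^+ 2) ^+ n * ball_vol n)%:E)%E =
  (Num.sqrt rho ^+ n.+1 * ball_vol n.+1)%:E.
Proof.
move=> r0; have cf := @continuous_ball_slice n rho.
rewrite -(@integral_itv_bndoo _ _ _ _ true false); last first.
  apply/measurable_EFinP; apply: measurable_funTS; exact: continuous_measurable_fun.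
have /integrable_fin_num -/(_ (measurable_itv _))/fineK <- :=
  seg_integrable (- Num.sqrt rho) (Num.sqrt rho) cf.
congr EFin.
transitivity (seg_int (- Num.sqrt rho) (Num.sqrt rho) (fun t => ball_vol n * Num.sqrt (rho - t ^+ 2) ^+ n)).
  by apply: eq_Rintegral => t _; rewrite mulrC.
rewrite seg_intZ; last first.
  by apply/cont_sqrt_exp/cont_sub; [exact: cont_cst|apply: cont_exp; exact: cont_id].
by rewrite seg_int_bump // /ball_vol big_ord_recr /= mulrCA.
Qed.

(** The slice of a ball at height [t] is a ball of squared radius rho - t^2, so
    volumes obey the recursion that defines [ball_vol]. *)
Lemma lebesgue_rV_ball n rho : 0 < rho ->
  lebesgue_rV [set y : 'rV[R]_n | sq y < rho] = (Num.sqrt rho ^+ n * ball_vol n)%:E.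
Proof.
elim: n rho => [|n IH] rho r0.
  by rewrite /ball_vol big_ord0 mulr1 expr0 /= indicE mem_set //= /sq big_ord0.
rewrite /= (_ : (fun t => _) = ball_slice n rho); last first.
  apply/funext => t; congr lebesgue_rV; apply/seteqP.
  by split => y /=; rewrite -/(cons_rV t y) sq_cons.
by rewrite (ball_sliceE IH r0) -integral_mkcond int_ball_slice.
Qed.

(** Only the slice at height 0 sees the missing centre. *)
Lemma lebesgue_rV_punctured n :
  lebesgue_rV [set y : 'rV[R]_n.+1 | 0 < sq y < 1] = (ball_vol n.+1)%:E.
Proof.
rewrite /=; set g := (fun t : R => _).
have gE t : t \in ([set: R] `\ 0) -> g t = ball_slice n 1 t.
  rewrite inE /= => -[_ /eqP t0]; congr lebesgue_rV; apply/seteqP.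
  split => y /=; rewrite -/(cons_rV t y) sq_cons; first by case/andP.
  move=> ->; rewrite andbT; apply: ltr_pwDl; [by rewrite exprn_even_gt0|exact: sq_ge0].
have sE := ball_sliceE (fun r r0 => @lebesgue_rV_ball n r r0) (@ltr01 R).
have ms : measurable_fun [set: R] (ball_slice n 1).
  rewrite sE; apply/(measurable_restrictT _ _).1 => //.
  apply/measurable_EFinP; apply: measurable_funTS; apply: continuous_measurable_fun.
  exact: continuous_ball_slice.
have mD : measurable ([set: R] `\ (0 : R)) by exact: measurableD.
have ms0 : measurable_fun ([set: R] `\ (0 : R)) (ball_slice n 1) by exact: measurable_funTS.
transitivity (\int[lebesgue_measure]_(t in [set: R] `\ (0%R : R)) g t)%E.
  rewrite integral_setD1 //; apply: eq_measurable_fun ms0.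
  by move=> t /gE.
transitivity (\int[lebesgue_measure]_(t in [set: R] `\ (0%R : R)) ball_slice n 1 t)%E.
  by apply: eq_integral => t /gE.
rewrite integral_setD1 //.
by rewrite sE -integral_mkcond int_ball_slice // sqrtr1 expr1n mul1r.
Qed.

(** The truncated cone over the sphere is the unit ball without its centre. *)
Lemma omegaE n : omega R n.+1 = n.+1%:R * ball_vol n.+1.
Proof.
rewrite /omega /sphere_measure (_ : [set _ *: _ | _ in _ & _ in _] =
  [set y : 'rV[R]_n.+1 | 0 < sq y < 1]).
  by rewrite lebesgue_rV_punctured.
apply/seteqP; split => [y [r /=]|y /= /andP[y0 y1]].
  rewrite in_itv /= => /andP[r0 r1] [t]; rewrite /unit_sphere /enorm /= -/(sq t) => t1 <-.
  have t1' : sq t = 1 by rewrite -[LHS]sqr_sqrtr ?sq_ge0 // t1 expr1n.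
  by rewrite sqZ t1' mulr1 exprn_gt0 //= expr_lt1 // ltW.
have s0 : 0 < Num.sqrt (sq y) by rewrite sqrtr_gt0.
exists (Num.sqrt (sq y)); first by rewrite /= in_itv /= s0 -[ltRHS]sqrtr1 ltr_sqrt.
exists ((Num.sqrt (sq y))^-1 *: y); last by rewrite scalerA divff ?gt_eqF // scale1r.
rewrite /unit_sphere /enorm /= -/(sq _) sqZ exprVn sqr_sqrtr ?(ltW y0) //.
by rewrite mulVf ?gt_eqF // sqrtr1.
Qed.

(** Both sides are products of [beta]; [omega] thereby becomes the integral of
    a continuous function, which is how it enters all the estimates. *)
Lemma int_bump4_omega n :
  (n.+1 * (n.+1 + 2) * (n.+1 + 4))%:R * int_rV (@bump R n.+1 4 1) = 8 * omega R n.+1.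
Proof.
rewrite omegaE int_bump sqrtr1 expr1n mul1r -mulnA natrM -mulrA prod_beta_rec.
by rewrite mulrCA.
Qed.

Lemma omega_gt0 n : 0 < omega R n.+1.
Proof.
rewrite omegaE mulr_gt0 //; apply: prodr_gt0 => j _; exact: beta_gt0.
Qed.

End Omega.

(** * The second derivative kernel on a line *)

Section Kernel.
Variable R : realType.

Lemma cont_inv (U : topologicalType) (f : U -> R) : continuous f ->
  (forall x, f x != 0) -> continuous (fun x => (f x)^-1).
Proof. by move=> cf f0 x; apply: cvgV; [exact: f0|exact: cf]. Qed.

Lemma cont_max (U : topologicalType) (f g : U -> R) : continuous f -> continuous g ->
  continuous (fun x => Num.max (f x) (g x)).
Proof.
move=> cf cg; rewrite (_ : (fun x => _) = (fun x => 2^-1 * (f x + g x + `|f x - g x|))).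
  apply: cont_mul; first exact: cont_cst.
  apply: cont_add; first exact: cont_add.
  by apply: (@cont_comp _ _ _ (fun x => f x - g x) (fun x : R => `|x|)); [exact: cont_sub|move=> x; exact: norm_continuous].
apply/funext => x; case: (leP (f x) (g x)) => fg.
  rewrite ler0_norm ?subr_le0 //; by field.
by rewrite gtr0_norm ?subr_gt0 //; field.
Qed.

Lemma cont_min (U : topologicalType) (f g : U -> R) : continuous f -> continuous g ->
  continuous (fun x => Num.min (f x) (g x)).
Proof.
move=> cf cg; rewrite (_ : (fun x => _) = (fun x => f x + g x - Num.max (f x) (g x))).
  by apply: cont_sub; [exact: cont_add|exact: cont_max].
apply/funext => x; by case: (leP (f x) (g x)) => fg; ring.
Qed.

Lemma cont_abs (U : topologicalType) (f : U -> R) : continuous f ->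
  continuous (fun x => `|f x|).
Proof.
move=> cf; apply: (@cont_comp _ _ _ f (fun x : R => `|x|)) => // x; exact: norm_continuous.
Qed.

(** The total variation over the line of t / (t^2 + 1)^((m+1)/2). *)
Definition kappa m : R := 4 * Num.sqrt m%:R ^+ m / Num.sqrt m.+1%:R ^+ m.+1.

(** The kernel | |y|^2 - n y_0^2 | / |y|^(n+2), n = m + 1, at a point with first
    coordinate [t] and distance [r] to the first axis. *)
Definition slice_kernel m (r t : R) :=
  `|r ^+ 2 - m%:R * t ^+ 2| / Num.sqrt (t ^+ 2 + r ^+ 2) ^+ (m + 3).

Lemma cont_slice_kernel m (r : R) : 0 < r -> continuous (slice_kernel m r).
Proof.
move=> r0.
have s0 (t : R) : 0 < Num.sqrt (t ^+ 2 + r ^+ 2).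
  by rewrite sqrtr_gt0 ltr_wpDl ?sqr_ge0 // exprn_gt0.
apply: cont_mul.
  apply/cont_abs/cont_sub; first exact: cont_cst.
  apply: cont_mul; first exact: cont_cst.
  by apply: cont_exp; exact: cont_id.
apply: cont_inv; last by move=> t; rewrite expf_neq0 // gt_eqF.
apply/cont_sqrt_exp/cont_add; last exact: cont_cst.
by apply: cont_exp; exact: cont_id.
Qed.

Lemma is_derive_slice m (r t : R) : 0 < r ->
  is_derive t 1 (fun t : R => t / Num.sqrt (t ^+ 2 + r ^+ 2) ^+ m.+1)
    ((r ^+ 2 - m%:R * t ^+ 2) / Num.sqrt (t ^+ 2 + r ^+ 2) ^+ (m + 3)).
Proof.
move=> r0.
have t0 : 0 < t ^+ 2 + r ^+ 2 by rewrite ltr_wpDl ?sqr_ge0 // exprn_gt0.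
have s0 : 0 < Num.sqrt (t ^+ 2 + r ^+ 2) by rewrite sqrtr_gt0.
have sm0 : Num.sqrt (t ^+ 2 + r ^+ 2) ^+ m.+1 != 0 by rewrite expf_neq0 // gt_eqF.
have d1 : is_derive t 1 (fun t : R => t ^+ 2 + r ^+ 2) (2 * t).
  by apply: isd_eq (isd_add (isd_exp _ _) (isd_cst _ _ _)) _; rewrite addr0 expr1.
have d2 := isd_comp d1 (is_derive1_sqrt t0).
have d3 := isd_comp d2 (isd_exp m.+1 _).
have d4 := isd_inv d3 sm0.
apply: isd_eq (isd_mul (isd_id t 1) d4) _.
have E : r ^+ 2 = Num.sqrt (t ^+ 2 + r ^+ 2) ^+ 2 - t ^+ 2 by rewrite sqr_sqrtr ?(ltW t0) //; ring.
set s := Num.sqrt (t ^+ 2 + r ^+ 2) in E s0 sm0 *.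
rewrite E /GRing.scale /= exprD !exprS.
have : s ^+ m != 0 by rewrite expf_neq0 // gt_eqF.
move: (s ^+ m) => sm smn.
by field; rewrite smn gt_eqF.
Qed.

(** The integrand is the absolute value of the derivative of
    G(t) = t / (t^2 + r^2)^((m+1)/2), which increases between -t0 and t0 for
    t0 = r / sqrt m, decreases elsewhere, and has the sign of t; hence the
    bound 4 G(t0). *)
Lemma int_slice_kernel m (r T : R) : (0 < m)%N -> 0 < r ->
  seg_int (- T) T (slice_kernel m r) <= kappa m / r ^+ m.
Proof.
move=> m0 r0.
have cK := @cont_slice_kernel m r r0.
have K0 t : 0 <= slice_kernel m r t by rewrite divr_ge0 ?exprn_ge0 ?sqrtr_ge0.
have mR : 0 < m%:R :> R by rewrite ltr0n.
set t0 := r / Num.sqrt m%:R.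
have sm : 0 < Num.sqrt (m%:R : R) by rewrite sqrtr_gt0.
have t00 : 0 < t0 by rewrite divr_gt0.
have t0E : m%:R * t0 ^+ 2 = r ^+ 2.
  by rewrite expr_div_n sqr_sqrtr ?ler0n // mulrC divfK ?gt_eqF.
pose G (t : R) := t / Num.sqrt (t ^+ 2 + r ^+ 2) ^+ m.+1.
have dG (t : R) : is_derive t 1 G ((r ^+ 2 - m%:R * t ^+ 2) / Num.sqrt (t ^+ 2 + r ^+ 2) ^+ (m + 3)).
  exact: is_derive_slice.
have cG : continuous G by exact: (isd_continuous dG).
have GN t : G (- t) = - G t by rewrite /G sqrrN mulNr.
have Gt0 : G t0 = kappa m / r ^+ m / 4.
  rewrite /G (_ : t0 ^+ 2 + r ^+ 2 = r ^+ 2 * (m.+1%:R / m%:R)); last first.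
    by rewrite -t0E -natr1; field; rewrite gt_eqF.
  rewrite sqrtrM ?sqr_ge0 // sqrtr_sqr gtr0_norm // exprMn sqrtrM ?ler0n // sqrtrV ?ler0n //.
  rewrite /kappa /t0 exprMn exprVn !exprS.
  have : r ^+ m != 0 by rewrite expf_neq0 // gt_eqF.
  have : Num.sqrt (m%:R : R) ^+ m != 0 by rewrite expf_neq0 // gt_eqF.
  have : Num.sqrt (m.+1%:R : R) != 0 by rewrite gt_eqF // sqrtr_gt0 ltr0n.
  have : Num.sqrt (m.+1%:R : R) ^+ m != 0 by rewrite expf_neq0 // gt_eqF // sqrtr_gt0 ltr0n.
  move=> a b c d; field; rewrite a b c d !gt_eqF //.
pose T' := Num.max T t0.
have TT' : T <= T' by rewrite le_max lexx.
have tT' : t0 <= T' by rewrite le_max lexx orbT.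
have T'0 : 0 < T' by exact: lt_le_trans tT'.
have Gpos : 0 <= G T' by rewrite divr_ge0 ?exprn_ge0 ?sqrtr_ge0 // ltW.
have sgn (t : R) : `|t| <= t0 -> 0 <= r ^+ 2 - m%:R * t ^+ 2.
  by move=> tt; rewrite subr_ge0 -t0E ler_pM2l // -real_normK ?num_real // lerXn2r ?nnegrE // ltW.
have sgn' (t : R) : t0 <= `|t| -> r ^+ 2 - m%:R * t ^+ 2 <= 0.
  by move=> tt; rewrite subr_le0 -t0E ler_pM2l // -[leRHS]real_normK ?num_real // lerXn2r ?nnegrE // ltW.
have neg a b : a <= b -> (forall t, a <= t <= b -> t0 <= `|t|) ->
    seg_int a b (slice_kernel m r) = G a - G b.
  move=> ab H; rewrite (_ : G a - G b = - G b - - G a); last by ring.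
  apply: (@seg_int_FTC _ _ _ _ (fun t => - G t)) => //.
    by move=> x; apply: cvgN; exact: cG.
  move=> t /andP[ta tb]; apply: isd_eq (is_deriveN (dG t)) _.
  rewrite /slice_kernel ler0_norm ?mulNr //.
  by apply/sgn'/H; rewrite !ltW.
have mid : seg_int (- t0) t0 (slice_kernel m r) = G t0 - G (- t0).
  apply: seg_int_FTC => //; first by lra.
  move=> t /andP[ta tb]; apply: isd_eq (dG t) _.
  rewrite /slice_kernel ger0_norm //; apply: sgn.
  by rewrite ler_norml !ltW.
apply: (@le_trans _ _ (seg_int (- T') T' (slice_kernel m r))).
  have [T0|T0] := leP 0 T; last first.
    rewrite /seg_int set_itv_ge; last by rewrite bnd_simp -ltNge; lra.
    rewrite Rintegral_set0; apply: Rintegral_ge0 => x _; exact: K0.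
  rewrite (@seg_int_cat _ (- T') (- T) T') //; last by lra.
  rewrite (@seg_int_cat _ (- T) T T') //; last by lra.
  have H a b : 0 <= seg_int a b (slice_kernel m r) by apply: Rintegral_ge0 => x _; exact: K0.
  have := H (- T') (- T); have := H T T'; lra.
rewrite (@seg_int_cat _ (- T') (- t0) T') //; last by lra.
rewrite (@seg_int_cat _ (- t0) t0 T') //; last by lra.
rewrite mid !neg //.
- rewrite !GN Gt0; lra.
- by move=> t /andP[tt _]; apply: le_trans tt (ler_norm _).
- by lra.
- move=> t /andP[_ tt]; rewrite -normrN; apply: le_trans (ler_norm _); lra.
Qed.

End Kernel.

(** * Kernel and weight around an axis *)

Section KernelIntegral.
Variable R : realType.

Lemma csupp_bounded n M (f : 'rV[R]_n -> R) : 0 <= M -> csupp M f ->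
  exists2 C, 0 <= C & forall y, `|f y| <= C.
Proof.
move=> M0 [cf f0].
have A0 : [set y : 'rV[R]_n | `|y| <= M] !=set0 by exists 0; rewrite /= normr0.
have cA : {within [set y : 'rV[R]_n | `|y| <= M], continuous (fun y => `|f y|)}.
  by apply: continuous_subspaceT; exact: cont_abs.
have [c _ Hc] := EVT_max_rV A0 (@compact_ball_rV R n M) cA.
exists `|f c| => // y; have [yM|yM] := leP `|y| M.
  by apply: Hc; rewrite inE.
by rewrite f0 // normr0.
Qed.

Lemma tail_cons n t (y : 'rV[R]_n) : tail_rV (cons_rV t y) = y.
Proof. by apply/rowP => j; rewrite mxE cons_rVS. Qed.

Lemma tailZ n a (y : 'rV[R]_n.+1) : tail_rV (a *: y) = a *: tail_rV y.
Proof. by apply/rowP => j; rewrite !mxE. Qed.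

Lemma sq_tail n (y : 'rV[R]_n.+1) : sq y = y 0 ord0 ^+ 2 + sq (tail_rV y).
Proof. by rewrite -{1}(cons_rVK y) sq_cons. Qed.

Lemma cont_tail n : continuous (fun y : 'rV[R]_n.+1 => sq (tail_rV y)).
Proof.
rewrite (_ : (fun y => _) = (fun y : 'rV[R]_n.+1 => sq y - y 0 ord0 ^+ 2)).
  by apply: cont_sub; [exact: cont_sq|apply: cont_exp; exact: cont_coord].
by apply/funext => y; rewrite sq_tail addrC addKr.
Qed.

Definition axis_dist n (y : 'rV[R]_n.+1) : R := Num.sqrt (sq (tail_rV y)).

Lemma cont_axis_dist n : continuous (@axis_dist n).
Proof.
apply: (@cont_comp _ _ _ (fun y : 'rV[R]_n.+1 => sq (tail_rV y)) (@Num.sqrt R)).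
  exact: cont_tail.
by move=> x; exact: sqrt_continuous.
Qed.

Lemma axis_distZ n a (y : 'rV[R]_n.+1) : 0 <= a -> axis_dist (a *: y) = a * axis_dist y.
Proof. by move=> a0; rewrite /axis_dist tailZ sqZ sqrtrM ?sqr_ge0 // sqrtr_sqr ger0_norm. Qed.

Lemma axis_dist_le n (y : 'rV[R]_n.+1) : axis_dist y <= Num.sqrt (sq y).
Proof. by rewrite ler_sqrt ?sq_ge0 // sq_tail lerDr sqr_ge0. Qed.

(** The denominator is frozen on the ball of radius [rho] to keep the kernel
    continuous; only its values outside the ball matter. *)
Definition axis_kernel m rho (y : 'rV[R]_m.+1) : R :=
  `|sq (tail_rV y) - m%:R * y 0 ord0 ^+ 2| / Num.max (Num.sqrt (sq y)) rho ^+ (m + 3).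

Lemma cont_axis_kernel m rho : 0 < rho -> continuous (@axis_kernel m rho).
Proof.
move=> r0; apply: cont_mul.
  apply/cont_abs/cont_sub; first exact: cont_tail.
  apply: cont_mul; first exact: cont_cst.
  by apply: cont_exp; exact: cont_coord.
apply: cont_inv; last by move=> y; rewrite expf_neq0 // gt_eqF // lt_max r0 orbT.
apply: cont_exp; apply: cont_max; last exact: cont_cst.
apply: (@cont_comp _ _ _ (@sq R m.+1) (@Num.sqrt R)); first exact: cont_sq.
by move=> x; exact: sqrt_continuous.
Qed.

Lemma axis_kernel_ge0 m rho (y : 'rV[R]_m.+1) : 0 <= axis_kernel rho y.
Proof. by rewrite divr_ge0 // exprn_ge0 // le_max sqrtr_ge0. Qed.

(** Homogeneity of degree -n, n = m + 1, away from the frozen region. *)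
Lemma axis_kernelZ m rho rho' l (y : 'rV[R]_m.+1) : 0 < l ->
  rho <= Num.sqrt (sq (l^-1 *: y)) -> rho' <= Num.sqrt (sq y) ->
  0 < Num.sqrt (sq y) ->
  axis_kernel rho (l^-1 *: y) = l ^+ m.+1 * axis_kernel rho' y.
Proof.
move=> l0 H1 H2 sy0; rewrite /axis_kernel !max_l //.
rewrite tailZ !sqZ mxE exprMn.
rewrite sqrtrM ?sqr_ge0 // sqrtr_sqr [`|l^-1|]gtr0_norm ?invr_gt0 //.
have -> : l^-1 ^+ 2 * sq (tail_rV y) - m%:R * (l^-1 ^+ 2 * y 0 ord0 ^+ 2) =
  l^-1 ^+ 2 * (sq (tail_rV y) - m%:R * y 0 ord0 ^+ 2) by ring.
rewrite normrM ger0_norm ?sqr_ge0 // exprMn invfM.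
rewrite -exprVn invrK [(m + 3)%N]addnC !exprD !exprS expr0 !mulr1.
by field; rewrite expf_neq0 ?gt_eqF.
Qed.

(** x^m (1 - x^2)_+^2: the power compensates the r^-m of [int_slice_kernel], and
    what remains is a bump with known integral on the orthogonal hyperplane. *)
Definition radial_weight m (x : R) := x ^+ m * Num.sqrt (1 - x ^+ 2) ^+ 4.

Lemma cont_radial_weight m : continuous (radial_weight m).
Proof.
apply: cont_mul; first by apply: cont_exp; exact: cont_id.
apply/cont_sqrt_exp/cont_sub; first exact: cont_cst.
by apply: cont_exp; exact: cont_id.
Qed.

(** The integral of [radial_weight m] against dx / x. *)
Definition weight_mass m : R := 8 / (m%:R * (m%:R + 2) * (m%:R + 4)).

Lemma weight_mass_gt0 m : (0 < m)%N -> 0 < weight_mass m.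
Proof.
by move=> m0; rewrite divr_gt0 // !mulr_gt0 ?ltr0n // ltr_wpDl.
Qed.

Lemma radial_weight_ge0 m x : 0 <= x -> 0 <= radial_weight m x.
Proof. by move=> x0; rewrite mulr_ge0 // exprn_ge0 // sqrtr_ge0. Qed.

(** Against dl / l the integral of l -> radial_weight (l r) does not depend on
    [r], up to what is lost on dilations below [e]. *)
Lemma seg_int_weight m (e L r : R) : (0 < m)%N -> 0 < e -> 0 < r -> e * r <= 1 -> 1 <= L * r ->
  weight_mass m - 2 * (e * r) <=
  seg_int e L (fun l : R => radial_weight m (l * r) / Num.max l e).
Proof.
case: m => [//|m] _ e0 r0 er Lr.
have eV : e <= r^-1 by rewrite -(ler_pM2r r0) mulVf ?gt_eqF.
have VL : r^-1 <= L by rewrite -(ler_pM2r r0) mulVf ?gt_eqF.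
have cf : continuous (fun l : R => radial_weight m.+1 (l * r) / Num.max l e).
  apply: cont_mul.
    apply: (@cont_comp _ _ _ (fun l : R => l * r)); last exact: cont_radial_weight.
    by apply: cont_mul; [exact: cont_id|exact: cont_cst].
  apply: cont_inv; first by apply: cont_max; [exact: cont_id|exact: cont_cst].
  by move=> x; rewrite gt_eqF // lt_max e0 orbT.
rewrite (@seg_int_cat _ _ r^-1) ?eV //.
apply: ler_wpDr.
  apply: Rintegral_ge0 => x; rewrite /= in_itv /= => /andP[rx _].
  rewrite divr_ge0 ?radial_weight_ge0 ?le_max ?(ltW e0) ?orbT //.
  rewrite mulr_ge0 ?(ltW r0) //; apply: le_trans rx; rewrite invr_ge0; exact: ltW.
pose a : R := m.+1%:R; pose P (x : R) := x ^+ m.+1 / a - 2 * (x ^+ m.+3 / (a + 2)) + x ^+ (m.+4.+1) / (a + 4).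
have a0 : 0 < a by rewrite ltr0n.
have dP (x : R) : is_derive x 1 P (x ^+ m * (1 - x ^+ 2) ^+ 2).
  have dj k (b : R) : is_derive x 1 (fun y : R => y ^+ k.+1 / b) (k.+1%:R * x ^+ k / b).
    by apply: isd_eq (isd_mul (isd_exp _ _) (isd_cst _ _ _)) _; rewrite mulr0 addr0.
  apply: isd_eq (isd_add (isd_sub (dj m a) (isd_mul (isd_cst _ _ _) (dj m.+2 _))) (dj m.+4 _)) _.
  have E2 : m.+3%:R = a + 2 :> R by rewrite /a -!natrD addn2.
  have E4 : m.+4.+1%:R = a + 4 :> R by rewrite /a -!natrD addn4.
  rewrite E2 E4 -/a mul0r add0r !exprS.
  field; rewrite !gt_eqF //; lra.
have dPr (l : R) : is_derive l 1 (fun l : R => P (l * r)) ((l * r) ^+ m * (1 - (l * r) ^+ 2) ^+ 2 * r).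
  have d1 : is_derive l 1 (fun l : R => l * r) r.
    by apply: isd_eq (isd_mul (isd_id _ _) (isd_cst _ _ _)) _; rewrite mulr0 addr0 mul1r.
  exact: isd_comp d1 (dP _).
have -> : seg_int e r^-1 (fun l : R => radial_weight m.+1 (l * r) / Num.max l e) =
   P (r^-1 * r) - P (e * r).
  rewrite -(@seg_int_FTC _ e r^-1 (fun l : R => (l * r) ^+ m * (1 - (l * r) ^+ 2) ^+ 2 * r) (fun l : R => P (l * r))) //.
  - apply: eq_seg_int => l /andP[el lr].
    have l0 : 0 < l by exact: lt_le_trans el.
    have lr1 : l * r <= 1 by rewrite -(mulVf (lt0r_neq0 r0)) ler_pM2r.
    rewrite max_l // /radial_weight [Num.sqrt _ ^+ 4](_ : _ = (Num.sqrt (1 - (l * r) ^+ 2) ^+ 2) ^+ 2); last by rewrite -exprM.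
    rewrite sqr_sqrtr; last by rewrite subr_ge0 exprn_ile1 // mulr_ge0 // ltW.
    by rewrite [(l * r) ^+ m.+1]exprS; field; rewrite gt_eqF.
  - apply: cont_mul; last exact: cont_cst.
    have clr : continuous (fun l : R => l * r) by apply: cont_mul; [exact: cont_id|exact: cont_cst].
    apply: cont_mul; first exact: cont_exp.
    by apply: cont_exp; apply: cont_sub; [exact: cont_cst|exact: cont_exp].
  - exact: isd_continuous dPr.
rewrite mulVf ?gt_eqF //; apply: lerB.
  by rewrite le_eqVlt; apply/orP; left; apply/eqP; rewrite /P !expr1n /weight_mass -/a; field; rewrite !gt_eqF //; lra.
set x := e * r.
have x0 : 0 <= x by rewrite mulr_ge0 // ltW.
have x1 : x <= 1 by [].
have xk k : x ^+ k.+1 <= x by rewrite exprS ler_piMr // exprn_ile1.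
have a1 : 1 <= a by rewrite ler1n.
have H1 : x ^+ m.+1 / a <= x by rewrite ler_pdivrMr //; apply: le_trans (xk m) _; rewrite ler_peMr.
have H2 : 0 <= x ^+ m.+3 / (a + 2) by rewrite divr_ge0 ?exprn_ge0 //; lra.
have H3 : x ^+ m.+4.+1 / (a + 4) <= x.
  rewrite ler_pdivrMr; last by lra.
  by apply: le_trans (xk _) _; rewrite ler_peMr //; lra.
rewrite /P; move: H1 H2 H3; move: (_ / a) (_ / (a + 2)) (_ / (a + 4)) => p q s.
by clear; lra.
Qed.

End KernelIntegral.

(** * Dilation averages against the kernel *)

Section KernelBound.
Variable R : realType.

Lemma cont_sqrt_sq n : continuous (fun y : 'rV[R]_n => Num.sqrt (sq y)).
Proof.
apply: (@cont_comp _ _ _ (@sq R n) (@Num.sqrt R)); first exact: cont_sq.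
by move=> x; exact: sqrt_continuous.
Qed.

(** Write 1 as the integral of radial_weight (l r) dl / l over weight_mass, with
    r the distance to the axis, exchange integrals and rescale y by 1 / l. The
    kernel being homogeneous of degree -n, the dilations fall on [psi], where
    their integral against dl / l is at most [c]. There remains the integral of
    kernel times weight, which [int_slice_kernel] reduces to the integral of a
    bump on the orthogonal hyperplane. *)
Lemma int_kernel_off_axis m (M c r0 : R) (psi : 'rV[R]_m.+1 -> R) :
  (0 < m)%N -> 0 <= M -> csupp M psi -> (forall y, 0 <= psi y) -> 0 < r0 ->
  (forall y, axis_dist y < r0 -> psi y = 0) ->
  (forall e L y, 0 < e -> e <= L -> seg_int e L (fun l => psi (l^-1 *: y) / l) <= c) ->
  int_rV (fun y => psi y * axis_kernel r0 y) <= c * kappa R m * omega R m.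
Proof.
move=> m0 M0 cpsi psi0 r00 pax hc.
set K := axis_kernel r0; set J := int_rV _.
have cK : continuous K by exact: cont_axis_kernel.
set N := m%:R * M + 1.
have N0 : 0 < N by rewrite ltr_wpDl // mulr_ge0.
have rN y : psi y != 0 -> axis_dist y <= N.
  move=> py; have yM : `|y| <= M.
    by rewrite leNgt; apply/negP => /cpsi.2 y0; rewrite y0 eqxx in py.
  apply: (le_trans (sqrt_sq_le_norm _)).
  rewrite /N; have : `|tail_rV y| <= M.
    by apply: le_trans yM; rewrite -{2}(cons_rVK y) norm_cons_rV le_max lexx orbT.
  by move=> H; apply: (@le_trans _ _ (m%:R * M)); [rewrite ler_wpM2l|lra].
have J0 : 0 <= J.
  rewrite -(@int_rV0 R m.+1); apply: (@le_int_rV _ _ M) => //.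
  - by split=> //; exact: cont_cst.
  - exact: csuppMr.
  - by move=> y; rewrite mulr_ge0 // axis_kernel_ge0.
have c0 : 0 <= c.
  apply: le_trans (hc 1 1 0 ltr01 (lexx _)).
  apply: Rintegral_ge0 => x; rewrite /= in_itv /= => /andP[x1 _].
  by rewrite divr_ge0 // (le_trans ler01).
(* the weighted inequality, with an error from small dilations *)
have main e : 0 < e -> e * N <= 1 -> e * r0 <= 1 ->
    (weight_mass R m - 2 * (e * N)) * J <= weight_mass R m * (c * kappa R m * omega R m).
  move=> e0 eN er0; pose L := r0^-1.
  have L0 : 0 < L by rewrite invr_gt0.
  have eL : e <= L by rewrite -(ler_pM2r r00) mulVf ?gt_eqF.
  pose d := e * r0; have d0 : 0 < d by rewrite mulr_gt0.
  pose F1 (l : R) (y : 'rV[R]_m.+1) := psi y * K y *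
    (radial_weight m (l * axis_dist y) / Num.max l e).
  (* clamping the dilation makes [G] continuous in every [l] *)
  pose cl l := Num.min (Num.max l e) L.
  have cle l : e <= cl l by rewrite le_min eL le_max lexx orbT.
  have cl0 l : 0 < cl l by exact: lt_le_trans (cle l).
  have clL l : cl l <= L by rewrite ge_min lexx orbT.
  have clE l : e <= l <= L -> cl l = l.
    by move=> /andP[el lL]; rewrite /cl max_l // min_l.
  pose G (l : R) (y : 'rV[R]_m.+1) := psi ((cl l)^-1 *: y) / cl l.
  pose F2 (l : R) (y : 'rV[R]_m.+1) := G l y * axis_kernel d y * radial_weight m (axis_dist y).
  have cfst : continuous (@fst R 'rV[R]_m.+1) by move=> z; exact: cvg_fst.
  have csnd : continuous (@snd R 'rV[R]_m.+1) by move=> z; exact: cvg_snd.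
  have csA (f : 'rV[R]_m.+1 -> R) : continuous f -> continuous (fun z : R * 'rV[R]_m.+1 => f z.2).
    by move=> cf; exact: (cont_comp csnd cf).
  have ccl : continuous cl.
    by apply: cont_min; [apply: cont_max; [exact: cont_id|exact: cont_cst]|exact: cont_cst].
  have cF1 : continuous (fun z : R * 'rV[R]_m.+1 => F1 z.1 z.2).
    apply: cont_mul; first by apply: (csA (fun y => psi y * K y)); exact: cont_mul cpsi.1 cK.
    apply: cont_mul.
      apply: (@cont_comp _ _ _ (fun z : R * 'rV[R]_m.+1 => z.1 * axis_dist z.2)); last exact: cont_radial_weight.
      by apply: cont_mul => //; apply: csA; exact: cont_axis_dist.
    apply: cont_inv; first by apply: cont_max => //; exact: cont_cst.
    by move=> z; rewrite gt_eqF // lt_max e0 orbT.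
  have cG : continuous (fun z : R * 'rV[R]_m.+1 => G z.1 z.2).
    have ci : continuous (fun z : R * 'rV[R]_m.+1 => (cl z.1)^-1).
      by apply: cont_inv; [exact: (cont_comp cfst ccl)|move=> z; rewrite gt_eqF].
    by apply: cont_mul => //; apply: (cont_comp _ cpsi.1); exact: contV_scale.
  have cF2 : continuous (fun z : R * 'rV[R]_m.+1 => F2 z.1 z.2).
    apply: cont_mul; last first.
      by apply: (csA (fun y => radial_weight m (axis_dist y))); apply: (cont_comp _ (@cont_radial_weight R m)); exact: cont_axis_dist.
    by apply: cont_mul => //; apply: csA; exact: cont_axis_kernel.
  have F10 l y : M < `|y| -> F1 l y = 0 by move=> My; rewrite /F1 cpsi.2 // !mul0r.
  have G0 l y : M * L < `|y| -> G l y = 0.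
    move=> My; rewrite /G cpsi.2 ?mul0r // normrZ ger0_norm ?invr_ge0 ?(ltW (cl0 l)) //.
    rewrite mulrC ltr_pdivlMr //; apply: le_lt_trans My.
    by rewrite ler_wpM2l.
  have ML0 : 0 <= M * L by rewrite mulr_ge0 // ltW.
  have F20 l y : M * L < `|y| -> F2 l y = 0 by move=> My; rewrite /F2 G0 // !mul0r.
  have step1 : (weight_mass R m - 2 * (e * N)) * J <= int_rV (fun y => seg_int e L (F1^~ y)).
    rewrite -(int_rVZ _ M0 (csuppMr cpsi cK)); apply: (@le_int_rV _ _ M) => //.
    - by apply: csuppZ; exact: csuppMr.
    - split => [|y My].
        by apply: (@continuous_seg_int _ _ _ _ (fun y l => F1 l y)) => //; exact: continuous_swap.
      rewrite (@eq_seg_int _ _ _ _ (fun=> 0)) ?seg_int_cst ?mul0r // => l _; exact: F10.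
    - move=> y; have [p0|pn0] := eqVneq (psi y) 0.
        rewrite p0 mul0r mulr0 (@eq_seg_int _ _ _ _ (fun=> 0)) ?seg_int_cst ?mul0r // => l _.
        by rewrite /F1 p0 !mul0r.
      have ry : r0 <= axis_dist y by rewrite leNgt; apply/negP => /pax y0; rewrite y0 eqxx in pn0.
      have ry0 : 0 < axis_dist y by exact: lt_le_trans ry.
      have ryN := rN _ pn0.
      rewrite /F1 seg_intZ; last first.
        apply: cont_mul.
          apply: (@cont_comp _ _ _ (fun l : R => l * axis_dist y)); last exact: cont_radial_weight.
          by apply: cont_mul; [exact: cont_id|exact: cont_cst].
        apply: cont_inv; first by apply: cont_max; [exact: cont_id|exact: cont_cst].
        by move=> z; rewrite gt_eqF // lt_max e0 orbT.
      rewrite mulrC ler_wpM2l //; first by rewrite mulr_ge0 // axis_kernel_ge0.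
      have ery : e * axis_dist y <= e * N by rewrite ler_pM2l.
      apply: le_trans (@seg_int_weight R m e L (axis_dist y) m0 e0 ry0 _ _).
      + lra.
      + exact: le_trans eN.
      + by rewrite -(mulVf (lt0r_neq0 r00)) ler_pM2l.
  apply: le_trans step1 _; rewrite -(@int_rV_seg _ _ M) //.
  have -> : seg_int e L (fun l => int_rV (F1 l)) = seg_int e L (fun l => int_rV (F2 l)).
    apply: eq_seg_int => l elL.
    have l0 : 0 < l by case/andP: elL => el _; exact: lt_le_trans el.
    have csF1 : csupp M (F1 l) by split; [exact: continuous_slice2|exact: F10].
    have csF2 : csupp (M * L) (F2 l) by split; [exact: continuous_slice2|exact: F20].
    apply: (@mulfI _ (l ^+ m.+1)); first by rewrite expf_neq0 // gt_eqF.
    rewrite -(int_rV_scale l0 M0 csF1) -(int_rVZ _ ML0 csF2).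
    congr int_rV; apply/funext => y; rewrite /F1 /F2 /G clE //.
    have [->|pn0] := eqVneq (psi (l^-1 *: y)) 0; first by rewrite !mul0r mulr0.
    have H1 : r0 <= axis_dist (l^-1 *: y).
      by rewrite leNgt; apply/negP => /pax y0; rewrite y0 eqxx in pn0.
    have H2 : l * axis_dist (l^-1 *: y) = axis_dist y.
      by rewrite axis_distZ ?invr_ge0 ?(ltW l0) // mulrA divff ?gt_eqF // mul1r.
    have H3 : d <= axis_dist y.
      rewrite -H2 /d; apply: ler_pM => //; first exact: ltW.
      + exact: ltW.
      + by case/andP: elL.
    rewrite H2 /K (@axis_kernelZ R m r0 d l y) //.
    + rewrite max_l; last by case/andP: elL.
      by field; rewrite gt_eqF.
    + by apply: le_trans H1 _; exact: axis_dist_le.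
    + by apply: le_trans H3 _; exact: axis_dist_le.
    + by apply: lt_le_trans (axis_dist_le _); exact: lt_le_trans H3.
  rewrite (@int_rV_seg _ _ (M * L)) //.
  have csF2s : csupp (M * L) (fun y => seg_int e L (F2^~ y)).
    split => [|y My].
      by apply: (@continuous_seg_int _ _ _ _ (fun y l => F2 l y)) => //; exact: continuous_swap.
    by rewrite (@eq_seg_int _ _ _ _ (fun=> 0)) ?seg_int_cst ?mul0r // => l _; exact: F20.
  have ML1 : M * L <= M * L + 1 by lra.
  have ML10 : 0 <= M * L + 1 by lra.
  have -> : weight_mass R m * (c * kappa R m * omega R m) =
     int_rV (fun y : 'rV[R]_m => c * kappa R m * bump 4 1 y).
    rewrite (int_rVZ _ (@ler01 R)); last exact: csupp_bump1.
    case: m m0 {psi cpsi psi0 pax hc K J cK N N0 rN J0 eN F1 G F2 cfst csnd csA cF1 cG cF2 F10 G0 F20 csF2s} => // k _.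
    have E : omega R k.+1 = (k.+1 * (k.+1 + 2) * (k.+1 + 4))%:R * int_rV (@bump R k.+1 4 1) / 8.
      by rewrite int_bump4_omega; field.
    rewrite E /weight_mass !natrM !natrD.
    have kk : 0 < k.+1%:R :> R by rewrite ltr0n.
    by field; rewrite !gt_eqF //; lra.
  rewrite /=; apply: (@le_int_rV _ _ (M * L + 1)) => //.
  - exact: (csupp_slice ML10 (csupp_le ML1 csF2s)).
  - by apply: csuppZ; apply: csupp_le (csupp_bump1 _ _); lra.
  move=> y.
  have [yd|yd] := ltP (Num.sqrt (sq y)) d.
    rewrite (_ : (fun t => _) = fun=> 0); last first.
      apply/funext => t; rewrite (@eq_seg_int _ _ _ _ (fun=> 0)) ?seg_int_cst ?mul0r // => l _.
      rewrite /F2 /G pax ?mul0r // axis_distZ ?invr_ge0 ?(ltW (cl0 l)) //.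
      rewrite mulrC ltr_pdivrMr // /axis_dist tail_cons; apply: lt_le_trans yd _.
      by rewrite /d mulrC ler_pM2l.
    rewrite line_int0.
    by rewrite mulr_ge0 ?exprn_ge0 ?sqrtr_ge0 // mulr_ge0 // divr_ge0 ?mulr_ge0 ?exprn_ge0 ?sqrtr_ge0.
  have y0 : 0 < Num.sqrt (sq y) by exact: lt_le_trans yd.
  rewrite (line_int_slice y csF2s).
  set r := Num.sqrt (sq y) in yd y0 *.
  have cs := @cont_slice_kernel R m r y0.
  apply: (@le_trans _ _ (seg_int (- (M * L)) (M * L) (fun t => c * radial_weight m r * slice_kernel m r t))).
    apply: le_seg_int.
    - exact: (continuous_slice_y csF2s).
    - by apply: cont_mul => //; exact: cont_cst.
    move=> t _; rewrite /F2.
    have -> : (fun l => G l (cons_rV t y) * axis_kernel d (cons_rV t y) * radial_weight m (axis_dist (cons_rV t y))) =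
       (fun l => (slice_kernel m r t * radial_weight m r) * G l (cons_rV t y)).
      apply/funext => l; rewrite /axis_dist tail_cons -/r.
      have -> : axis_kernel d (cons_rV t y) = slice_kernel m r t; last by ring.
      rewrite /axis_kernel /slice_kernel tail_cons cons_rV0 sq_cons.
      rewrite sqr_sqrtr ?sq_ge0 // max_l //.
      apply: le_trans yd _; rewrite /r ler_sqrt ?lerDr ?sqr_ge0 //.
      by rewrite addr_ge0 ?sqr_ge0 ?sq_ge0.
    rewrite seg_intZ; last first.
      by apply: (@continuous_slice2 _ _ _ (fun y l => G l y)); exact: continuous_swap.
    rewrite mulrC -[leRHS]mulrA [_ * slice_kernel _ _ _]mulrC.
    apply: ler_wpM2r.
      by rewrite mulr_ge0 ?divr_ge0 ?exprn_ge0 ?sqrtr_ge0 // radial_weight_ge0 ?sqrtr_ge0.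
    apply: le_trans (hc e L (cons_rV t y) e0 eL).
    by rewrite le_eqVlt; apply/orP; left; apply/eqP; apply: eq_seg_int => l /clE; rewrite /G => ->.
  rewrite seg_intZ //.
  have := int_slice_kernel (M * L) m0 y0.
  have cr : 0 <= c * radial_weight m r by rewrite mulr_ge0 // radial_weight_ge0 // ltW.
  move=> /(ler_wpM2l cr)/le_trans; apply.
  rewrite le_eqVlt; apply/orP; left; apply/eqP.
  rewrite /radial_weight /bump sqr_sqrtr ?sq_ge0 //.
  by field; rewrite expf_neq0 // gt_eqF.
have W0 := weight_mass_gt0 R m0.
rewrite -(ler_pM2l W0).
apply/ler_addgt0Pr => h h0.
pose e := Num.min (Num.min (N^-1) (r0^-1)) (h / (2 * N * (J + 1))).
have J1 : 0 < J + 1 by lra.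
have e0 : 0 < e by rewrite !lt_min !invr_gt0 N0 r00 /= divr_gt0 // !mulr_gt0.
have eN : e * N <= 1 by rewrite -(mulVf (lt0r_neq0 N0)) ler_pM2r // !ge_min lexx.
have er : e * r0 <= 1 by rewrite -(mulVf (lt0r_neq0 r00)) ler_pM2r // !ge_min lexx orbT.
have := main e e0 eN er.
have : e * (2 * N * (J + 1)) <= h.
  by rewrite -ler_pdivlMr ?mulr_gt0 // !ge_min lexx orbT.
have : 0 <= e * N by rewrite mulr_ge0 // ltW.
by rewrite /=; nra.
Qed.

End KernelBound.

(** * The kernel in an arbitrary direction *)

Section KernelDirection.
Variable R : realType.

(** The axis is reached by cutting [psi] off within distance [r] of it: the
    kernel is bounded on the support of [psi], so the part cut off tends to 0
    with [r]. *)
Lemma int_kernel_le m (M c rho : R) (psi : 'rV[R]_m.+1 -> R) :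
  (0 < m)%N -> 0 <= M -> csupp M psi -> (forall y, 0 <= psi y) -> 0 < rho ->
  (forall y, Num.sqrt (sq y) < rho -> psi y = 0) ->
  (forall e L y, 0 < e -> e <= L -> seg_int e L (fun l => psi (l^-1 *: y) / l) <= c) ->
  int_rV (fun y => psi y * axis_kernel rho y) <= c * kappa R m * omega R m.
Proof.
move=> m0 M0 cpsi psi0 rho0 p0 hc.
have cK := @cont_axis_kernel R m rho rho0.
have cpK : csupp M (fun y => psi y * axis_kernel rho y) by exact: csuppMr.
have [C C0 HC] := csupp_bounded M0 cpK.
apply/ler_addgt0Pr => h h0.
pose r := Num.min (4^-1) (h / (C * (2 * M) + 1) / 4).
have CM : 0 <= C * (2 * M) by rewrite !mulr_ge0.
have r0 : 0 < r by rewrite lt_min invr_gt0 ltr0n /= !divr_gt0 //; lra.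
have r4 : 4 * r <= 1 by rewrite -(@ler_pM2l _ 4^-1) ?invr_gt0 // mulrA mulVf // mul1r mulr1 ge_min lexx.
have rh : C * (2 * M) * (4 * r) <= h.
  have : r <= h / (C * (2 * M) + 1) / 4 by rewrite ge_min lexx orbT.
  rewrite ler_pdivlMr // ler_pdivlMr; last by lra.
  nra.
pose ct (y : 'rV[R]_m.+1) := Num.min 1 (Num.max 0 (axis_dist y / r - 1)).
have cct : continuous ct.
  apply: cont_min; first exact: cont_cst.
  apply: cont_max; first exact: cont_cst.
  apply: cont_sub; last exact: cont_cst.
  by apply: cont_mul; [exact: cont_axis_dist|exact: cont_cst].
have ct0 y : 0 <= ct y by rewrite le_min ler01 le_max lexx.
have ct1 y : ct y <= 1 by rewrite ge_min lexx.
have ctlow y : axis_dist y < r -> ct y = 0.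
  by move=> yr; rewrite /ct max_l ?min_r // subr_le0 ler_pdivrMr // mul1r ltW.
have cthigh y : 2 * r <= axis_dist y -> ct y = 1.
  move=> yr; have H : 1 <= axis_dist y / r - 1.
    by rewrite lerBrDr ler_pdivlMr //; lra.
  by rewrite /ct max_r ?(le_trans ler01 H) // min_l.
have csplit : int_rV (fun y => psi y * axis_kernel rho y) =
   int_rV (fun y => psi y * ct y * axis_kernel r y) +
   int_rV (fun y => psi y * axis_kernel rho y * (1 - ct y)).
  rewrite -(int_rVD M0).
  - congr int_rV; apply/funext => y.
    have -> : psi y * ct y * axis_kernel r y = psi y * ct y * axis_kernel rho y; last by ring.
    have [yr|yr] := ltP (axis_dist y) r; first by rewrite ctlow // mulr0 !mul0r.
    have [yr'|yr'] := ltP (Num.sqrt (sq y)) rho; first by rewrite p0 // !mul0r.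
    by rewrite /axis_kernel !max_l // (le_trans yr) // axis_dist_le.
  - by apply: csuppMr; [exact: csuppMr|exact: cont_axis_kernel].
  - by apply: csuppMr => //; apply: cont_sub => //; exact: cont_cst.
rewrite csplit; apply: lerD.
  apply: (@int_kernel_off_axis R m M) => //.
  - exact: csuppMr.
  - by move=> y; rewrite mulr_ge0.
  - by move=> y /ctlow ->; rewrite mulr0.
  - move=> e L y e0 eL; apply: le_trans (hc e L y e0 eL).
    pose ml l := Num.max l e.
    have ml0 l : 0 < ml l by rewrite lt_max e0 orbT.
    have cml : continuous ml by apply: cont_max; [exact: cont_id|exact: cont_cst].
    have cmi : continuous (fun l => (ml l)^-1) by apply: cont_inv => // l; rewrite gt_eqF.
    have E (f : 'rV[R]_m.+1 -> R) : seg_int e L (fun l => f (l^-1 *: y) / l) =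
        seg_int e L (fun l => f ((ml l)^-1 *: y) / ml l).
      by apply: eq_seg_int => l /andP[el _]; rewrite /ml max_l.
    have cy (f : 'rV[R]_m.+1 -> R) : continuous f -> continuous (fun l => f ((ml l)^-1 *: y) / ml l).
      move=> cf; apply: cont_mul => //; apply: (cont_comp _ cf).
      by apply: contV_scale => //; exact: cst_continuous.
    rewrite (E psi) (E (fun y => psi y * ct y)); apply: le_seg_int.
    + by apply: (cy (fun y => psi y * ct y)); exact: cont_mul cpsi.1 cct.
    + exact: cy cpsi.1.
    + by move=> l _; rewrite ler_wpM2r ?invr_ge0 ?(ltW (ml0 l)) // ler_piMr.
pose f y := psi y * axis_kernel rho y * (1 - ct y).
have cf : csupp M f by apply: csuppMr => //; apply: cont_sub => //; exact: cont_cst.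
have fC y : `|f y| <= C.
  rewrite /f normrM -[leRHS]mulr1; apply: ler_pM => //.
  by rewrite ger0_norm ?subr_ge0 // lerBlDr lerDl.
have f0 y : 2 * r <= axis_dist y -> f y = 0 by move=> /cthigh E; rewrite /f E subrr mulr0.
have r20 : 0 <= 2 * r by lra.
have cT : csupp (2 * r) (fun y => line_int (fun t => f (cons_rV t y))).
  split; first exact: (csupp_slice M0 cf).1.
  move=> y yr; rewrite (_ : (fun t => _) = fun=> 0).
    by rewrite line_int0.
  apply/funext => t; apply: f0; rewrite /axis_dist tail_cons.
  exact: le_trans (ltW yr) (norm_le_sqrt_sq y).
apply: le_trans (ler_norm _) _.
apply: le_trans (int_rV_bound (C := C * (2 * M)) r20 cT _) _.
  move=> y; rewrite (line_int_slice y cf) [2 * M](_ : _ = M - - M); last by ring.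
  apply: seg_int_bound => //; first by lra.
  exact: (continuous_slice_y cf).
have -> : 2 * (2 * r) = 4 * r by ring.
apply: le_trans rh; rewrite ler_wpM2l //.
case: m m0 {psi cpsi psi0 p0 hc cK cpK HC ct cct ct0 ct1 ctlow cthigh csplit f cf fC f0 cT} => // k _.
by rewrite exprS ler_piMr ?exprn_ile1 //; lra.
Qed.

Lemma dotC n (x y : 'rV[R]_n) : dot x y = dot y x.
Proof. by apply: eq_bigr => j _; rewrite mulrC. Qed.

Lemma dotBl n (x y z : 'rV[R]_n) : dot (x - y) z = dot x z - dot y z.
Proof. by rewrite /dot -sumrB; apply: eq_bigr => j _; rewrite !mxE mulrBl. Qed.

Lemma dotDl n (x y z : 'rV[R]_n) : dot (x + y) z = dot x z + dot y z.
Proof. by rewrite /dot -big_split; apply: eq_bigr => j _; rewrite !mxE mulrDl. Qed.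

Lemma dotZl n a (x z : 'rV[R]_n) : dot (a *: x) z = a * dot x z.
Proof. by rewrite /dot mulr_sumr; apply: eq_bigr => j _; rewrite !mxE mulrA. Qed.

Lemma dotBr n (x y z : 'rV[R]_n) : dot z (x - y) = dot z x - dot z y.
Proof. by rewrite !(dotC z) dotBl. Qed.

Lemma dotDr n (x y z : 'rV[R]_n) : dot z (x + y) = dot z x + dot z y.
Proof. by rewrite !(dotC z) dotDl. Qed.

Lemma dotZr n a (x z : 'rV[R]_n) : dot z (a *: x) = a * dot z x.
Proof. by rewrite !(dotC z) dotZl. Qed.

Lemma dot_delta n (y : 'rV[R]_n) j : dot y (delta_mx 0 j) = y 0 j.
Proof.
rewrite /dot (bigD1 j) //= mxE !eqxx mulr1 big1 ?addr0 // => i ij.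
by rewrite mxE (negbTE ij) andbF mulr0.
Qed.

Lemma sq0_eq0 n (y : 'rV[R]_n) : sq y = 0 -> y = 0.
Proof.
move=> y0; apply/rowP => j; rewrite mxE; apply/eqP.
by rewrite -sqrf_eq0; apply/eqP/le_anti; rewrite sqr_ge0 andbT -y0 coord_sq.
Qed.

Lemma dot0l n (y : 'rV[R]_n) : dot 0 y = 0.
Proof. by rewrite /dot big1 // => j _; rewrite mxE mul0r. Qed.

Lemma dotNr n (x y : 'rV[R]_n) : dot x (- y) = - dot x y.
Proof. by rewrite -scaleN1r dotZr mulN1r. Qed.

Lemma dotNl n (x y : 'rV[R]_n) : dot (- x) y = - dot x y.
Proof. by rewrite dotC dotNr dotC. Qed.

Lemma coord_le_sqrt_sq n (y : 'rV[R]_n) j : `|y 0 j| <= Num.sqrt (sq y).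
Proof. by rewrite -sqrtr_sqr ler_sqrt ?coord_sq // sq_ge0. Qed.

Lemma dot_le n (x y : 'rV[R]_n) : `|dot x y| <= Num.sqrt (sq x) * Num.sqrt (sq y).
Proof.
have [x0|x0] := eqVneq (sq x) 0.
  by rewrite x0 (sq0_eq0 x0) sqrtr0 mul0r /dot big1 ?normr0 // => j _; rewrite mxE mul0r.
have xp : 0 < sq x by rewrite lt_neqAle eq_sym x0 sq_ge0.
rewrite -sqrtrM ?sq_ge0 // -sqrtr_sqr ler_sqrt ?mulr_ge0 ?sq_ge0 //.
have := sq_ge0 (sq x *: y - dot x y *: x).
rewrite sqE dotBl !dotBr !dotZl !dotZr -!sqE (dotC y x).
have -> : sq x * (sq x * sq y) - sq x * (dot x y * dot x y) -
  (dot x y * (sq x * dot x y) - dot x y * (dot x y * sq x)) =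
  sq x * (sq x * sq y - dot x y ^+ 2) by ring.
by rewrite pmulr_rge0 // subr_ge0.
Qed.

(** The Householder reflection exchanging a unit vector with the first basis
    vector. *)
Lemma exists_reflection n (p : 'rV[R]_n.+1) : sq p = 1 ->
  exists A : 'rV[R]_n.+1 -> 'rV[R]_n.+1,
    [/\ forall x y, A (x - y) = A x - A y, forall a x, A (a *: x) = a *: A x,
        forall x, sq (A x) = sq x, forall x, A (A x) = x &
        forall y, dot (A y) p = y 0 ord0].
Proof.
move=> p1; pose e : 'rV[R]_n.+1 := delta_mx 0 ord0.
have ee : dot e e = 1 by rewrite dot_delta mxE !eqxx.
have pp : dot p p = 1 by rewrite -sqE.
have [pe|pe] := eqVneq (p - e) 0.
  exists id; split => // y.
  by rewrite (_ : p = e) ?dot_delta //; apply/eqP; rewrite -subr_eq0 pe.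
pose w := p - e.
have w0 : dot w w != 0.
  by apply: contra pe => /eqP; rewrite -sqE => /sq0_eq0/eqP.
have ww : dot w w = 2 - 2 * dot p e.
  by rewrite /w !dotBl !dotBr pp ee (dotC e p); ring.
pose A (y : 'rV[R]_n.+1) := y - (2 * dot y w / dot w w) *: w.
have Adot x z : dot (A x) z = dot x z - 2 * dot x w / dot w w * dot w z.
  by rewrite /A dotBl dotZl.
have Aw x : dot (A x) w = - dot x w by rewrite Adot; field.
exists A; split.
- move=> x y; apply/rowP => j; rewrite /A dotBl !mxE; field.
  exact: w0.
- move=> a x; apply/rowP => j; rewrite /A dotZl !mxE; field.
  exact: w0.
- move=> x; rewrite !sqE Adot (dotC x) (dotC w) Adot Aw (dotC w x); field.
  exact: w0.
- move=> x; rewrite {1}/A Aw; apply/rowP => j; rewrite /A !mxE; field.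
  exact: w0.
- move=> y; rewrite Adot -(dot_delta y) -/e.
  have -> : dot w p = dot w w / 2.
    by rewrite ww /w dotBl pp (dotC e p); field.
  rewrite /w dotBr -/w; field.
  exact: w0.
Qed.

(** Up to a constant factor, the size of the second derivative in the direction
    [w] of the fundamental solution of the Laplacian, frozen near 0 like
    [axis_kernel]. *)
Definition dir_kernel n (w : 'rV[R]_n) rho (y : 'rV[R]_n) : R :=
  `|sq w * sq y - n%:R * dot y w ^+ 2| / Num.max (Num.sqrt (sq y)) rho ^+ (n + 2).

Lemma cont_dir_kernel n (w : 'rV[R]_n) rho : 0 < rho -> continuous (dir_kernel w rho).
Proof.
move=> r0; apply: cont_mul.
  apply/cont_abs/cont_sub; first by apply: cont_mul; [exact: cont_cst|exact: cont_sq].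
  apply: cont_mul; first exact: cont_cst.
  by apply: cont_exp; exact: cont_dot.
apply: cont_inv; last by move=> y; rewrite expf_neq0 // gt_eqF // lt_max r0 orbT.
by apply: cont_exp; apply: cont_max; [exact: cont_sqrt_sq|exact: cont_cst].
Qed.

(** A reflection sends the direction of [w] to the first axis and preserves
    everything else. *)
Lemma int_dir_kernel m (M c rho : R) (w : 'rV[R]_m.+1) (psi : 'rV[R]_m.+1 -> R) :
  (0 < m)%N -> 0 <= M -> csupp M psi -> (forall y, 0 <= psi y) -> 0 < rho ->
  (forall y, Num.sqrt (sq y) < rho -> psi y = 0) ->
  (forall e L y, 0 < e -> e <= L -> seg_int e L (fun l => psi (l^-1 *: y) / l) <= c) ->
  int_rV (fun y => psi y * dir_kernel w rho y) <= sq w * (c * kappa R m * omega R m).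
Proof.
move=> m0 M0 cpsi psi0 rho0 p0 hc.
have [w0|w0] := eqVneq (sq w) 0.
  rewrite w0 mul0r (_ : (fun y => _) = fun=> 0) ?int_rV0 // /dir_kernel.
  apply/funext => y; rewrite w0 (sq0_eq0 w0).
  have -> : dot y 0 = 0 by rewrite /dot big1 // => j _; rewrite mxE mulr0.
  by rewrite mul0r expr0n mulr0 subrr normr0 mul0r mulr0.
have w1 : 0 < sq w by rewrite lt_neqAle eq_sym w0 sq_ge0.
pose p := (Num.sqrt (sq w))^-1 *: w.
have sw : 0 < Num.sqrt (sq w) by rewrite sqrtr_gt0.
have p1 : sq p = 1 by rewrite sqZ exprVn sqr_sqrtr ?(ltW w1) // mulVf.
have [A [AB AZ Asq AK Ap]] := exists_reflection p1.
have MA : 0 <= m.+1%:R * M by rewrite mulr_ge0.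
have csA : csupp (m.+1%:R * M) (fun y => psi (A y)).
  split => [|y My].
    apply: (cont_comp _ cpsi.1); apply: continuous_dist => x e e0.
    have n1 : 0 < m.+1%:R :> R by rewrite ltr0n.
    exists (e / m.+1%:R) => [|y xy]; first exact: divr_gt0.
    rewrite -AB; apply: le_lt_trans (norm_le_sqrt_sq _) _; rewrite Asq.
    by apply: le_lt_trans (sqrt_sq_le_norm _) _; rewrite mulrC -ltr_pdivlMr.
  apply: cpsi.2; rewrite ltNge; apply/negP => AM.
  have := le_trans (norm_le_sqrt_sq y) _; rewrite -Asq => /(_ _ (sqrt_sq_le_norm _)).
  move=> H; have := le_trans H (ler_wpM2l (ler0n _ _) AM).
  by rewrite leNgt My.
have key := int_kernel_le m0 MA csA (fun y => psi0 _) rho0.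
have -> : int_rV (fun y => psi y * dir_kernel w rho y) =
  sq w * int_rV (fun y => psi (A y) * axis_kernel rho y).
  have cs := csuppMr cpsi (@cont_dir_kernel _ w rho rho0).
  rewrite -(int_rV_isometry M0 cs AB Asq AK AK).
  rewrite -(int_rVZ _ MA); last by apply: csuppMr => //; exact: cont_axis_kernel.
  congr int_rV; apply/funext => y; rewrite [RHS]mulrCA; congr (_ * _).
  rewrite /dir_kernel /axis_kernel Asq addSnnS [RHS]mulrA; congr (_ / _).
  have -> : dot (A y) w = Num.sqrt (sq w) * y 0 ord0.
    by rewrite -Ap /p dotZr mulrA divff ?mul1r // gt_eqF.
  rewrite exprMn sqr_sqrtr ?(ltW w1) // [sq y]sq_tail -natr1.
  rewrite -[X in X * `|_|](ger0_norm (sq_ge0 w)) -normrM; congr `|_|; ring.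
rewrite ler_pM2l //; apply: key => [y|e L y e0 eL].
  by rewrite -Asq; exact: p0.
apply: le_trans (hc e L (A y) e0 eL).
rewrite le_eqVlt; apply/orP; left; apply/eqP; apply: eq_seg_int => l _.
by rewrite AZ.
Qed.

End KernelDirection.

(** * Second order jets and Green's formula *)

Section Jets.
Variable R : realType.

(** [h] is only continuous on [D], but off [D] the factor [G] vanishes nearby. *)
Lemma mul_zero_off_continuous (T : topologicalType) n (D K : set 'rV[R]_n)
    (h : 'rV[R]_n -> R) (p : T -> 'rV[R]_n) (G : T -> R) :
  closed K -> K `<=` D -> (forall y, D y -> {for y, continuous h}) ->
  continuous p -> continuous G -> (forall z, ~ K (p z) -> G z = 0) ->
  continuous (fun z => h (p z) * G z).
Proof.
move=> clK KD ch cp cG G0 z; have [Dz|nDz] := pselect (D (p z)).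
  have H1 : {for z, continuous (fun z => h (p z))}.
    exact: (@continuous_comp _ _ _ p h z (cp z) (ch _ Dz)).
  exact: (cvgM H1 (cG z)).
have nK : (~` K) (p z) by move=> /KD.
have oK : open (~` K) by exact: closed_openC.
have nz : \forall z' \near z, (~` K) (p z').
  by apply: cp; apply: open_nbhs_nbhs.
have H : {near z, (fun=> h (p z) * G z) =1 (fun z' => h (p z') * G z')}.
  by apply: filterS nz => z' nz'; rewrite !G0 ?mulr0.
apply: cvg_trans (near_eq_cvg H) _.
exact: cst_continuous.
Qed.

(** A C^2 function packed with its gradient and its pure second derivatives,
    which is what a Laplacian needs; products and compositions then compute
    these by formula. *)
Definition jet2 n (f : 'rV[R]_n -> R) (g s : 'I_n -> 'rV[R]_n -> R) :=
  continuous f /\ forall j, [/\ continuous (g j), continuous (s j),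
    forall y, is_derive y (delta_mx 0 j) f (g j y) &
    forall y, is_derive y (delta_mx 0 j) (g j) (s j y)].

Definition lap n (s : 'I_n -> 'rV[R]_n -> R) y := \sum_j s j y.

Lemma jet2_mul n f1 (g1 s1 : 'I_n -> 'rV[R]_n -> R) f2 g2 s2 :
  jet2 f1 g1 s1 -> jet2 f2 g2 s2 ->
  jet2 (fun y => f1 y * f2 y) (fun j y => g1 j y * f2 y + f1 y * g2 j y)
    (fun j y => s1 j y * f2 y + 2 * (g1 j y * g2 j y) + f1 y * s2 j y).
Proof.
move=> [c1 H1] [c2 H2]; split; first exact: cont_mul.
move=> j; have [cg1 cs1 d1 dd1] := H1 j; have [cg2 cs2 d2 dd2] := H2 j; split.
- by apply: cont_add; exact: cont_mul.
- apply: cont_add; last exact: cont_mul.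
  apply: cont_add; first exact: cont_mul.
  by apply: cont_mul; [exact: cont_cst|exact: cont_mul].
- by move=> y; exact: isd_mul.
- move=> y; apply: isd_eq (isd_add (isd_mul (dd1 y) (d2 y)) (isd_mul (d1 y) (dd2 y))) _.
  by ring.
Qed.

Lemma lap_mul n f1 (g1 s1 : 'I_n -> 'rV[R]_n -> R) f2 g2 s2 y :
  lap (fun j y => s1 j y * f2 y + 2 * (g1 j y * g2 j y) + f1 y * s2 j y) y =
  lap s1 y * f2 y + 2 * (\sum_j g1 j y * g2 j y) + f1 y * lap s2 y.
Proof. by rewrite /lap !big_split /= mulr_suml !mulr_sumr. Qed.

Lemma jet2_comp n f (g s : 'I_n -> 'rV[R]_n -> R) (p p1 p2 : R -> R) :
  jet2 f g s -> continuous p2 -> (forall t : R, is_derive t 1 p (p1 t)) ->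
  (forall t : R, is_derive t 1 p1 (p2 t)) ->
  jet2 (fun y => p (f y)) (fun j y => p1 (f y) * g j y)
   (fun j y => p2 (f y) * g j y ^+ 2 + p1 (f y) * s j y).
Proof.
move=> [cf H] cp2 dp dp1.
have cp : continuous p by exact: isd_continuous dp.
have cp1 : continuous p1 by exact: isd_continuous dp1.
split; first exact: cont_comp.
move=> j; have [cg cs d1 d2] := H j; split.
- by apply: cont_mul => //; exact: cont_comp.
- apply: cont_add; first by apply: cont_mul; [exact: cont_comp|exact: cont_exp].
  by apply: cont_mul => //; exact: cont_comp.
- by move=> y; exact: isd_comp.
- move=> y; apply: isd_eq (isd_mul (isd_comp (d1 y) (dp1 _)) (d2 y)) _.
  by ring.
Qed.

Lemma isd_affine n (f : 'rV[R]_n -> R) (c : R) (y v : 'rV[R]_n) :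
  (forall h : R, f (h *: v + y) = h * c + f y) -> is_derive y v f c.
Proof.
move=> H; have d0 : is_derive (0 : R) 1 (fun h : R => h * c + f y) c.
  apply: isd_eq (isd_add (isd_mul (isd_id (0 : R) 1) (isd_cst (0 : R) 1 c)) (isd_cst (0 : R) 1 (f y))) _.
  by rewrite mul1r mulr0 !addr0.
apply: isd_line d0 => h; rewrite H /GRing.scale /= mulr1 addr0 //.
Qed.

Lemma jet2_affine n (w : 'rV[R]_n) (a : R) :
  jet2 (fun y => dot y w + a) (fun j _ => w 0 j) (fun _ _ => 0).
Proof.
split; first by apply: cont_add; [exact: cont_dot|exact: cont_cst].
move=> j; split; try exact: cont_cst.
- move=> y; apply: isd_affine => h.
  by rewrite dotDl dotZl (dotC (delta_mx _ _)) dot_delta addrA.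
- by move=> y; exact: isd_cst.
Qed.

Lemma jet2_sq n (a : 'rV[R]_n) :
  jet2 (fun y => sq (y - a)) (fun j y => 2 * (y - a) 0 j) (fun _ _ => 2).
Proof.
have cya : continuous (fun y : 'rV[R]_n => y - a).
  by apply: contV_sub; [exact: cont_id|exact: cst_continuous].
have cyj j : continuous (fun y : 'rV[R]_n => (y - a) 0 j).
  exact: (@cont_comp _ _ _ _ (fun z : 'rV[R]_n => z 0 j) cya (@cont_coord R n j)).
split; first exact: (@cont_comp _ _ _ _ (@sq R n) cya (@cont_sq R n)).
move=> j; split.
- by apply: cont_mul => //; exact: cont_cst.
- exact: cont_cst.
- move=> y; set c := (y - a) 0 j.
  have d0 : is_derive (0 : R) 1 (fun h : R => h ^+ 2 + (h * (2 * c) + sq (y - a))) (2 * c).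
    apply: isd_eq (isd_add (isd_exp 2 (0 : R)) (isd_add (isd_mul (isd_id (0 : R) 1) (isd_cst (0 : R) 1 (2 * c))) (isd_cst (0 : R) 1 _))) _.
    by rewrite /= expr1 mulr0 mul1r mulr0 !addr0 add0r.
  apply: isd_line d0 => h; rewrite /GRing.scale /= mulr1 addr0.
  rewrite -addrA; move: (y - a) @c => b c.
  rewrite !sqE dotDl !dotDr !dotZl !dotZr (dotC (delta_mx _ _) b).
  by rewrite !dot_delta mxE !eqxx -/c mulr1; ring.
- by move=> y; apply: isd_affine => h; rewrite !mxE !eqxx mulr1; ring.
Qed.

Lemma jet2_ext n f f' (g g' s s' : 'I_n -> 'rV[R]_n -> R) :
  jet2 f g s -> (forall y, f y = f' y) -> (forall j y, g j y = g' j y) ->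
  (forall j y, s j y = s' j y) -> jet2 f' g' s'.
Proof.
move=> H Ef Eg Es.
have -> : f' = f by apply/funext => y.
have -> : g' = g by apply/funext => j; apply/funext => y.
by have -> : s' = s by apply/funext => j; apply/funext => y.
Qed.

Lemma jet2_shift n f (g s : 'I_n -> 'rV[R]_n -> R) a : jet2 f g s ->
  jet2 (fun y => f (y - a)) (fun j y => g j (y - a)) (fun j y => s j (y - a)).
Proof.
have cya : continuous (fun y : 'rV[R]_n => y - a).
  by apply: contV_sub; [exact: cont_id|exact: cst_continuous].
move=> [cf H]; split; first exact: cont_comp cya cf.
move=> j; have [cg cs d1 d2] := H j; split.
- exact: cont_comp cya cg.
- exact: cont_comp cya cs.
- by move=> y; apply: isd_line (d1 (y - a)) => h; rewrite addrA.
- by move=> y; apply: isd_line (d2 (y - a)) => h; rewrite addrA.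
Qed.

Lemma jet2_zero_off n f (g s : 'I_n -> 'rV[R]_n -> R) (K : set 'rV[R]_n) :
  closed K -> jet2 f g s -> (forall y, ~ K y -> f y = 0) ->
  forall j y, ~ K y -> g j y = 0 /\ s j y = 0.
Proof.
move=> clK [_ H] f0 j.
have [_ _ dg ds] := H j.
have oK : open (~` K) by exact: closed_openC.
have zero (p q : 'rV[R]_n -> R) : (forall y, ~ K y -> p y = 0) ->
    (forall y, is_derive y (delta_mx 0 j) p (q y)) -> forall y, ~ K y -> q y = 0.
  move=> p0 dp y nKy.
  have dz : is_derive y (delta_mx 0 j) p 0.
    apply: (@isd_near _ _ _ _ (fun=> 0)).
    have := open_nbhs_nbhs (conj oK nKy); apply: filterS => z nz.
    by rewrite p0.
  by case: (dp y) => _ <-; case: dz => _ <-.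
have g0 := zero _ _ f0 dg.
by move=> y nK; split; [exact: g0|exact: (zero _ _ g0 ds)].
Qed.

(** Green's formula: when [h] is harmonic, h * lap s is the sum over [j] of the
    derivatives of h g_j - f d_j h, and each of them integrates to zero. All
    products extend by zero from [D], as [f] lives on the closed part [K]. *)
Lemma int_harmonic_lap n M (D K : set 'rV[R]_n) (h f : 'rV[R]_n -> R) g s :
  0 <= M -> harmonic_on D h -> closed K -> K `<=` D ->
  (forall y, K y -> `|y| <= M) -> jet2 f g s ->
  (forall y, ~ K y -> f y = 0) -> int_rV (fun y => h y * lap s y) = 0.
Proof.
move=> M0 [[ch dh] hh] clK KD KM jf f0.
have gs0 := jet2_zero_off clK jf f0.
have nM y : M < `|y| -> ~ K y by move=> My /KM; rewrite leNgt My.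
have [cf H] := jf.
have oK : open (~` K) by exact: closed_openC.
pose F j y := h y * g j y - partial j h y * f y.
pose F1 j y := h y * s j y - partial j (partial j h) y * f y.
have cs (j : 'I_n) : csupp M (F1 j).
  have [cg css _ _] := H j; have [_ [c1 d1]] := dh j; have [_ c2] := d1 j.
  split => [|y /nM nK]; last by rewrite /F1 (gs0 j y nK).2 f0 // !mulr0 subrr.
  apply: cont_sub; apply: (mul_zero_off_continuous clK KD) => //; try exact: cont_id.
  - by move=> y nK; exact: (gs0 j y nK).2.
  - exact: c2.1.
have csF (j : 'I_n) : csupp M (F j).
  have [cg css _ _] := H j; have [_ [c1 d1]] := dh j.
  split => [|y /nM nK]; last by rewrite /F (gs0 j y nK).1 f0 // !mulr0 subrr.
  apply: cont_sub; apply: (mul_zero_off_continuous clK KD) => //; try exact: cont_id.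
  by move=> y nK; exact: (gs0 j y nK).1.
have I0 j : int_rV (F1 j) = 0.
  apply: (@int_rV_partial _ n M j (F j)) => // y.
  have [_ _ dg ds] := H j; have [dhj [c1 d1]] := dh j; have [ddh _] := d1 j.
  have [Dy|nDy] := pselect (D y).
    have e1 : is_derive y (delta_mx 0 j) h (partial j h y) by split; [exact: dhj|].
    have e2 : is_derive y (delta_mx 0 j) (partial j h) (partial j (partial j h) y) by split; [exact: ddh|].
    apply: isd_eq (isd_sub (isd_mul e1 (ds y)) (isd_mul e2 (dg y))) _.
    by rewrite /F1; ring.
  have nKy : (~` K) y by move=> /KD.
  rewrite /F1 (gs0 j y nKy).2 f0 // !mulr0 subrr.
  apply: (@isd_near _ _ _ _ (fun=> 0)).
  have := open_nbhs_nbhs (conj oK nKy); apply: filterS => z nz.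
  by rewrite /F (gs0 j z nz).1 f0 // !mulr0 subrr.
have isum : forall l : seq 'I_n, csupp M (fun y => \sum_(j <- l) F1 j y) /\
    int_rV (fun y => \sum_(j <- l) F1 j y) = 0.
  elim=> [|j l [IH1 IH2]].
    under eq_fun do rewrite big_nil; rewrite int_rV0; split => //.
    by split => //; exact: cont_cst.
  under eq_fun do rewrite big_cons; split; first exact: csuppD.
  by rewrite (int_rVD M0 (cs j) IH1) I0 IH2 addr0.
have [_ <-] := isum (index_enum _).
congr int_rV; apply/funext => y; rewrite /F1 sumrB -mulr_sumr -mulr_suml.
have [Dy|nDy] := pselect (D y); first by rewrite hh // mul0r subr0.
by rewrite f0 ?mulr0 ?subr0 // => /KD.
Qed.

(** The derivatives of h * f, extended by zero off [K], integrate to zero. *)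
Lemma int_by_parts n M (D K : set 'rV[R]_n) (h f : 'rV[R]_n -> R)
    (g : 'I_n -> 'rV[R]_n -> R) (w : 'rV[R]_n) :
  0 <= M -> class_C 1 D h -> closed K -> K `<=` D ->
  (forall y, K y -> `|y| <= M) -> continuous f -> (forall j, continuous (g j)) ->
  (forall j y, is_derive y (delta_mx 0 j) f (g j y)) ->
  (forall y, ~ K y -> f y = 0) ->
  csupp M (fun y => h y * \sum_j w 0 j * g j y) /\
  csupp M (fun y => dir_deriv w h y * f y) /\
  int_rV (fun y => h y * \sum_j w 0 j * g j y) =
  - int_rV (fun y => dir_deriv w h y * f y).
Proof.
move=> M0 [ch dh] clK KD KM cf cg dg f0.
have oK : open (~` K) by exact: closed_openC.
have nM y : M < `|y| -> ~ K y by move=> My /KM; rewrite leNgt My.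
have g0 j y : ~ K y -> g j y = 0.
  move=> nKy.
  have dz : is_derive y (delta_mx 0 j) f 0.
    apply: (@isd_near _ _ _ _ (fun=> 0)).
    have := open_nbhs_nbhs (conj oK nKy); apply: filterS => z nz.
    by rewrite f0.
  by case: (dg j y) => _ <-; case: dz => _ <-.
have cs1 j : csupp M (fun y => h y * g j y).
  split => [|y /nM nK]; last by rewrite g0 ?mulr0.
  by apply: (mul_zero_off_continuous clK KD) => //; [exact: cont_id|exact: g0].
have cs2 j : csupp M (fun y => partial j h y * f y).
  have [_ [c1 _]] := dh j.
  split => [|y /nM nK]; last by rewrite f0 ?mulr0.
  by apply: (mul_zero_off_continuous clK KD) => //; exact: cont_id.
have csh : csupp M (fun y => h y * f y).
  split => [|y /nM nK]; last by rewrite f0 ?mulr0.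
  by apply: (mul_zero_off_continuous clK KD) => //; exact: cont_id.
have I0 j : int_rV (fun y => h y * g j y) = - int_rV (fun y => partial j h y * f y).
  apply/eqP; rewrite -addr_eq0 -(int_rVD M0 (cs1 j) (cs2 j)); apply/eqP.
  apply: (@int_rV_partial _ n M j (fun y => h y * f y)) => //; first exact: csuppD.
  move=> y; have [dhj _] := dh j.
  have [Dy|nDy] := pselect (D y).
    have e1 : is_derive y (delta_mx 0 j) h (partial j h y) by split; [exact: dhj|].
    by apply: isd_eq (isd_mul e1 (dg j y)) _; rewrite addrC.
  have nKy : (~` K) y by move=> /KD.
  rewrite g0 // f0 // !mulr0 addr0.
  apply: (@isd_near _ _ _ _ (fun=> 0)).
  have := open_nbhs_nbhs (conj oK nKy); apply: filterS => z nz.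
  by rewrite f0 // mulr0.
have isum : forall l : seq 'I_n,
    [/\ csupp M (fun y => h y * \sum_(j <- l) w 0 j * g j y),
        csupp M (fun y => (\sum_(j <- l) w 0 j *: partial j h y) * f y) &
    int_rV (fun y => h y * \sum_(j <- l) w 0 j * g j y) =
    - int_rV (fun y => (\sum_(j <- l) w 0 j *: partial j h y) * f y)].
  elim=> [|j l [IH1 IH2 IH3]].
    have -> : (fun y : 'rV[R]_n => h y * \sum_(j <- [::]) w 0 j * g j y) = fun=> 0.
      by apply/funext => y; rewrite big_nil mulr0.
    have -> : (fun y : 'rV[R]_n => (\sum_(j <- [::]) w 0 j *: partial j h y) * f y) = fun=> 0.
      by apply/funext => y; rewrite big_nil mul0r.
    by rewrite int_rV0 oppr0; split => //; split => //; exact: cont_cst.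
  have -> : (fun y : 'rV[R]_n => h y * \sum_(j <- j :: l) w 0 j * g j y) =
     (fun y => w 0 j * (h y * g j y) + h y * \sum_(j <- l) w 0 j * g j y).
    by apply/funext => y; rewrite big_cons mulrDr mulrCA.
  have -> : (fun y : 'rV[R]_n => (\sum_(j <- j :: l) w 0 j *: partial j h y) * f y) =
     (fun y => w 0 j * (partial j h y * f y) + (\sum_(j <- l) w 0 j *: partial j h y) * f y).
    by apply/funext => y; rewrite big_cons mulrDl mulrA.
  split; try by apply: csuppD => //; exact: csuppZ.
  rewrite !(int_rVD M0 (csuppZ _ _)) //.
  by rewrite (int_rVZ _ M0 (cs1 j)) (int_rVZ _ M0 (cs2 j)) I0 IH3; ring.
have [H1 H2 H3] := isum (index_enum _).
by split; [|split].
Qed.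

End Jets.

(** * A smooth step *)

Section SpecialFunctions.
Variable R : realType.

(** A function may be frozen beyond a point where its derivative vanishes. *)
Lemma isd_max (a : R) (f f1 : R -> R) :
  (forall t : R, a <= t -> is_derive t 1 f (f1 t)) -> f1 a = 0 ->
  forall t : R, is_derive t 1 (fun t => f (Num.max t a)) (f1 (Num.max t a)).
Proof.
move=> df f1a t; have [ta|ta|->] := ltgtP t a.
- rewrite f1a; apply: (@isd_near _ _ _ _ (fun=> f a)).
  by near=> z; rewrite max_r // ltW //; near: z; exact: lt_nbhsl.
- apply: (@isd_near _ _ _ _ f); last exact/df/ltW.
  by near=> z; rewrite max_l // ltW //; near: z; exact: lt_nbhsr.
- have d1 : is_derive a 1 (fun=> f a) (f1 a) by rewrite f1a; exact: isd_cst.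
  have := isd_glue (erefl (f a)) d1 (df a (lexx a)).
  rewrite (_ : (fun x => _) = (fun t => f (Num.max t a))) //.
  by apply/funext => x; case: ltP => xa.
Unshelve. all: by end_near. Qed.

Lemma isd_min (a : R) (f f1 : R -> R) :
  (forall t : R, t <= a -> is_derive t 1 f (f1 t)) -> f1 a = 0 ->
  forall t : R, is_derive t 1 (fun t => f (Num.min t a)) (f1 (Num.min t a)).
Proof.
move=> df f1a t; have [ta|ta|->] := ltgtP t a.
- apply: (@isd_near _ _ _ _ f); last exact/df/ltW.
  by near=> z; rewrite min_l // ltW //; near: z; exact: lt_nbhsl.
- rewrite f1a; apply: (@isd_near _ _ _ _ (fun=> f a)).
  by near=> z; rewrite min_r // ltW //; near: z; exact: lt_nbhsr.
- have d1 : is_derive a 1 (fun=> f a) (f1 a) by rewrite f1a; exact: isd_cst.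
  have := isd_glue (erefl (f a)) (df a (lexx a)) d1.
  rewrite (_ : (fun x => _) = (fun t => f (Num.min t a))) //.
  by apply/funext => x; case: ltP => xa.
Unshelve. all: by end_near. Qed.

Definition clamp01 (x : R) := Num.min (Num.max x 0) 1.

Lemma clamp01_itv x : 0 <= clamp01 x <= 1.
Proof. by rewrite ge_min lexx orbT andbT le_min le_max lexx orbT ler01. Qed.

Lemma clamp01_le0 x : x <= 0 -> clamp01 x = 0.
Proof. by move=> x0; rewrite /clamp01 max_r // min_l. Qed.

Lemma clamp01_ge1 x : 1 <= x -> clamp01 x = 1.
Proof. by move=> x1; rewrite /clamp01 max_l ?min_r // (le_trans ler01). Qed.

Lemma cont_clamp01 : continuous clamp01.
Proof.
apply: cont_min; last exact: cont_cst.
by apply: cont_max; [exact: cont_id|exact: cont_cst].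
Qed.

Lemma isd_clamp01 (f f1 : R -> R) : (forall t : R, is_derive t 1 f (f1 t)) ->
  f1 0 = 0 -> f1 1 = 0 ->
  forall t : R, is_derive t 1 (fun t => f (clamp01 t)) (f1 (clamp01 t)).
Proof.
move=> df f10 f11 t.
have d1 : forall t : R, is_derive t 1 (fun t => f (Num.min t 1)) (f1 (Num.min t 1)).
  by apply: isd_min.
have H0 : f1 (Num.min 0 1) = 0 by rewrite min_l.
exact: (@isd_max 0 (fun t => f (Num.min t 1)) (fun t => f1 (Num.min t 1)) (fun x _ => d1 x) H0).
Qed.

(** The polynomial [S] with S' = 140 x^3 (1 - x)^3 has three derivatives that
    vanish at 0 and 1, so it stays C^3 when composed with a clamped affine
    function. *)
Lemma exists_smooth_step (a b : R) : a < b -> exists E0 E1 E2 E3 : R -> R,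
  [/\ [/\ forall t : R, is_derive t 1 E0 (- E1 t), forall t : R, is_derive t 1 E1 (E2 t),
         forall t : R, is_derive t 1 E2 (E3 t) & continuous E3],
      (forall t, t <= a -> E0 t = 1), (forall t, b <= t -> E0 t = 0),
      (forall t, 0 <= E0 t <= 1) /\ (forall t, 0 <= E1 t) &
      (forall t, ~~ (a < t < b) -> E1 t = 0 /\ E2 t = 0)].
Proof.
move=> ab; have ba0 : 0 < b - a by rewrite subr_gt0.
pose S (x : R) := 35 * x ^+ 4 - 84 * x ^+ 5 + 70 * x ^+ 6 - 20 * x ^+ 7.
pose S1 (x : R) := 140 * (x ^+ 3 * (1 - x) ^+ 3).
pose S2 (x : R) := 420 * (x ^+ 2 * (1 - x) ^+ 2 * (1 - 2 * x)).
pose S3 (x : R) := 840 * (x * (1 - x) * (1 - 5 * x + 5 * x ^+ 2)).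
have d1x (x : R) : is_derive x 1 (fun x : R => 1 - x) (- 1).
  by apply: isd_eq (isd_sub (isd_cst _ _ _) (isd_id _ _)) _; rewrite sub0r.
have d1xk k (x : R) : is_derive x 1 (fun x : R => (1 - x) ^+ k) (- (k%:R * (1 - x) ^+ k.-1)).
  by apply: isd_eq (isd_comp (d1x x) (isd_exp k _)) _; rewrite mulrN1.
have dck k c (x : R) : is_derive x 1 (fun x : R => c * x ^+ k) (c * (k%:R * x ^+ k.-1)).
  by apply: isd_eq (isd_mul (isd_cst _ _ _) (isd_exp k _)) _; rewrite mul0r add0r.
have dS (x : R) : is_derive x 1 S (S1 x).
  apply: isd_eq (isd_sub (isd_add (isd_sub (dck 4 _ _) (dck 5 _ _)) (dck 6 _ _)) (dck 7 _ _)) _.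
  by rewrite /S1 /=; ring.
have dS1 (x : R) : is_derive x 1 S1 (S2 x).
  apply: isd_eq (isd_mul (isd_cst _ _ _) (isd_mul (isd_exp 3 _) (d1xk 3 _))) _.
  by rewrite /S2 /=; ring.
have dS2 (x : R) : is_derive x 1 S2 (S3 x).
  have dl : is_derive x 1 (fun x : R => 1 - 2 * x) (- 2).
    apply: isd_eq (isd_sub (isd_cst _ _ _) (isd_mul (isd_cst _ _ _) (isd_id _ _))) _.
    by ring.
  apply: isd_eq (isd_mul (isd_cst _ _ _) (isd_mul (isd_mul (isd_exp 2 _) (d1xk 2 _)) dl)) _.
  by rewrite /S3 /=; ring.
have cS3 : continuous S3.
  apply: cont_mul; first exact: cont_cst.
  apply: cont_mul.
    apply: cont_mul; first exact: cont_id.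
    by apply: cont_sub; [exact: cont_cst|exact: cont_id].
  apply: cont_add.
    apply: cont_sub; first exact: cont_cst.
    by apply: cont_mul; [exact: cont_cst|exact: cont_id].
  apply: cont_mul; first exact: cont_cst.
  by apply: cont_exp; exact: cont_id.
pose L := b - a; pose u (t : R) := (t - a) / L.
have du (t : R) : is_derive t 1 u L^-1.
  apply: isd_eq (isd_mul (isd_sub (isd_id _ _) (isd_cst _ _ _)) (isd_cst _ _ _)) _.
  by rewrite mulr0 addr0 subr0 mul1r.
have cu : continuous u by exact: isd_continuous du.
have dc (f f1 : R -> R) c : (forall t : R, is_derive t 1 f (f1 t)) -> f1 0 = 0 -> f1 1 = 0 ->
    forall t : R, is_derive t 1 (fun t => c * f (clamp01 (u t))) (c / L * f1 (clamp01 (u t))).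
  move=> df f10 f11 t.
  apply: isd_eq (isd_mul (isd_cst _ _ _) (isd_comp (du t) (isd_clamp01 df f10 f11 (u t)))) _.
  by rewrite mul0r add0r mulrCA [RHS]mulrC mulrA.
have u0 t : t <= a -> clamp01 (u t) = 0.
  by move=> ta; apply: clamp01_le0; rewrite pmulr_lle0 ?invr_gt0 // subr_le0.
have u1 t : b <= t -> clamp01 (u t) = 1.
  by move=> bt; apply: clamp01_ge1; rewrite ler_pdivlMr // mul1r lerD2r.
exists (fun t => 1 - 1 * S (clamp01 (u t))), (fun t => 1 / L * S1 (clamp01 (u t))),
  (fun t => 1 / L / L * S2 (clamp01 (u t))), (fun t => 1 / L / L / L * S3 (clamp01 (u t))).
have S10 : S1 0 = 0 by rewrite /S1; ring.
have S11 : S1 1 = 0 by rewrite /S1; ring.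
have S20 : S2 0 = 0 by rewrite /S2; ring.
have S21 : S2 1 = 0 by rewrite /S2; ring.
split.
- split.
  + move=> t; apply: isd_eq (isd_sub (isd_cst _ _ _) (dc S S1 1 dS S10 S11 t)) _.
    by rewrite sub0r.
  + by apply: dc.
  + by apply: dc => //; rewrite /S3; ring.
  + apply: cont_mul; first exact: cont_cst.
    by apply: (@cont_comp _ _ _ (fun t => clamp01 (u t))) => //; exact: (cont_comp cu cont_clamp01).
- by move=> t ta; rewrite u0 // /S; ring.
- by move=> t ta; rewrite u1 // /S; ring.
- split=> t; have /andP[c0 c1] := clamp01_itv (u t); move: (clamp01 _) c0 c1 => x c0 c1.
    have Q (z : R) : 0 <= z -> 0 <= 1 + 4 * z + 10 * z ^+ 2 + 20 * z ^+ 3.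
      by move=> z0; rewrite !addr_ge0 // mulr_ge0 // exprn_ge0.
    have x1 : 0 <= 1 - x by rewrite subr_ge0.
    apply/andP; split.
      (* [S] and [1 - S] are exchanged by x -> 1 - x and have nonnegative factors *)
      have -> : 1 - 1 * S x = (1 - x) ^+ 4 * (1 + 4 * x + 10 * x ^+ 2 + 20 * x ^+ 3).
        by rewrite /S; ring.
      by rewrite mulr_ge0 ?exprn_ge0 ?Q.
    have -> : S x = x ^+ 4 * (1 + 4 * (1 - x) + 10 * (1 - x) ^+ 2 + 20 * (1 - x) ^+ 3).
      by rewrite /S; ring.
    by rewrite mul1r gerBl mulr_ge0 ?exprn_ge0 ?Q.
  have LL : 0 <= 1 / L by rewrite divr_ge0 // ltW.
  rewrite mulr_ge0 // /S1 mulr_ge0 // mulr_ge0 // exprn_ge0 //; lra.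
- move=> t; rewrite negb_and -!leNgt => /orP[ta|tb]; first by rewrite u0 // S10 S20 !mulr0.
  by rewrite u1 // S11 S21 !mulr0.
Qed.

End SpecialFunctions.

(** * The regularised dipole potential *)

Section Potential.
Variable R : realType.

Lemma isd_sqrt_pow n (t : R) : 0 < t ->
  is_derive t 1 (fun t : R => (Num.sqrt t ^+ n)^-1) (- (n%:R / 2) * (Num.sqrt t ^+ (n + 2))^-1).
Proof.
move=> t0; have s0 : 0 < Num.sqrt t by rewrite sqrtr_gt0.
have sn : Num.sqrt t ^+ n != 0 by rewrite expf_neq0 // gt_eqF.
apply: isd_eq (isd_inv (isd_comp (is_derive1_sqrt t0) (isd_exp n _)) sn) _.
case: n sn => [|n] sn /=; first by rewrite !mul0r oppr0 !mul0r.
by rewrite exprD !exprS; field; rewrite gt_eqF //= expf_neq0 // gt_eqF.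
Qed.

(** [e] is rho^(-n/2) for rho >= d^2, n = m + 1, continued inside by its second
    order Taylor polynomial: with this choice the divergence of y e(|y|^2) is a
    nonnegative bump, which carries the mass [omega n], and y_j e(|y|^2) is
    harmonic outside the ball of radius [d]. *)
Lemma exists_potential m (d : R) : 0 < d -> exists (e e1 e2 : R -> R) (C : R),
  [/\ [/\ forall t : R, is_derive t 1 e (e1 t), forall t : R, is_derive t 1 e1 (e2 t) &
        continuous e2],
    forall t, d ^+ 2 <= t ->
      [/\ e t = (Num.sqrt t ^+ m.+1)^-1,
          e1 t = - (m.+1%:R / 2) * (Num.sqrt t ^+ (m.+1 + 2))^-1 &
          (m.+1%:R + 2) * e1 t + 2 * t * e2 t = 0],
    forall t, m.+1%:R * e t + 2 * t * e1 t = C * Num.sqrt (d ^+ 2 - t) ^+ 4 &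
    0 <= C /\ C * int_rV (@bump R m.+1 4 (d ^+ 2)) = omega R m.+1].
Proof.
move=> d0; set n := m.+1; pose a := d ^+ 2; have a0 : 0 < a by rewrite exprn_gt0.
pose k : R := n%:R / 2; have k0 : 0 < k by rewrite divr_gt0 ?ltr0n.
have sa : Num.sqrt a = d by rewrite sqrtr_sqr gtr0_norm.
pose c := (d ^+ n)^-1; have c0 : 0 < c by rewrite invr_gt0 exprn_gt0.
pose p j (t : R) := (Num.sqrt t ^+ j)^-1.
pose T (t : R) := c * (1 - k * (t / a - 1) + k * (k + 1) / 2 * (t / a - 1) ^+ 2).
pose T1 (t : R) := c / a * (- k + k * (k + 1) * (t / a - 1)).
pose T2 : R := c / a / a * (k * (k + 1)).
have du (t : R) : is_derive t 1 (fun t : R => t / a - 1) a^-1.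
  apply: isd_eq (isd_sub (isd_mul (isd_id _ _) (isd_cst _ _ _)) (isd_cst _ _ _)) _.
  by rewrite mulr0 addr0 subr0 mul1r.
have dT (t : R) : is_derive t 1 T (T1 t).
  have d2 := isd_comp (du t) (isd_exp 2 _).
  apply: isd_eq (isd_mul (isd_cst t 1 c) (isd_add (isd_sub (isd_cst t 1 1) (isd_mul (isd_cst t 1 k) (du t))) (isd_mul (isd_cst t 1 (k * (k + 1) / 2)) d2))) _.
  by rewrite /T1 /= expr1; field; rewrite gt_eqF.
have dT1 (t : R) : is_derive t 1 T1 T2.
  apply: isd_eq (isd_mul (isd_cst t 1 (c / a)) (isd_add (isd_cst t 1 (- k)) (isd_mul (isd_cst t 1 (k * (k + 1))) (du t)))) _.
  by rewrite /T2; field; rewrite gt_eqF.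
pose f (t : R) := p n t - T t.
pose f1 (t : R) := - k * p (n + 2)%N t - T1 t.
pose f2 (t : R) := k * (k + 1) * p (n + 4)%N t - T2.
have pos t : a <= t -> 0 < t by exact: lt_le_trans.
have df t : a <= t -> is_derive t 1 f (f1 t).
  by move=> /pos t0; exact: isd_sub (isd_sqrt_pow n t0) (dT t).
have df1 t : a <= t -> is_derive t 1 f1 (f2 t).
  move=> /pos t0; apply: isd_eq (isd_sub (isd_mul (isd_cst t 1 (- k)) (isd_sqrt_pow (n + 2) t0)) (dT1 t)) _.
  rewrite mul0r add0r /f2 -addnA /p natrD; congr (_ - _).
  by move: (Num.sqrt t ^+ _)^-1 => q; rewrite /k; field.
have fa : f a = 0 by rewrite /f /p sa /T divff ?gt_eqF // subrr mulr0 subr0 expr0n mulr0 addr0 mulr1 subrr.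
have f1a : f1 a = 0.
  rewrite /f1 /p sa /T1 divff ?gt_eqF // subrr mulr0 addr0 /c /a exprD.
  by field; rewrite gt_eqF //= expf_neq0 // gt_eqF.
have f2a : f2 a = 0.
  rewrite /f2 /p sa /T2 /c /a exprD.
  by field; rewrite gt_eqF //= expf_neq0 // gt_eqF.
have cmax : continuous (fun t : R => Num.max t a).
  by apply: cont_max; [exact: cont_id|exact: cont_cst].
have an : forall t, a <= Num.max t a by move=> t; rewrite le_max lexx orbT.
exists (fun t => T t + f (Num.max t a)), (fun t => T1 t + f1 (Num.max t a)),
  (fun t => T2 + f2 (Num.max t a)), (n%:R * (n%:R + 2) * (n%:R + 4) / 8 * (c / a / a)).
split.
- split.
  + by move=> t; exact: isd_add (dT t) (isd_max df f1a t).
  + by move=> t; exact: isd_add (dT1 t) (isd_max df1 f2a t).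
  + apply: cont_add; first exact: cont_cst.
    apply: cont_sub; last exact: cont_cst.
    apply: cont_mul; first exact: cont_cst.
    apply: cont_inv; first exact: cont_sqrt_exp.
    move=> t; rewrite expf_neq0 // gt_eqF // sqrtr_gt0; exact: pos.
- move=> t at0; have t0 := pos _ at0; rewrite max_l //; split.
  + by rewrite /f addrC subrK.
  + by rewrite /f1 addrC subrK.
  + rewrite /f1 /f2 ![T1 t + _]addrC ![T2 + _]addrC !subrK /p.
    have s0 : 0 < Num.sqrt t by rewrite sqrtr_gt0.
    have E : t = Num.sqrt t ^+ 2 by rewrite sqr_sqrtr // ltW.
    rewrite {2}E !exprD /k; field.
    by rewrite gt_eqF //= expf_neq0 // gt_eqF.
- move=> t; have [at0|ta] := leP a t.
    have t0 := pos _ at0.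
    rewrite /= ?max_l // /f /f1 addrC [T t + _]addrC [T1 t + _]addrC !subrK /p.
    rewrite [Num.sqrt (d ^+ 2 - t)]ler0_sqrtr ?subr_le0 // expr0n mulr0.
    have s0 : 0 < Num.sqrt t by rewrite sqrtr_gt0.
    have E : t = Num.sqrt t ^+ 2 by rewrite sqr_sqrtr // ltW.
    rewrite {1}E exprD /k; field.
    by rewrite expf_neq0 ?gt_eqF.
  rewrite /= ?max_r ?(ltW ta) // fa f1a !addr0.
  rewrite [Num.sqrt _ ^+ 4](_ : _ = (Num.sqrt (d ^+ 2 - t) ^+ 2) ^+ 2); last by rewrite -exprM.
  rewrite sqr_sqrtr ?subr_ge0 ?(ltW ta) // /T /T1 -/a /k.
  by field; rewrite gt_eqF.
- split.
    have nn : 0 <= n%:R * (n%:R + 2) * (n%:R + 4) / 8 :> R.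
      by rewrite divr_ge0 // !mulr_ge0 // addr_ge0.
    apply: mulr_ge0 => //; exact: ltW (divr_gt0 (divr_gt0 c0 a0) a0).
  have B1 := int_bump4_omega R m; rewrite -/n in B1.
  have -> : omega R n = (n * (n + 2) * (n + 4))%:R * int_rV (@bump R n 4 1) / 8.
    by rewrite B1; field.
  rewrite -/a /n !int_bump sqrtr1 expr1n mul1r sa !natrM !natrD /c /a exprD.
  by field; rewrite gt_eqF //= expf_neq0 // gt_eqF.
Qed.

End Potential.

(** * Green's identity in a half-space *)

Section Representation.
Variable R : realType.

Variables (m : nat) (d dl d1 d2 : R).
Hypotheses (m0 : (0 < m)%N) (dl0 : 0 < dl) (dld1 : dl <= d1) (d12 : d1 < d2) (d2d : d2 < d).
Let n := m.+1.
Let d10 : 0 < d1. Proof. exact: lt_le_trans dld1. Qed.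
Variables (nu l : 'rV[R]_n) (h : 'rV[R]_n -> R) (U : R).
Hypotheses (nu1 : sq nu = 1) (l1 : sq l = 1).
Let D := [set y : 'rV[R]_n | - d < dot y nu].
Hypotheses (hD : harmonic_on D h) (hU : forall y, D y -> `|h y| <= U).

(* the profile of [exists_potential] *)
Variables (e e1 e2 : R -> R) (C : R).
Hypotheses (de : forall t : R, is_derive t 1 e (e1 t))
  (de1 : forall t : R, is_derive t 1 e1 (e2 t)) (ce2 : continuous e2).
Hypothesis (eE : forall t, dl ^+ 2 <= t ->
  [/\ e t = (Num.sqrt t ^+ n)^-1, e1 t = - (n%:R / 2) * (Num.sqrt t ^+ (n + 2))^-1 &
      (n%:R + 2) * e1 t + 2 * t * e2 t = 0]).
Hypothesis (eW : forall t, n%:R * e t + 2 * t * e1 t = C * Num.sqrt (dl ^+ 2 - t) ^+ 4).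

(* the step of [exists_smooth_step], applied to heights along [nu] *)
Variables (E0 E1 E2 E3 : R -> R).
Hypotheses (dE0 : forall t : R, is_derive t 1 E0 (- E1 t))
  (dE1 : forall t : R, is_derive t 1 E1 (E2 t)) (dE2 : forall t : R, is_derive t 1 E2 (E3 t))
  (cE3 : continuous E3).
Hypotheses (E0lo : forall t, t <= d1 -> E0 t = 1) (E0hi : forall t, d2 <= t -> E0 t = 0)
  (E001 : forall t, 0 <= E0 t <= 1) (E1ge0 : forall t, 0 <= E1 t)
  (E12out : forall t, ~~ (d1 < t < d2) -> E1 t = 0 /\ E2 t = 0).

(* another such step, applied to |y|^2 / r^2 *)
Variables (X0 X1 X2 : R -> R) (CX : R).
Hypotheses (dX0 : forall t : R, is_derive t 1 X0 (- X1 t))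
  (dX1 : forall t : R, is_derive t 1 X1 (X2 t)) (cX2 : continuous X2).
Hypotheses (X0lo : forall t, t <= 1 -> X0 t = 1) (X0hi : forall t, 4 <= t -> X0 t = 0)
  (X001 : forall t, 0 <= X0 t <= 1)
  (X12out : forall t, ~~ (1 < t < 4) -> X1 t = 0 /\ X2 t = 0)
  (X1b : forall t, `|X1 t| <= CX) (X2b : forall t, `|X2 t| <= CX).
Variable r : R.
Hypotheses (r0 : 0 < r) (d1r : d1 <= r).

(* the dipole in the direction [l], its gradient [gd], its pure second
   derivatives [gs], and its derivative [gnu] along [nu] *)
Let g (y : 'rV[R]_n) := dot y l * e (sq y).
Let gd j (y : 'rV[R]_n) := l 0 j * e (sq y) + dot y l * (e1 (sq y) * (2 * y 0 j)).
Let gs j (y : 'rV[R]_n) := 4 * (l 0 j * (e1 (sq y) * y 0 j)) +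
  dot y l * (e2 (sq y) * (2 * y 0 j) ^+ 2 + e1 (sq y) * 2).
Let gnu (y : 'rV[R]_n) := dot nu l * e (sq y) + 2 * (dot y l * dot y nu * e1 (sq y)).

Lemma double_r_ge0 : 0 <= 2 * r. Proof. by rewrite mulr_ge0 // ltW. Qed.

Lemma jet2_sq0 : jet2 (@sq R n) (fun j y => 2 * y 0 j) (fun _ _ => 2).
Proof.
by apply: jet2_ext (jet2_sq (0 : 'rV[R]_n)) _ _ _ => [y|j y|//]; rewrite ?subr0.
Qed.

Lemma jet2_potential : jet2 g gd gs.
Proof.
apply: jet2_ext (jet2_mul (jet2_affine l 0) (jet2_comp jet2_sq0 ce2 de de1)) _ _ _.
- by move=> y; rewrite addr0.
- by move=> j y; rewrite addr0.
- by move=> j y; rewrite /gs addr0; ring.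
Qed.

Lemma lap_potential y : lap gs y = 2 * dot y l * ((n%:R + 2) * e1 (sq y) + 2 * sq y * e2 (sq y)).
Proof.
rewrite /lap /gs big_split /=.
rewrite (_ : \sum_(i < n) 4 * _ = 4 * (e1 (sq y) * dot y l)); last first.
  rewrite /dot !mulr_sumr; apply: eq_bigr => j _; ring.
rewrite -mulr_sumr big_split /= sumr_const card_ord.
rewrite (_ : \sum_(i < n) _ = 4 * (e2 (sq y) * sq y)); last first.
  rewrite /sq !mulr_sumr; apply: eq_bigr => j _; ring.
by rewrite -[_ *+ n]mulr_natr; ring.
Qed.

Lemma gnuE y : \sum_j nu 0 j * gd j y = gnu y.
Proof.
rewrite /gd /gnu; transitivity (\sum_j (e (sq y) * (nu 0 j * l 0 j) + 2 * (dot y l * e1 (sq y)) * (y 0 j * nu 0 j))).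
  by apply: eq_bigr => j _; ring.
by rewrite big_split /= -!mulr_sumr /dot; ring.
Qed.

(* the cutoff with its first and second derivatives *)
Let chi (y : 'rV[R]_n) := X0 (sq y / r ^+ 2).
Let chid j (y : 'rV[R]_n) := - X1 (sq y / r ^+ 2) * (2 * y 0 j / r ^+ 2).
Let chis (j : 'I_n) (y : 'rV[R]_n) := - X2 (sq y / r ^+ 2) * (2 * y 0 j / r ^+ 2) ^+ 2
   - X1 (sq y / r ^+ 2) * (2 / r ^+ 2).

Lemma jet2_cutoff : jet2 chi chid chis.
Proof.
have r2 : continuous (fun _ : R => 0 : R) by exact: cont_cst.
have dc (t : R) : is_derive t 1 (fun t : R => t / r ^+ 2) (r ^+ 2)^-1.
  apply: isd_eq (isd_mul (isd_id _ _) (isd_cst _ _ _)) _.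
  by rewrite mulr0 addr0 mul1r.
have dc2 (t : R) : is_derive t 1 (fun _ : R => (r ^+ 2)^-1) 0 by exact: isd_cst.
have j1 := jet2_comp jet2_sq0 r2 dc dc2.
have dX0' (t : R) : is_derive t 1 (fun t => - X1 t) (- X2 t) by exact: is_deriveN.
have cX2' : continuous (fun t => - X2 t) by move=> t; apply: cvgN; exact: cX2.
apply: jet2_ext (jet2_comp j1 cX2' dX0 dX0') _ _ _ => //.
- by move=> j y; rewrite /chid; ring.
- by move=> j y; rewrite /chis; ring.
Qed.

(* [P0] and [P v] are the Laplacians of the test functions
   chi(y) E0(- y.nu) g(y) and chi(y) E1(v - y.nu) g(y - 2 v nu) *)
Let A (y : 'rV[R]_n) := E0 (- dot y nu).
Let P0 (y : 'rV[R]_n) := lap chis y * (A y * g y) +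
  2 * \sum_j chid j y * (nu 0 j * E1 (- dot y nu) * g y + A y * gd j y) +
  chi y * (- E2 (- dot y nu) * g y + 2 * (E1 (- dot y nu) * gnu y) + A y * lap gs y).
Let P v (y : 'rV[R]_n) := let z := y - (2 * v) *: nu in
  lap chis y * (E1 (v - dot y nu) * g z) +
  2 * \sum_j chid j y * (- nu 0 j * E2 (v - dot y nu) * g z + E1 (v - dot y nu) * gd j z) +
  chi y * (E3 (v - dot y nu) * g z - 2 * (E2 (v - dot y nu) * gnu z) + E1 (v - dot y nu) * lap gs z).

(* a closed part of the half-space that holds the supports of all test
   functions *)
Let K := [set y : 'rV[R]_n | sq y <= 4 * r ^+ 2 /\ - d2 <= dot y nu].

Lemma sum_nu_sq : \sum_j nu 0 j ^+ 2 = 1.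
Proof. exact: nu1. Qed.

Lemma closed_K : closed K.
Proof.
have -> : K = [set y | sq y <= 4 * r ^+ 2] `&` [set y | - d2 <= dot y nu] by [].
apply: closedI.
  apply: (@closed_comp _ _ (@sq R n) [set z : R | z <= 4 * r ^+ 2]); last exact: closed_le.
  by move=> x _; exact: cont_sq.
apply: (@closed_comp _ _ (fun y : 'rV[R]_n => dot y nu) [set z : R | - d2 <= z]); last exact: closed_ge.
by move=> x _; exact: cont_dot.
Qed.

Lemma K_sub : K `<=` D.
Proof. by move=> y [_ H]; rewrite /D /=; apply: lt_le_trans H; rewrite ltrN2. Qed.

Lemma K_bound y : K y -> `|y| <= 2 * r.
Proof.
move=> [H _]; apply: le_trans (norm_le_sqrt_sq y) _.
rewrite -[leRHS]ger0_norm ?mulr_ge0 ?(ltW r0) // -sqrtr_sqr ler_sqrt ?sqr_ge0 //.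
by rewrite exprMn; apply: le_trans H _; rewrite -natrX.
Qed.

Lemma chi_out y : 4 * r ^+ 2 <= sq y -> chi y = 0.
Proof. by move=> H; apply: X0hi; rewrite ler_pdivlMr // exprn_gt0. Qed.

Lemma notK y : ~ K y -> 4 * r ^+ 2 <= sq y \/ d2 <= - dot y nu.
Proof.
move=> nK; have [H|H] := leP (4 * r ^+ 2) (sq y); first by left.
right; rewrite leNgt; apply/negP => H'; apply: nK; split; first exact: ltW.
by rewrite lerNl ltW.
Qed.

Definition laplacian_of_test (p : 'rV[R]_n -> R) := exists f g' s',
  [/\ jet2 f g' s', forall y, ~ K y -> f y = 0 & forall y, p y = lap s' y].

Lemma int_laplacian_of_test p : laplacian_of_test p -> int_rV (fun y => h y * p y) = 0.
Proof.
move=> [f [g' [s' [jt f0 pE]]]].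
have -> : p = lap s' by apply/funext.
apply: (@int_harmonic_lap _ n (2 * r) D K h f g' s') => //.
- by rewrite mulr_ge0 // ltW.
- exact: closed_K.
- exact: K_sub.
- exact: K_bound.
Qed.

Lemma laplacian_of_test_out p y : laplacian_of_test p -> ~ K y -> p y = 0.
Proof.
move=> [f [g' [s' [jt f0 pE]]]] nK; rewrite pE /lap big1 // => j _.
exact: (jet2_zero_off closed_K jt f0 j nK).2.
Qed.

Lemma test_P0 : laplacian_of_test P0.
Proof.
have jA : jet2 A (fun j y => nu 0 j * E1 (- dot y nu)) (fun j y => nu 0 j ^+ 2 * - E2 (- dot y nu)).
  have dE0' (t : R) : is_derive t 1 (fun t => - E1 t) (- E2 t) by exact: is_deriveN.
  have cE2 : continuous E2 by exact: isd_continuous dE2.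
  have cE2' : continuous (fun t => - E2 t) by move=> t; apply: cvgN; exact: cE2.
  apply: jet2_ext (jet2_comp (jet2_affine (- nu) 0) cE2' dE0 dE0') _ _ _.
  - by move=> y; rewrite addr0 dotNr.
  - by move=> j y; rewrite addr0 dotNr mxE; ring.
  - by move=> j y; rewrite addr0 dotNr mxE; ring.
have jt := jet2_mul jet2_cutoff (jet2_mul jA jet2_potential).
do 3 eexists; split; first exact: jt.
- move=> y /notK [/chi_out ->|/E0hi]; first by rewrite mul0r.
  by rewrite -/(A y) => ->; rewrite mul0r mulr0.
- move=> y; have lapA : lap (fun j y => nu 0 j ^+ 2 * - E2 (- dot y nu)) y = - E2 (- dot y nu).
    by rewrite /lap -mulr_suml sum_nu_sq mul1r.
  rewrite !lap_mul /P0 lapA.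
  rewrite (_ : \sum_j nu 0 j * _ * _ = E1 (- dot y nu) * gnu y); last first.
    by rewrite -gnuE mulr_sumr; apply: eq_bigr => j _; ring.
  by [].
Qed.

Lemma test_P v : 0 <= v -> laplacian_of_test (P v).
Proof.
move=> v0.
have jB : jet2 (fun y => E1 (v - dot y nu)) (fun j y => - nu 0 j * E2 (v - dot y nu))
    (fun j y => nu 0 j ^+ 2 * E3 (v - dot y nu)).
  apply: jet2_ext (jet2_comp (jet2_affine (- nu) v) cE3 dE1 dE2) _ _ _.
  - by move=> y; rewrite dotNr addrC.
  - by move=> j y; rewrite dotNr mxE [- dot y nu + v]addrC; ring.
  - by move=> j y; rewrite dotNr mxE [- dot y nu + v]addrC; ring.
have jt := jet2_mul jet2_cutoff (jet2_mul jB (jet2_shift ((2 * v) *: nu) jet2_potential)).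
do 3 eexists; split; first exact: jt.
- move=> y /notK [/chi_out ->|H]; first by rewrite mul0r.
  rewrite (E12out _).1 ?mul0r ?mulr0 // negb_and -!leNgt; apply/orP; right.
  by apply: le_trans H _; rewrite lerDr.
- move=> y; have lapB : lap (fun j y => nu 0 j ^+ 2 * E3 (v - dot y nu)) y = E3 (v - dot y nu).
    by rewrite /lap -mulr_suml sum_nu_sq mul1r.
  rewrite !lap_mul /P lapB.
  rewrite (_ : \sum_j - nu 0 j * _ * _ = - (E2 (v - dot y nu) * gnu (y - (2 * v) *: nu))); last first.
    by rewrite -gnuE -mulNr mulr_sumr; apply: eq_bigr => j _; ring.
  by rewrite mulrN -/(lap gs _).
Qed.

Lemma lap_potential0 z : dl ^+ 2 <= sq z -> lap gs z = 0.
Proof. by move=> /eE [_ _ H]; rewrite lap_potential H mulr0. Qed.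

Lemma sq_shift y v : sq (y - (2 * v) *: nu) = sq y + 4 * (v * (v - dot y nu)).
Proof.
rewrite !sqE dotBl !dotBr !dotZl !dotZr -[dot nu nu]sqE nu1 (dotC nu y); ring.
Qed.

(** A point below the hyperplane y.nu = v is nearer to 0 than to the mirror image
    2 v nu of 0. *)
Lemma shift_far y v : 0 <= v -> d1 < v - dot y nu ->
  dl ^+ 2 <= sq (y - (2 * v) *: nu) /\ sq y <= sq (y - (2 * v) *: nu).
Proof.
move=> v0 H; split; last first.
  by rewrite sq_shift lerDl !mulr_ge0 //; apply: ltW; exact: lt_trans d10 H.
apply: (@le_trans _ _ (dot (y - (2 * v) *: nu) nu ^+ 2)).
  rewrite dotBl dotZl -sqE nu1 mulr1.
  have -> : (dot y nu - 2 * v) ^+ 2 = (v + (v - dot y nu)) ^+ 2 by ring.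
  have Hd := lt_trans d10 H.
  have Hd1 : dl <= v + (v - dot y nu) by apply: le_trans dld1 _; apply: ler_wpDl => //; exact: ltW.
  by rewrite lerXn2r ?nnegrE ?(ltW dl0) // addr_ge0 // ltW.
have := dot_le (y - (2 * v) *: nu) nu; rewrite nu1 sqrtr1 mulr1 => H'.
rewrite -real_normK ?num_real // -[leRHS]sqr_sqrtr ?sq_ge0 //.
by rewrite lerXn2r ?nnegrE ?sqrtr_ge0.
Qed.

(* what [P v] contains besides an exact derivative in [v], by [seg_int_P] *)
Let Rm v (y : 'rV[R]_n) := let z := y - (2 * v) *: nu in
  E1 (v - dot y nu) * (lap chis y * g z +
    2 * \sum_j chid j y * (gd j z - 2 * (nu 0 j * gnu z))).

Lemma cont_g : continuous g. Proof. exact: jet2_potential.1. Qed.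
Lemma cont_gd j : continuous (gd j). Proof. by case: (jet2_potential.2 j). Qed.
Lemma cont_gnu : continuous gnu.
Proof.
rewrite (_ : gnu = fun y => \sum_j nu 0 j * gd j y); last by apply/funext => y; rewrite gnuE.
by apply: (@cont_sum _ _ _ (fun j y => nu 0 j * gd j y)) => j; apply: cont_mul; [exact: cont_cst|exact: cont_gd].
Qed.
Lemma cont_lap p (q q' : 'I_n -> 'rV[R]_n -> R) : jet2 p q q' -> continuous (lap q').
Proof.
by move=> [_ H]; apply: (@cont_sum _ _ _ (fun j y => q' j y)) => j; case: (H j).
Qed.

Lemma cont_shift : continuous (fun z : R * 'rV[R]_n => z.2 - (2 * z.1) *: nu).
Proof.
apply: contV_sub; first by move=> z; exact: cvg_snd.
apply: contV_scale; last exact: cst_continuous.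
by apply: cont_mul; [exact: cont_cst|move=> z; exact: cvg_fst].
Qed.

Lemma cont_height : continuous (fun z : R * 'rV[R]_n => z.1 - dot z.2 nu).
Proof.
apply: cont_sub; first by move=> z; exact: cvg_fst.
apply: (@cont_comp _ _ _ (fun z : R * 'rV[R]_n => z.2) (fun y => dot y nu)).
  by move=> z; exact: cvg_snd.
exact: cont_dot.
Qed.

Lemma cont_snd_comp (f : 'rV[R]_n -> R) : continuous f ->
  continuous (fun z : R * 'rV[R]_n => f z.2).
Proof.
by move=> cf; apply: (@cont_comp _ _ _ (fun z : R * 'rV[R]_n => z.2)) => // z; exact: cvg_snd.
Qed.

Lemma cont_shift_comp (f : 'rV[R]_n -> R) : continuous f ->
  continuous (fun z : R * 'rV[R]_n => f (z.2 - (2 * z.1) *: nu)).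
Proof. by move=> cf; exact: cont_comp cont_shift cf. Qed.

Lemma cont_height_comp (f : R -> R) : continuous f ->
  continuous (fun z : R * 'rV[R]_n => f (z.1 - dot z.2 nu)).
Proof. by move=> cf; exact: cont_comp cont_height cf. Qed.

Lemma cE1 : continuous E1. Proof. exact: isd_continuous dE1. Qed.
Lemma cE2 : continuous E2. Proof. exact: isd_continuous dE2. Qed.
Lemma cE0 : continuous E0. Proof. exact: isd_continuous dE0. Qed.
Lemma cont_chid j : continuous (chid j). Proof. by case: (jet2_cutoff.2 j). Qed.

Lemma cont_P : continuous (fun z : R * 'rV[R]_n => P z.1 z.2).
Proof.
rewrite /P /=; apply: cont_add; first apply: cont_add.
- apply: cont_mul; first exact: (cont_snd_comp (cont_lap jet2_cutoff)).
  by apply: cont_mul; [exact: cont_height_comp cE1|exact: cont_shift_comp cont_g].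
- apply: cont_mul; first exact: cont_cst.
  apply: (@cont_sum _ _ _ (fun j (z : R * 'rV[R]_n) => chid j z.2 * (- nu 0 j * E2 (z.1 - dot z.2 nu) * g (z.2 - (2 * z.1) *: nu) + E1 (z.1 - dot z.2 nu) * gd j (z.2 - (2 * z.1) *: nu)))) => j.
  apply: cont_mul; first exact: cont_snd_comp (@cont_chid j).
  apply: cont_add.
    apply: cont_mul; last exact: cont_shift_comp cont_g.
    by apply: cont_mul; [exact: cont_cst|exact: cont_height_comp cE2].
  by apply: cont_mul; [exact: cont_height_comp cE1|exact: cont_shift_comp (@cont_gd j)].
- apply: cont_mul; first exact: cont_snd_comp jet2_cutoff.1.
  apply: cont_add; first apply: cont_sub.
  + by apply: cont_mul; [exact: cont_height_comp cE3|exact: cont_shift_comp cont_g].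
  + apply: cont_mul; first exact: cont_cst.
    by apply: cont_mul; [exact: cont_height_comp cE2|exact: cont_shift_comp cont_gnu].
  + by apply: cont_mul; [exact: cont_height_comp cE1|exact: cont_shift_comp (cont_lap jet2_potential)].
Qed.

Lemma cont_Rm : continuous (fun z : R * 'rV[R]_n => Rm z.1 z.2).
Proof.
rewrite /Rm /=; apply: cont_mul; first exact: cont_height_comp cE1.
apply: cont_add.
  by apply: cont_mul; [exact: (cont_snd_comp (cont_lap jet2_cutoff))|exact: cont_shift_comp cont_g].
apply: cont_mul; first exact: cont_cst.
apply: (@cont_sum _ _ _ (fun j (z : R * 'rV[R]_n) => chid j z.2 * (gd j (z.2 - (2 * z.1) *: nu) - 2 * (nu 0 j * gnu (z.2 - (2 * z.1) *: nu))))) => j.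
apply: cont_mul; first exact: cont_snd_comp (@cont_chid j).
apply: cont_sub; first exact: cont_shift_comp (@cont_gd j).
apply: cont_mul; first exact: cont_cst.
by apply: cont_mul; [exact: cont_cst|exact: cont_shift_comp cont_gnu].
Qed.

Lemma isd_height (y : 'rV[R]_n) (v : R) : is_derive v 1 (fun v : R => v - dot y nu) 1.
Proof. by apply: isd_eq (isd_sub (isd_id _ _) (isd_cst _ _ _)) _; rewrite subr0. Qed.

Lemma isd_g_shift (y : 'rV[R]_n) (v : R) :
  is_derive v 1 (fun v : R => g (y - (2 * v) *: nu)) (- 2 * gnu (y - (2 * v) *: nu)).
Proof.
have -> : (fun v : R => g (y - (2 * v) *: nu)) =
   (fun v => (dot y l - 2 * dot nu l * v) * e (sq y - 4 * dot y nu * v + 4 * v ^+ 2)).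
  apply/funext => u; rewrite /g sq_shift dotBl dotZl; congr (_ * e _); ring.
have d1' : is_derive v 1 (fun v : R => dot y l - 2 * dot nu l * v) (- (2 * dot nu l)).
  apply: isd_eq (isd_sub (isd_cst _ _ _) (isd_mul (isd_cst _ _ _) (isd_id _ _))) _.
  by ring.
have d2' : is_derive v 1 (fun v : R => sq y - 4 * dot y nu * v + 4 * v ^+ 2) (- 4 * dot y nu + 8 * v).
  apply: isd_eq (isd_add (isd_sub (isd_cst _ _ _) (isd_mul (isd_cst _ _ _) (isd_id _ _))) (isd_mul (isd_cst _ _ _) (isd_exp 2 _))) _.
  by rewrite /= expr1; ring.
apply: isd_eq (isd_mul d1' (isd_comp d2' (de _))) _.
rewrite /gnu sq_shift !dotBl !dotZl -[dot nu nu]sqE nu1.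
have -> : sq y + 4 * (v * (v - dot y nu)) = sq y - 4 * dot y nu * v + 4 * v ^+ 2 by ring.
by ring.
Qed.

(** Where the cutoff is 1, [P v] is the [v]-derivative of
    E2(v - y.nu) g(y - 2 v nu): the pole moves along [nu] at speed 2, which is
    what the cross term of the Laplacian asks for, and [g] is harmonic where the
    step varies. So the integral over [v] is a value at v = 0, up to terms with
    derivatives of the cutoff. *)
Lemma seg_int_P V y : 0 <= V -> d2 <= V - dot y nu ->
  seg_int 0 V (P^~ y) =
  - (chi y * (E2 (- dot y nu) * g y)) +
  2 * ((\sum_j chid j y * nu 0 j) * (E1 (- dot y nu) * g y)) +
  seg_int 0 V (Rm^~ y).
Proof.
move=> V0 Vy.
have cP : continuous (P^~ y).
  by apply: (@continuous_slice2 _ _ _ (fun y v => P v y)); exact: (continuous_swap cont_P).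
have cR : continuous (Rm^~ y).
  by apply: (@continuous_slice2 _ _ _ (fun y v => Rm v y)); exact: (continuous_swap cont_Rm).
set sx := \sum_j chid j y * nu 0 j.
pose Q (v : R) := chi y * (E2 (v - dot y nu) * g (y - (2 * v) *: nu)) -
  2 * (sx * (E1 (v - dot y nu) * g (y - (2 * v) *: nu))).
pose Q1 (v : R) := let z := y - (2 * v) *: nu in
  chi y * (E3 (v - dot y nu) * g z - 2 * (E2 (v - dot y nu) * gnu z)) -
  2 * (sx * (E2 (v - dot y nu) * g z - 2 * (E1 (v - dot y nu) * gnu z))).
have dQ (v : R) : is_derive v 1 Q (Q1 v).
  have a2 := isd_comp (isd_height y v) (dE2 _).
  have a1 := isd_comp (isd_height y v) (dE1 _).
  have ag := isd_g_shift y v.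
  apply: isd_eq (isd_sub (isd_mul (isd_cst v 1 (chi y)) (isd_mul a2 ag))
    (isd_mul (isd_cst v 1 2) (isd_mul (isd_cst v 1 sx) (isd_mul a1 ag)))) _.
  by rewrite /Q1; ring.
apply/eqP; rewrite -subr_eq -seg_intB //; apply/eqP.
transitivity (Q V - Q 0).
  apply: seg_int_FTC => //; first exact: cont_sub.
    exact: isd_continuous dQ.
  move=> v /andP[v0 _]; apply: isd_eq (dQ v) _.
  rewrite /Q1 /P /Rm /=; set z := y - (2 * v) *: nu.
  have E1lap : E1 (v - dot y nu) * lap gs z = 0.
    have [H|H] := ltP d1 (v - dot y nu).
      by rewrite lap_potential0 ?mulr0 //; exact: (shift_far (ltW v0) H).1.
    by rewrite (E12out _).1 ?mul0r // negb_and -leNgt H.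
  rewrite E1lap addr0.
  have -> : \sum_j chid j y * (- nu 0 j * E2 (v - dot y nu) * g z + E1 (v - dot y nu) * gd j z) =
     - sx * (E2 (v - dot y nu) * g z) + E1 (v - dot y nu) * \sum_j chid j y * gd j z.
    transitivity (\sum_j (- (E2 (v - dot y nu) * g z) * (chid j y * nu 0 j) +
        E1 (v - dot y nu) * (chid j y * gd j z))).
      by apply: eq_bigr => j _; ring.
    by rewrite big_split /= -!mulr_sumr -/sx; ring.
  have -> : \sum_j chid j y * (gd j z - 2 * (nu 0 j * gnu z)) =
     \sum_j chid j y * gd j z - 2 * (sx * gnu z).
    transitivity (\sum_j (chid j y * gd j z + (- 2 * gnu z) * (chid j y * nu 0 j))).
      by apply: eq_bigr => j _; ring.
    by rewrite big_split /= -mulr_sumr -/sx; ring.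
  by ring.
have [E1V E2V] : E1 (V - dot y nu) = 0 /\ E2 (V - dot y nu) = 0.
  by apply: E12out; rewrite negb_and -!leNgt Vy orbT.
rewrite /Q E1V E2V mulr0 scale0r subr0 !sub0r; ring.
Qed.

(* for v >= V the translated step has left the support of the cutoff; [max v 0]
   keeps the integrand a test Laplacian for all real [v] *)
Let V := 2 * r + d2.
Let S (y : 'rV[R]_n) := seg_int 0 V (fun v => P (Num.max v 0) y).

Lemma V_ge0 : 0 <= V.
Proof. by rewrite addr_ge0 ?mulr_ge0 ?(ltW r0) // ltW // (lt_trans d10). Qed.

Lemma cont_maxP : continuous (fun z : R * 'rV[R]_n => P (Num.max z.1 0) z.2).
Proof.
have c1 : continuous (fun z : R * 'rV[R]_n => Num.max z.1 0).
  by apply: cont_max; [move=> z; exact: cvg_fst|exact: cont_cst].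
have c2 : continuous (fun z : R * 'rV[R]_n => z.2) by move=> z; exact: cvg_snd.
exact: (continuous_comp2 c1 c2 cont_P).
Qed.

Lemma cont_S : continuous S.
Proof.
apply: (@continuous_seg_int _ _ _ _ (fun (y : 'rV[R]_n) (v : R) => P (Num.max v 0) y)).
  exact: V_ge0.
have H := @continuous_swap R _ _ (fun (v : R) (y : 'rV[R]_n) => P (Num.max v 0) y) cont_maxP.
exact: H.
Qed.

Lemma max_ge0 (v : R) : 0 <= Num.max v 0. Proof. by rewrite le_max lexx orbT. Qed.

Lemma S_out y : ~ K y -> S y = 0.
Proof.
move=> nK; rewrite /S (@eq_seg_int _ _ _ _ (fun=> 0)) ?seg_int_cst ?mul0r ?V_ge0 // => v _.
exact: laplacian_of_test_out (test_P (max_ge0 v)) nK.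
Qed.

Lemma int_S : int_rV (fun y => h y * S y) = 0.
Proof.
pose F (v : R) (y : 'rV[R]_n) := h y * P (Num.max v 0) y.
have FK v y : ~ K y -> P (Num.max v 0) y = 0.
  by move=> nK; exact: laplacian_of_test_out (test_P (max_ge0 v)) nK.
have cF : continuous (fun z : R * 'rV[R]_n => F z.1 z.2).
  have c2 : continuous (fun z : R * 'rV[R]_n => z.2) by move=> z; exact: cvg_snd.
  have off (z : R * 'rV[R]_n) : ~ K z.2 -> P (Num.max z.1 0) z.2 = 0 by exact: FK.
  exact: (mul_zero_off_continuous closed_K K_sub hD.1.1 c2 cont_maxP off).
have := @int_rV_seg _ n (2 * r) 0 V F double_r_ge0 V_ge0 cF.
rewrite (@eq_seg_int _ _ _ _ (fun=> 0)); last first.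
  by move=> v _; exact: int_laplacian_of_test (test_P (max_ge0 v)).
rewrite seg_int_cst ?V_ge0 // mul0r => ->.
  congr int_rV; apply/funext => y; rewrite /S -seg_intZ //.
  by apply: (@continuous_slice2 _ _ _ (fun (y : 'rV[R]_n) (v : R) => P (Num.max v 0) y)); exact: (@continuous_swap R _ _ (fun (v : R) (y : 'rV[R]_n) => P (Num.max v 0) y) cont_maxP).
move=> v y My; rewrite /F FK ?mulr0 // => /K_bound; rewrite leNgt My //.
Qed.

Lemma SE y : S y = seg_int 0 V (P^~ y).
Proof. by apply: eq_seg_int => v /andP[v0 _]; rewrite max_l. Qed.

Let main y := 2 * (chi y * (E1 (- dot y nu) * gnu y)).
Let Err y := P0 y - S y - lap gs y - main y.

Lemma cutoff_out y : 4 * r ^+ 2 <= sq y -> [/\ chi y = 0, forall j, chid j y = 0 & lap chis y = 0].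
Proof.
move=> H; have rr : 0 < r ^+ 2 by rewrite exprn_gt0.
have H' : ~~ (1 < sq y / r ^+ 2 < 4) by rewrite negb_and -!leNgt orbC ler_pdivlMr // H.
have [x1 x2] := X12out H'; split; first exact: chi_out.
  by move=> j; rewrite /chid x1 oppr0 mul0r.
by rewrite /lap big1 // => j _; rewrite /chis x1 x2 oppr0 !mul0r subrr.
Qed.

Lemma cutoff_in y : sq y <= r ^+ 2 -> [/\ chi y = 1, forall j, chid j y = 0 & lap chis y = 0].
Proof.
move=> H; have rr : 0 < r ^+ 2 by rewrite exprn_gt0.
have H1 : sq y / r ^+ 2 <= 1 by rewrite ler_pdivrMr // mul1r.
have H' : ~~ (1 < sq y / r ^+ 2 < 4) by rewrite negb_and -!leNgt H1.
have [x1 x2] := X12out H'; split; first exact: X0lo.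
  by move=> j; rewrite /chid x1 oppr0 mul0r.
by rewrite /lap big1 // => j _; rewrite /chis x1 x2 oppr0 !mul0r subrr.
Qed.

Lemma height_le y : `|dot y nu| <= Num.sqrt (sq y).
Proof. by have := dot_le y nu; rewrite nu1 sqrtr1 mulr1. Qed.

Lemma V_height y : sq y <= 4 * r ^+ 2 -> d2 <= V - dot y nu.
Proof.
move=> H; have := le_trans (ler_norm _) (height_le y).
have : Num.sqrt (sq y) <= 2 * r.
  rewrite -[leRHS]ger0_norm ?mulr_ge0 ?(ltW r0) // -sqrtr_sqr ler_sqrt ?sqr_ge0 //.
  by rewrite exprMn; apply: le_trans H _; rewrite -natrX.
rewrite /V; lra.
Qed.

Lemma dl_le_r : dl ^+ 2 <= r ^+ 2.
Proof. by rewrite lerXn2r ?nnegrE ?(ltW dl0) ?(ltW r0) // (le_trans dld1). Qed.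

Lemma Err_far y : 4 * r ^+ 2 <= sq y -> Err y = 0.
Proof.
move=> H; have [c0 cd0 cl0] := cutoff_out H.
have P0y : P0 y = 0.
  by rewrite /P0 c0 cl0 big1 => [|j _]; rewrite ?cd0 !mul0r // mulr0 !addr0.
have Sy : S y = 0.
  rewrite /S (@eq_seg_int _ _ _ _ (fun=> 0)) ?seg_int_cst ?mul0r ?V_ge0 // => v _.
  by rewrite /P c0 cl0 big1 => [|j _]; rewrite ?cd0 !mul0r // mulr0 !addr0.
rewrite /Err P0y Sy /main c0 mul0r mulr0 !subr0 lap_potential0 ?subrr //.
apply: le_trans dl_le_r _; apply: le_trans H.
by rewrite ler_peMl ?sqr_ge0 // ler1n.
Qed.

Lemma Err_near y : sq y <= r ^+ 2 -> Err y = 0.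
Proof.
move=> H; have [c1 cd0 cl0] := cutoff_in H.
have H4 : sq y <= 4 * r ^+ 2 by apply: le_trans H _; rewrite ler_peMl ?sqr_ge0 // ler1n.
rewrite /Err SE seg_int_P ?V_ge0 ?V_height // /P0 /main c1 cl0.
rewrite (@eq_seg_int _ _ _ (Rm^~ y) (fun=> 0)); last first.
  by move=> v _; rewrite /Rm cl0 big1 => [|j _]; rewrite ?cd0 ?mul0r // mulr0 addr0 mulr0.
rewrite seg_int_cst ?V_ge0 // !big1 => [|j _|j _]; rewrite ?cd0 ?mul0r //.
have : A y * lap gs y = lap gs y.
  have [G|G] := leP (dl ^+ 2) (sq y); first by rewrite lap_potential0 // mulr0.
  rewrite /A E0lo ?mul1r //; apply: le_trans dld1.
  apply: le_trans (ler_norm _) _; rewrite normrN; apply: le_trans (height_le y) _.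
  by rewrite -[leRHS]ger0_norm ?(ltW dl0) // -sqrtr_sqr ler_sqrt ?sqr_ge0 // ltW.
move=> HA; transitivity (A y * lap gs y - lap gs y); last by rewrite HA subrr.
by ring.
Qed.

(* bounds for the exact dipole and its gradient outside the ball of radius [r] *)
Let Bg := (r ^+ m)^-1.
Let Bd := (1 + n%:R) * (r ^+ n)^-1.

Lemma far_bounds z : r ^+ 2 <= sq z ->
  [/\ `|g z| <= Bg, forall j, `|gd j z| <= Bd & `|gnu z| <= Bd].
Proof.
move=> H; have [ez e1z _] := eE (le_trans dl_le_r H).
pose s := Num.sqrt (sq z).
have rs : r <= s by rewrite -[leLHS]ger0_norm ?(ltW r0) // -sqrtr_sqr ler_sqrt ?sq_ge0.
have s0 : 0 < s by exact: lt_le_trans rs.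
have zl : `|dot z l| <= s by have := dot_le z l; rewrite l1 sqrtr1 mulr1.
have zn : `|dot z nu| <= s by exact: height_le.
have ln : `|dot nu l| <= 1 by have := dot_le nu l; rewrite l1 nu1 sqrtr1 mulr1.
have zj j : `|z 0 j| <= s by exact: coord_le_sqrt_sq.
have lj j : `|l 0 j| <= 1 by have := coord_le_sqrt_sq l j; rewrite l1 sqrtr1.
have inv k : (s ^+ k)^-1 <= (r ^+ k)^-1.
  by rewrite lef_pV2 ?posrE ?exprn_gt0 // lerXn2r ?nnegrE ?(ltW r0) ?(ltW s0).
have ie : `|e (sq z)| = (s ^+ n)^-1 by rewrite ez ger0_norm ?invr_ge0 ?exprn_ge0 ?sqrtr_ge0.
have ie1 : `|e1 (sq z)| = n%:R / 2 * (s ^+ (n + 2))^-1.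
  by rewrite e1z mulNr normrN ger0_norm // mulr_ge0 ?invr_ge0 ?exprn_ge0 ?sqrtr_ge0 ?divr_ge0.
have quad a b : `|a| <= s -> `|b| <= s -> `|2 * (a * b * e1 (sq z))| <= n%:R * (s ^+ n)^-1.
  move=> ha hb; rewrite !normrM ie1 ger0_norm //.
  apply: (@le_trans _ _ (2 * (s * s * (n%:R / 2 * (s ^+ (n + 2))^-1)))).
    rewrite ler_wpM2l // ler_wpM2r ?ler_pM //.
    by rewrite mulr_ge0 ?invr_ge0 ?exprn_ge0 ?divr_ge0 // ltW.
  rewrite exprD le_eqVlt; apply/orP; left; apply/eqP; field.
  by rewrite expf_neq0 ?gt_eqF.
have fin (a b : R) : `|a| <= 1 -> `|b| <= n%:R * (s ^+ n)^-1 -> `|a * e (sq z) + b| <= Bd.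
  move=> ha hb; apply: le_trans (ler_normD _ _) _.
  apply: (@le_trans _ _ ((1 + n%:R) * (s ^+ n)^-1)); last by rewrite ler_wpM2l // addr_ge0.
  by rewrite mulrDl mul1r lerD // normrM ie ler_piMl // invr_ge0 exprn_ge0 // ltW.
split.
- rewrite /g normrM ie; apply: (@le_trans _ _ (s * (s ^+ n)^-1)).
    by rewrite ler_wpM2r // invr_ge0 exprn_ge0 // ltW.
  apply: le_trans (inv m).
  by rewrite /n exprS invfM mulrA divff ?gt_eqF // mul1r.
- move=> j; rewrite /gd (_ : dot z l * _ = 2 * (dot z l * z 0 j * e1 (sq z))); last by ring.
  by apply: fin; [exact: lj|exact: quad].
- by apply: fin => //; exact: quad.
Qed.

Let BE := CX * (16 + 2 * n%:R) / r ^+ 2 * Bg + 2 * (n%:R * (4 * CX / r * (3 * Bd))).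

Lemma CX_ge0 : 0 <= CX. Proof. exact: le_trans (normr_ge0 _) (X1b 0). Qed.
Lemma Bd_ge0 : 0 <= Bd.
Proof. by rewrite mulr_ge0 ?addr_ge0 // invr_ge0 exprn_ge0 // ltW. Qed.
Lemma Bg_ge0 : 0 <= Bg. Proof. by rewrite invr_ge0 exprn_ge0 // ltW. Qed.

Lemma cutoff_bounds y : sq y <= 4 * r ^+ 2 ->
  `|lap chis y| <= CX * (16 + 2 * n%:R) / r ^+ 2 /\ forall j, `|chid j y| <= 4 * CX / r.
Proof.
move=> H; have rr : 0 < r ^+ 2 by rewrite exprn_gt0.
have r2 : r ^+ 2 != 0 by rewrite gt_eqF.
have s2 : Num.sqrt (sq y) <= 2 * r.
  rewrite -[leRHS]ger0_norm ?mulr_ge0 ?(ltW r0) // -sqrtr_sqr ler_sqrt ?sqr_ge0 //.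
  by rewrite exprMn; apply: le_trans H _; rewrite -natrX.
split; last first.
  move=> j; rewrite /chid normrM normrN.
  have -> : 4 * CX / r = CX * (4 / r) by ring.
  apply: ler_pM => //; rewrite !normrM normfV [`|2|]ger0_norm // [`|r ^+ 2|]ger0_norm ?sqr_ge0 //.
  rewrite ler_pdivrMr // (_ : 4 / r * r ^+ 2 = 2 * (2 * r)); last by field; rewrite gt_eqF.
  by rewrite ler_wpM2l //; apply: le_trans s2; exact: coord_le_sqrt_sq.
rewrite /lap /chis sumrB -mulr_sumr.
have -> : \sum_j (2 * y 0 j / r ^+ 2) ^+ 2 = 4 * sq y / r ^+ 4.
  rewrite /sq mulr_sumr mulr_suml; apply: eq_bigr => j _.
  by field; rewrite gt_eqF.
rewrite sumr_const card_ord -[_ *+ n]mulr_natr.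
apply: le_trans (ler_normB _ _) _.
have -> : CX * (16 + 2 * n%:R) / r ^+ 2 = CX * (16 / r ^+ 2) + CX * (2 / r ^+ 2) * n%:R by ring.
apply: lerD.
  rewrite normrM normrN; apply: ler_pM => //.
  rewrite ger0_norm; last by rewrite divr_ge0 ?mulr_ge0 ?sq_ge0 ?exprn_ge0 ?(ltW r0).
  rewrite ler_pdivrMr ?exprn_gt0 //.
  rewrite (_ : 16 / r ^+ 2 * r ^+ 4 = 4 * (4 * r ^+ 2)); last by field; rewrite gt_eqF.
  by rewrite ler_wpM2l.
rewrite normrM [X in _ * X]ger0_norm // ler_wpM2r // normrM ler_pM //.
by rewrite ger0_norm // divr_ge0 // ltW.
Qed.

Lemma bound_terms y z : sq y <= 4 * r ^+ 2 -> r ^+ 2 <= sq z ->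
  `|lap chis y * g z| <= CX * (16 + 2 * n%:R) / r ^+ 2 * Bg /\
  forall G : 'I_n -> R, (forall j, `|G j| <= 3 * Bd) ->
    `|2 * \sum_j chid j y * G j| <= 2 * (n%:R * (4 * CX / r * (3 * Bd))).
Proof.
move=> H Hz; have [hl hd] := cutoff_bounds H; have [hg _ _] := far_bounds Hz.
split; first by rewrite normrM ler_pM.
move=> G hG; rewrite normrM ger0_norm // ler_wpM2l //.
apply: le_trans (ler_norm_sum _ _ _) _.
have -> : n%:R * (4 * CX / r * (3 * Bd)) = \sum_(j < n) (4 * CX / r * (3 * Bd)).
  by rewrite sumr_const card_ord mulr_natl.
by apply: ler_sum => j _; rewrite normrM ler_pM.
Qed.

(** Only r^2 <= |y|^2 <= 4 r^2 contributes. There the cutoff has derivatives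
    O(1/r) and O(1/r^2), and [g] and its gradient are O(r^(1-n)) and O(r^-n), so
    the error is O(r^(-n-1)); the weights E1(v - y.nu) integrate to at most 1 in
    [v]. *)
Lemma Err_bound y : `|Err y| <= 2 * BE.
Proof.
have BE0 : 0 <= BE.
  by rewrite addr_ge0 ?mulr_ge0 ?divr_ge0 ?CX_ge0 ?Bg_ge0 ?Bd_ge0 ?addr_ge0 ?invr_ge0 ?exprn_ge0 ?(ltW r0).
have [H4|H4] := leP (4 * r ^+ 2) (sq y); first by rewrite Err_far // normr0 mulr_ge0.
have [H1|H1] := leP (sq y) (r ^+ 2); first by rewrite Err_near // normr0 mulr_ge0.
have y4 := ltW H4; have y1 := ltW H1.
have E : Err y = A y * (lap chis y * g y + 2 * \sum_j chid j y * gd j y) - seg_int 0 V (Rm^~ y).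
  rewrite /Err SE seg_int_P ?V_ge0 ?V_height // /P0 /main lap_potential0; last exact: le_trans dl_le_r y1.
  have -> : \sum_j chid j y * (nu 0 j * E1 (- dot y nu) * g y + A y * gd j y) =
     (\sum_j chid j y * nu 0 j) * (E1 (- dot y nu) * g y) + A y * \sum_j chid j y * gd j y.
    transitivity (\sum_j ((E1 (- dot y nu) * g y) * (chid j y * nu 0 j) +
        A y * (chid j y * gd j y))).
      by apply: eq_bigr => j _; ring.
    by rewrite big_split /= -!mulr_sumr; ring.
  by ring.
have /andP[A0 A1] : 0 <= A y <= 1 by exact: E001.
have bd3 : Bd <= 3 * Bd by rewrite ler_peMl ?Bd_ge0 // ler1n.
rewrite E (_ : 2 * BE = BE + BE); last by ring.
apply: le_trans (ler_normB _ _) _; apply: lerD.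
  rewrite normrM ger0_norm //; apply: le_trans (ler_piMl (normr_ge0 _) A1) _.
  have [b1 b2] := bound_terms y4 y1; apply: le_trans (ler_normD _ _) _.
  apply: lerD => //; apply: b2 => j.
  by apply: le_trans bd3; have [_ -> _] := far_bounds y1.
have cR : continuous (Rm^~ y).
  by apply: (@continuous_slice2 _ _ _ (fun y v => Rm v y)); exact: (continuous_swap cont_Rm).
have ch : continuous (fun v => E1 (v - dot y nu)).
  by apply: (@cont_comp _ _ _ (fun v => v - dot y nu)); [exact: isd_continuous (isd_height y)|exact: cE1].
have RB v : 0 <= v -> `|Rm v y| <= BE * E1 (v - dot y nu).
  move=> v0; rewrite /Rm mulrC normrM [X in _ * X]ger0_norm ?E1ge0 //.
  have [H|H] := ltP d1 (v - dot y nu); last first.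
    by rewrite (E12out _).1 ?mulr0 // negb_and -leNgt H.
  rewrite ler_wpM2r ?E1ge0 //; set z := y - (2 * v) *: nu.
  have Hz : r ^+ 2 <= sq z by apply: le_trans y1 _; exact: (shift_far v0 H).2.
  have [b1 b2] := bound_terms y4 Hz; apply: le_trans (ler_normD _ _) _.
  apply: lerD => //; apply: b2 => j.
  have [_ bgd bgn] := far_bounds Hz.
  have nj : `|nu 0 j| <= 1 by have := coord_le_sqrt_sq nu j; rewrite nu1 sqrtr1.
  apply: le_trans (ler_normB _ _) _.
  have -> : 3 * Bd = Bd + 2 * (1 * Bd) by ring.
  by apply: lerD => //; rewrite !normrM ger0_norm // ler_wpM2l // ler_pM.
have VB : seg_int 0 V (fun v => E1 (v - dot y nu)) <= 1.
  have -> : seg_int 0 V (fun v => E1 (v - dot y nu)) =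
      - E0 (V - dot y nu) - - E0 (0 - dot y nu).
    apply: (@seg_int_FTC _ 0 V _ (fun v => - E0 (v - dot y nu))); [exact: V_ge0|exact: ch| |].
      apply: (@cont_comp _ _ _ (fun v => v - dot y nu) (fun t => - E0 t)).
        exact: isd_continuous (isd_height y).
      by move=> t; apply: cvgN; exact: cE0.
    move=> v _; apply: isd_eq (is_deriveN (isd_comp (isd_height y v) (dE0 _))) _.
    by rewrite mulr1 opprK.
  have /andP[_ a1] := E001 (0 - dot y nu); have /andP[b0 _] := E001 (V - dot y nu).
  lra.
have cBE : continuous (fun v => BE * E1 (v - dot y nu)) by apply: cont_mul => //; exact: cont_cst.
rewrite -[leRHS]mulr1; apply: le_trans (ler_wpM2l BE0 VB); rewrite -seg_intZ //.
rewrite ler_norml; apply/andP; split.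
  rewrite -mulN1r -seg_intZ //; apply: le_seg_int => //.
    by apply: cont_mul => //; exact: cont_cst.
  by move=> v /andP[/RB + _]; rewrite ler_norml mulN1r => /andP[].
by apply: le_seg_int => // v /andP[/RB + _]; rewrite ler_norml => /andP[].
Qed.

Lemma zero_in_D : D 0.
Proof. by rewrite /D /= dot0l oppr_lt0 (lt_trans d10) // (lt_trans d12). Qed.

Lemma U_ge0 : 0 <= U.
Proof. exact: le_trans (normr_ge0 _) (hU zero_in_D). Qed.

Lemma csupp_h p : continuous p -> (forall y, ~ K y -> p y = 0) ->
  csupp (2 * r) (fun y => h y * p y).
Proof.
move=> cp p0; split; last first.
  by move=> y My; rewrite p0 ?mulr0 // => /K_bound; rewrite leNgt My.
by apply: (mul_zero_off_continuous closed_K K_sub hD.1.1 _ cp p0); exact: cont_id.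
Qed.

Lemma cont_test p : laplacian_of_test p -> continuous p.
Proof.
move=> [f [g' [s' [jt _ pE]]]]; have -> : p = lap s' by apply/funext.
exact: cont_lap jt.
Qed.

Lemma lap_gs_out y : ~ K y -> lap gs y = 0.
Proof.
move=> nK; have [H|H] := leP (dl ^+ 2) (sq y); first exact: lap_potential0.
exfalso; apply: nK; split.
  apply: le_trans (ltW H) _; apply: le_trans dl_le_r _.
  by rewrite ler_peMl ?sqr_ge0 // ler1n.
have := height_le y; rewrite ler_norml => /andP[H1 _]; apply: le_trans H1.
rewrite lerN2; apply: le_trans (ltW d12); apply: le_trans dld1.
by rewrite -[leRHS]ger0_norm ?(ltW dl0) // -sqrtr_sqr ler_sqrt ?sqr_ge0 // ltW.
Qed.

Lemma cont_minus_height : continuous (fun y : 'rV[R]_n => - dot y nu).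
Proof.
apply: (@cont_comp _ _ _ (fun y : 'rV[R]_n => dot y nu) (fun t : R => - t)).
  exact: cont_dot.
by move=> t; apply: cvgN; exact: cvg_id.
Qed.

Lemma cont_main : continuous main.
Proof.
apply: cont_mul; first exact: cont_cst.
apply: cont_mul; first exact: jet2_cutoff.1.
by apply: cont_mul; [exact: cont_comp cont_minus_height cE1|exact: cont_gnu].
Qed.

Lemma main_out y : ~ K y -> main y = 0.
Proof.
move=> /notK [H|H]; rewrite /main; first by rewrite chi_out // mul0r mulr0.
by rewrite (E12out _).1 ?mul0r ?mulr0 // negb_and -!leNgt H orbT.
Qed.

Lemma Err_out y : ~ K y -> Err y = 0.
Proof.
move=> nK; rewrite /Err S_out // main_out // lap_gs_out //.
by rewrite (laplacian_of_test_out test_P0 nK) !subr0.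
Qed.

(** Green's formula for all the test functions at once: up to [Err], the
    combination P0 - S is lap gs + main. *)
Lemma int_identity :
  `|int_rV (fun y => h y * lap gs y) + int_rV (fun y => h y * main y)| <=
  U * (2 * BE) * (2 * (2 * r)) ^+ n.
Proof.
have cP0 := csupp_h (cont_test test_P0) (fun y => @laplacian_of_test_out _ y test_P0).
have cS' := csupp_h cont_S S_out.
have cG := csupp_h (cont_lap jet2_potential) lap_gs_out.
have cM := csupp_h cont_main main_out.
have cE : continuous Err.
  apply: cont_sub cont_main; apply: cont_sub (cont_lap jet2_potential).
  exact: cont_sub (cont_test test_P0) cont_S.
have cErr := csupp_h cE Err_out.
have -> : int_rV (fun y => h y * lap gs y) + int_rV (fun y => h y * main y) =
   - int_rV (fun y => h y * Err y).
  have -> : (fun y => h y * Err y) = (fun y => h y * P0 y - h y * S y - h y * lap gs y - h y * main y).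
    by apply/funext => y; rewrite /Err; ring.
  rewrite (int_rVB double_r_ge0 (csuppB (csuppB cP0 cS') cG) cM).
  rewrite (int_rVB double_r_ge0 (csuppB cP0 cS') cG) (int_rVB double_r_ge0 cP0 cS').
  by rewrite int_S (int_laplacian_of_test test_P0); ring.
rewrite normrN; apply: int_rV_bound double_r_ge0 cErr _ => y.
have [Ky|nK] := pselect (K y); last first.
  by rewrite Err_out // mulr0 normr0 mulr_ge0 ?U_ge0 // (le_trans _ (Err_bound 0)).
by rewrite normrM ler_pM // ?Err_bound //; exact: hU (K_sub Ky).
Qed.

(** The product (y.nu)(y.l) is a quarter of the difference of the squares of
    y.(nu + l) and y.(nu - l), which splits a mixed second derivative of the
    fundamental solution into two pure ones. *)
Lemma gnu_split y : d1 <= Num.sqrt (sq y) ->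
  `|2 * gnu y| <= 2^-1 * (dir_kernel (nu + l) d1 y + dir_kernel (nu - l) d1 y).
Proof.
move=> H; set s := Num.sqrt (sq y).
have s0 : 0 < s by exact: lt_le_trans d10 H.
have Hs : dl ^+ 2 <= sq y.
  rewrite -[leRHS]sqr_sqrtr ?sq_ge0 // lerXn2r ?nnegrE ?(ltW dl0) ?sqrtr_ge0 //.
  exact: le_trans dld1 H.
have [ey e1y _] := eE Hs.
have sE : sq y = s ^+ 2 by rewrite sqr_sqrtr ?sq_ge0.
rewrite /dir_kernel max_l // -/s.
have sn0 : 0 < s ^+ (n + 2) by rewrite exprn_gt0.
set a := sq (nu + l) * _ - _; set b := sq (nu - l) * _ - _.
have -> : 2 * gnu y = 2^-1 * (a / s ^+ (n + 2) - b / s ^+ (n + 2)).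
  rewrite /gnu ey e1y -/s.
  have -> : (s ^+ n)^-1 = sq y / s ^+ (n + 2).
    by rewrite sE exprD; field; rewrite expf_neq0 ?gt_eqF.
  rewrite /a /b !sqE !dotBl !dotDl !dotBr !dotDr (dotC l nu).
  by field; rewrite expf_neq0 // gt_eqF.
rewrite normrM ger0_norm // ler_wpM2l //.
apply: le_trans (ler_normB _ _) _.
by rewrite !normrM !normfV (ger0_norm (ltW sn0)).
Qed.

(* the kernels are even, so [psi0] may be replaced by half of its
   symmetrisation [psi] *)
Let psi0 (y : 'rV[R]_n) := chi y * E1 (- dot y nu).
Let psi (y : 'rV[R]_n) := chi y * (E1 (- dot y nu) + E1 (dot y nu)).

Lemma psi0_ge0 y : 0 <= psi0 y.
Proof. by rewrite mulr_ge0 //; case/andP: (X001 (sq y / r ^+ 2)). Qed.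

Lemma chi_csupp f : continuous f -> csupp (2 * r) (fun y => chi y * f y).
Proof.
move=> cf; split; first by apply: cont_mul => //; exact: jet2_cutoff.1.
move=> y My; rewrite chi_out ?mul0r //.
have := lt_le_trans My (norm_le_sqrt_sq y) => H.
rewrite -[leRHS]sqr_sqrtr ?sq_ge0 // -[4](_ : 2 ^+ 2 = 4); last by rewrite -natrX.
by rewrite -exprMn lerXn2r ?nnegrE ?sqrtr_ge0 ?double_r_ge0 // ltW.
Qed.

Lemma E1_le (t : R) : d1 * E1 t <= t * E1 t.
Proof.
have [H|H] := leP d1 t; first by rewrite ler_wpM2r.
by rewrite (E12out _).1 ?mulr0 // negb_and -leNgt (ltW H).
Qed.

(** As d1 E1(t) <= t E1(t), the integral is at most 1 / d1 times that of
    (s/t) E1(s/t) dt / t, s = |y.nu|, which is a drop of [E0] and so at most 1;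
    of the two terms of [psi] only one is active on a given ray. *)
Lemma psi_dilation a b y : 0 < a -> a <= b ->
  seg_int a b (fun t => psi (t^-1 *: y) / t) <= d1^-1.
Proof.
move=> a0 ab; set s := dot y nu.
pose ml (t : R) := Num.max t a.
have ml0 t : 0 < ml t by rewrite lt_max a0 orbT.
have cml : continuous ml by apply: cont_max; [exact: cont_id|exact: cont_cst].
have cmi : continuous (fun t => (ml t)^-1) by apply: cont_inv => // t; rewrite gt_eqF.
have cE (c : R) : continuous (fun t => E1 (c / ml t)).
  by apply: (@cont_comp _ _ _ (fun t => c / ml t)); [apply: cont_mul => //; exact: cont_cst|exact: cE1].
have cpsi : continuous psi.
  apply: cont_mul; first exact: jet2_cutoff.1.
  apply: cont_add; first exact: cont_comp cont_minus_height cE1.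
  by apply: (cont_comp _ cE1); exact: cont_dot.
pose G (c t : R) := E1 (c / ml t) * (c / ml t) / ml t.
have cG c : continuous (G c).
  by apply: cont_mul => //; apply: cont_mul => //; apply: cont_mul => //; exact: cont_cst.
have IG c : seg_int a b (G c) = E0 (c / b) - E0 (c / a).
  have -> : E0 (c / b) - E0 (c / a) = E0 (c / ml b) - E0 (c / ml a).
    by rewrite /ml max_l // max_l.
  pose Q (t : R) := E0 (c / ml t).
  rewrite -/(Q b) -/(Q a); apply: (@seg_int_FTC _ a b (G c) Q) => //.
    apply: (@cont_comp _ _ _ (fun t => c / ml t)); last exact: cE0.
    by apply: cont_mul => //; exact: cont_cst.
  move=> t /andP[ta _]; have t0 : 0 < t by exact: lt_trans ta.
  have d1' : is_derive t 1 (fun t : R => c / t) (c * (- 1 / t ^+ 2)).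
    apply: isd_eq (isd_mul (isd_cst t 1 c) (isd_inv (isd_id t 1) (lt0r_neq0 t0))) _.
    by rewrite mul0r add0r.
  have dQ := isd_comp d1' (dE0 _).
  have nQ : \forall z \near t, E0 (c / z) = Q z.
    have : \forall z \near t, a < z by exact: lt_nbhsr.
    by apply: filterS => z az; rewrite /Q /ml max_l // ltW.
  apply: isd_eq (isd_near nQ dQ) _; rewrite /G /ml max_l ?(ltW ta) //.
  by field; rewrite gt_eqF.
apply: (@le_trans _ _ (d1^-1 * (seg_int a b (G (- s)) + seg_int a b (G s)))).
  rewrite -seg_intD // -seg_intZ; last exact: cont_add.
  rewrite (@eq_seg_int _ a b (fun t => psi (t^-1 *: y) / t) (fun t => psi ((ml t)^-1 *: y) / ml t)); last first.
    by move=> t /andP[ta _]; rewrite /ml max_l.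
  apply: le_seg_int.
  - apply: cont_mul => //; apply: (cont_comp _ cpsi).
    by apply: contV_scale => //; exact: cst_continuous.
  - by apply: cont_mul; [exact: cont_cst|exact: cont_add].
  - move=> t _; rewrite /psi dotZl -/s.
    set u := chi _; have /andP[u0 u1] : 0 <= u <= 1 by exact: X001.
    have -> : - ((ml t)^-1 * s) = - s / ml t by rewrite mulrC mulNr.
    rewrite [(ml t)^-1 * s]mulrC /G -mulrDl mulrA ler_wpM2r ?invr_ge0 ?(ltW (ml0 t)) //.
    rewrite -(ler_pM2l d10) [leRHS]mulVKf ?gt_eqF //.
    have h1 := E1_le (- s / ml t); have h2 := E1_le (s / ml t).
    have e1' := E1ge0 (- s / ml t); have e2' := E1ge0 (s / ml t).
    apply: (@le_trans _ _ (d1 * (E1 (- s / ml t) + E1 (s / ml t)))).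
      by rewrite ler_pM2l // ler_piMl // addr_ge0.
    by rewrite mulrDr; apply: lerD; rewrite [leRHS]mulrC.
rewrite -[leRHS]mulr1 ler_wpM2l ?invr_ge0 ?(ltW d10) // !IG.
have b0 : 0 < b by exact: lt_le_trans ab.
have lo c x : c <= 0 -> 0 < x -> E0 (c / x) = 1.
  move=> c0 x0; apply: E0lo; apply: le_trans (ltW d10).
  by rewrite pmulr_lle0 ?invr_gt0.
have [s0|s0] := leP s 0.
  rewrite (lo s b) // (lo s a) // subrr addr0.
  have /andP[_ x1] := E001 (- s / b); have /andP[x0 _] := E001 (- s / a); lra.
rewrite (lo (- s) b) ?oppr_le0 ?(ltW s0) // (lo (- s) a) ?oppr_le0 ?(ltW s0) // subrr add0r.
have /andP[_ x1] := E001 (s / b); have /andP[x0 _] := E001 (s / a); lra.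
Qed.

Lemma int_psi0_kernel w :
  int_rV (fun y => psi0 y * dir_kernel w d1 y) <=
  2^-1 * (sq w * (d1^-1 * kappa R m * omega R m)).
Proof.
have cK := @cont_dir_kernel R n w d1 d10.
have cpsi : csupp (2 * r) psi.
  apply: chi_csupp; apply: cont_add; first exact: cont_comp cont_minus_height cE1.
  by apply: (cont_comp _ cE1); exact: cont_dot.
have cpsi0 : csupp (2 * r) psi0 by apply: chi_csupp; exact: cont_comp cont_minus_height cE1.
have c0K := csuppMr cpsi0 cK.
have sqN (y : 'rV[R]_n) : sq (- y) = sq y by rewrite -scaleN1r sqZ sqrrN expr1n mul1r.
have cN : csupp (2 * r) (fun y => psi0 (- y) * dir_kernel w d1 (- y)).
  case: c0K => cc cz; split; last by move=> y My; apply: cz; rewrite normrN.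
  apply: (@cont_comp _ _ _ (fun y : 'rV[R]_n => - y) (fun y => psi0 y * dir_kernel w d1 y)) => //.
  exact: opp_continuous.
have -> : int_rV (fun y => psi0 y * dir_kernel w d1 y) =
   2^-1 * int_rV (fun y => psi y * dir_kernel w d1 y).
  have -> : (fun y => psi y * dir_kernel w d1 y) =
    (fun y => psi0 y * dir_kernel w d1 y + psi0 (- y) * dir_kernel w d1 (- y)).
    apply/funext => y; rewrite /psi /psi0 /chi /dir_kernel sqN !dotNl opprK sqrrN.
    by ring.
  rewrite (int_rVD double_r_ge0 c0K cN) (int_rV_opp double_r_ge0 c0K); by field.
rewrite ler_wpM2l //; apply: (@int_dir_kernel _ m (2 * r)) => //.
- exact: double_r_ge0.
- move=> y; rewrite mulr_ge0 ?addr_ge0 //; by case/andP: (X001 (sq y / r ^+ 2)).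
- move=> y H; have hs : forall t, `|t| <= Num.sqrt (sq y) -> E1 t = 0.
    move=> t ht; apply: (E12out _).1; rewrite negb_and -!leNgt; apply/orP; left.
    by apply: le_trans (ler_norm _) _; apply: le_trans ht (ltW H).
  by rewrite /psi !hs ?normrN ?height_le // addr0 mulr0.
- by move=> a b y; exact: psi_dilation.
Qed.

(** |nu + l|^2 + |nu - l|^2 = 4 whatever the angle between [nu] and [l], so the
    bound is the same for all directions [l]. *)
Lemma int_main_bound :
  `|int_rV (fun y => h y * main y)| <= U * (d1^-1 * kappa R m * omega R m).
Proof.
have cM := csupp_h cont_main main_out.
have cpsi0 : csupp (2 * r) psi0 by apply: chi_csupp; exact: cont_comp cont_minus_height cE1.
pose Kp := dir_kernel (nu + l) d1; pose Km := dir_kernel (nu - l) d1.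
have cp := csuppMr cpsi0 (@cont_dir_kernel R n (nu + l) d1 d10).
have cm := csuppMr cpsi0 (@cont_dir_kernel R n (nu - l) d1 d10).
pose B y := U / 2 * (psi0 y * Kp y + psi0 y * Km y).
have cB : csupp (2 * r) B by apply: csuppZ; exact: csuppD.
have hB y : `|h y * main y| <= B y.
  have U0 := U_ge0.
  have B0 : 0 <= B y.
    rewrite mulr_ge0 ?divr_ge0 // addr_ge0 // mulr_ge0 ?psi0_ge0 //.
      by rewrite divr_ge0 // exprn_ge0 // le_max sqrtr_ge0.
    by rewrite divr_ge0 // exprn_ge0 // le_max sqrtr_ge0.
  have [Ky|nK] := pselect (K y); last by rewrite main_out // mulr0 normr0.
  have mE : main y = psi0 y * (2 * gnu y) by rewrite /main /psi0; ring.
  have [H|H] := leP d1 (- dot y nu); last first.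
    have z : psi0 y = 0 by rewrite /psi0 (E12out _).1 ?mulr0 // negb_and -leNgt (ltW H).
    by rewrite mE z mul0r mulr0 normr0.
  have Hs : d1 <= Num.sqrt (sq y).
    by apply: le_trans H _; apply: le_trans (ler_norm _) _; rewrite normrN; exact: height_le.
  rewrite mE normrM normrM (ger0_norm (psi0_ge0 y)).
  have -> : B y = U * (psi0 y * (2^-1 * (Kp y + Km y))) by rewrite /B; field.
  apply: ler_pM => //; first by rewrite mulr_ge0 ?psi0_ge0.
    exact: hU (K_sub Ky).
  by rewrite ler_wpM2l ?psi0_ge0 //; exact: gnu_split.
have IB : int_rV B <= U * (d1^-1 * kappa R m * omega R m).
  rewrite /B (int_rVZ _ double_r_ge0 (csuppD cp cm)) (int_rVD double_r_ge0 cp cm).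
  have hp := int_psi0_kernel (nu + l); have hm := int_psi0_kernel (nu - l).
  have sqpm : sq (nu + l) + sq (nu - l) = 4.
    have := nu1; have := l1; rewrite !sqE !dotBl !dotDl !dotBr !dotDr (dotC l nu) => -> ->; ring.
  set k := d1^-1 * _ * _ in hp hm *.
  have -> : U * k = U / 2 * (2^-1 * (sq (nu + l) * k) + 2^-1 * (sq (nu - l) * k)).
    transitivity (U / 4 * ((sq (nu + l) + sq (nu - l)) * k)); first by rewrite sqpm; field.
    by field.
  by rewrite ler_wpM2l ?divr_ge0 ?U_ge0 // lerD.
apply: le_trans IB; rewrite ler_norml; apply/andP; split.
  rewrite -mulN1r -(int_rVZ _ double_r_ge0 cB).
  apply: (@le_int_rV R n (2 * r) (fun y => -1 * B y) (fun y => h y * main y)) => //.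
  - exact: double_r_ge0.
  - exact: csuppZ.
  - by move=> y; have := hB y; rewrite ler_norml mulN1r => /andP[].
apply: (@le_int_rV R n (2 * r) (fun y => h y * main y) B) => //; first exact: double_r_ge0.
by move=> y; have := hB y; rewrite ler_norml => /andP[].
Qed.

(** The Laplacian of [g] is the derivative along [l] of a bump; that derivative
    is moved to [h]. *)
Lemma int_pole : csupp (2 * r) (fun y => dir_deriv l h y * (C * bump 4 (dl ^+ 2) y)) /\
  int_rV (fun y => h y * lap gs y) =
  - int_rV (fun y => dir_deriv l h y * (C * bump 4 (dl ^+ 2) y)).
Proof.
pose W (y : 'rV[R]_n) := n%:R * e (sq y) + 2 * sq y * e1 (sq y).
have WE : (fun y : 'rV[R]_n => dir_deriv l h y * (C * bump 4 (dl ^+ 2) y)) =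
    (fun y => dir_deriv l h y * W y) by apply/funext => y; rewrite /W eW.
pose Wd (j : 'I_n) (y : 'rV[R]_n) := 2 * y 0 j * ((n%:R + 2) * e1 (sq y) + 2 * sq y * e2 (sq y)).
have csq : forall j y, is_derive y (delta_mx 0 j) (@sq R n) (2 * y 0 j).
  by move=> j; have [_ _ H _] := jet2_sq0.2 j.
have ce : continuous e by exact: isd_continuous de.
have ce1 : continuous e1 by exact: isd_continuous de1.
have cq (f : R -> R) : continuous f -> continuous (fun y : 'rV[R]_n => f (sq y)).
  by move=> cf; exact: cont_comp (@cont_sq R n) cf.
have cW : continuous W.
  apply: cont_add; apply: cont_mul; try exact: cont_cst; try exact: cq.
  by apply: cont_mul; [exact: cont_cst|exact: cont_sq].
have cWd j : continuous (Wd j).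
  apply: cont_mul; first by apply: cont_mul; [exact: cont_cst|exact: cont_coord].
  apply: cont_add; apply: cont_mul; try exact: cont_cst; try exact: cq.
  by apply: cont_mul; [exact: cont_cst|exact: cont_sq].
have dW j y : is_derive y (delta_mx 0 j) W (Wd j y).
  have a1 := isd_comp (csq j y) (de _); have a2 := isd_comp (csq j y) (de1 _).
  apply: isd_eq (isd_add (isd_mul (isd_cst y _ n%:R) a1)
    (isd_mul (isd_mul (isd_cst y _ 2) (csq j y)) a2)) _.
  by rewrite /Wd; ring.
have W0 y : ~ K y -> W y = 0.
  move=> nK; have [H|H] := leP (dl ^+ 2) (sq y); last first.
    exfalso; apply: nK; split.
      apply: le_trans (ltW H) _; apply: le_trans dl_le_r _.
      by rewrite ler_peMl ?sqr_ge0 // ler1n.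
    have := height_le y; rewrite ler_norml => /andP[H1 _]; apply: le_trans H1.
    rewrite lerN2; apply: le_trans (ltW d12); apply: le_trans dld1.
    by rewrite -[leRHS]ger0_norm ?(ltW dl0) // -sqrtr_sqr ler_sqrt ?sqr_ge0 // ltW.
  by rewrite /W eW ler0_sqrtr ?subr_le0 // expr0n mulr0.
have c1 : class_C 1 D h.
  have [[ch dh] _] := hD; split=> // j; have [dhj [c1j _]] := dh j.
  by split.
have [_ [H2 H3]] := int_by_parts l double_r_ge0 c1 closed_K K_sub K_bound cW cWd dW W0.
rewrite WE; split => //; rewrite -H3; congr int_rV; apply/funext => y; congr (_ * _).
rewrite lap_potential /Wd /dot !mulr_sumr !mulr_suml; apply: eq_bigr => j _; ring.
Qed.

Lemma int_pole_bound :
  `|int_rV (fun y => dir_deriv l h y * (C * bump 4 (dl ^+ 2) y))| <=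
  U * (d1^-1 * kappa R m * omega R m) + U * (2 * BE) * (2 * (2 * r)) ^+ n.
Proof.
have [_ H] := int_pole; have H1 := int_identity; have H2 := int_main_bound.
rewrite -normrN -H; rewrite -[X in `|X|](addrK (int_rV (fun y => h y * main y))).
by apply: le_trans (ler_normB _ _) _; rewrite addrC lerD.
Qed.

End Representation.

(** * The gradient estimate in a half-space *)

Section HalfSpace.
Variable R : realType.

Lemma bounded_of_compact_support (a b : R) (f : R -> R) : a < b -> continuous f ->
  (forall t, ~~ (a < t < b) -> f t = 0) -> exists K, forall t, `|f t| <= K.
Proof.
move=> ab cf f0; have [|c _ hc] := @EVT_max _ (fun t => `|f t|) _ _ (ltW ab).
  by apply: continuous_subspaceT; exact: cont_abs.
exists `|f c| => t; have [/andP[at_ tb]|nt] := boolP (a < t < b).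
  by apply: hc; rewrite in_itv /= !ltW.
by rewrite f0 // normr0.
Qed.

Lemma continuous_at_sum (T : topologicalType) (n : nat) (F : 'I_n -> T -> R) x :
  (forall j, {for x, continuous (F j)}) -> {for x, continuous (fun y => \sum_j F j y)}.
Proof.
move=> cF; suff H (s : seq 'I_n) :
  {for x, continuous (fun y => \sum_(j <- s) F j y)} by exact: H.
elim: s => [|j s IH].
  have -> : (fun y => \sum_(j <- [::]) F j y) = cst 0 by apply/funext => y; rewrite big_nil.
  exact: cvg_cst.
have -> : (fun y => \sum_(k <- j :: s) F k y) = (fun y => F j y + \sum_(k <- s) F k y).
  by apply/funext => y; rewrite big_cons.
exact: continuousD (cF j) IH.
Qed.

(** The cutoff error in [int_pole_bound] is O(1/r), while the left side does not
    depend on [r]. *)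
Lemma smoothed_gradient_bound (m : nat) (d dl d1 : R) (nu l : 'rV[R]_m.+1)
    (h : 'rV[R]_m.+1 -> R) (U : R) :
  (0 < m)%N -> 0 < dl -> dl <= d1 -> d1 < d -> sq nu = 1 -> sq l = 1 ->
  harmonic_on [set y | - d < dot y nu] h ->
  (forall y, - d < dot y nu -> `|h y| <= U) ->
  exists C : R,
    [/\ 0 <= C, C * int_rV (bump 4 (dl ^+ 2) : 'rV[R]_m.+1 -> R) = omega R m.+1,
      csupp (2 * d1) (fun y => dir_deriv l h y * (C * bump 4 (dl ^+ 2) y)) &
      `|int_rV (fun y => dir_deriv l h y * (C * bump 4 (dl ^+ 2) y))| <=
      U * (d1^-1 * kappa R m * omega R m)].
Proof.
move=> m0 dl0 dld1 d1d nu1 l1 hD hU.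
have d10 : 0 < d1 by exact: lt_le_trans dld1.
have d12 : d1 < (d1 + d) / 2 by lra.
have d2d : (d1 + d) / 2 < d by lra.
have [e [e1 [e2 [C [[de de1 ce2] eE eW [C0 CI]]]]]] := exists_potential m dl0.
have [E0 [E1 [E2 [E3 [[dE0 dE1 dE2 cE3] E0lo E0hi [E001 E1ge0] Eout]]]]] :=
  exists_smooth_step d12.
have [X0 [X1 [X2 [X3 [[dX0 dX1 dX2 cX3] X0lo X0hi [X001 X1ge0] Xout]]]]] :=
  exists_smooth_step (a := 1 : R) (b := 4) ltac:(lra).
have cX1 : continuous X1 by exact: isd_continuous dX1.
have cX2 : continuous X2 by exact: isd_continuous dX2.
have x14 : (1 : R) < 4 by lra.
have [C1 hC1] := bounded_of_compact_support x14 cX1 (fun t nt => (Xout t nt).1).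
have [C2 hC2] := bounded_of_compact_support x14 cX2 (fun t nt => (Xout t nt).2).
pose CX := Num.max C1 C2.
have X1b t : `|X1 t| <= CX by rewrite le_max hC1.
have X2b t : `|X2 t| <= CX by rewrite le_max hC2 orbT.
exists C; split => //.
  by have [] := int_pole dl0 dld1 d12 d2d l nu1 hD de de1 ce2 eW d10 (lexx d1).
pose n := m.+1; set B := U * _.
pose Q : R := U * (2 * (CX * (16 + 2 * n%:R) + 24 * n%:R * (1 + n%:R) * CX)) * 4 ^+ n.
apply/ler_addgt0Pr => eps eps0.
pose r := d1 + `|Q| / eps.
have r0 : 0 < r by rewrite ltr_wpDr // divr_ge0 // ltW.
have d1r : d1 <= r by rewrite lerDl divr_ge0 // ltW.
have := int_pole_bound m0 dl0 dld1 d12 d2d nu1 l1 hD hU de de1 ce2 eE eW dE0 dE1 dE2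
  cE3 E0lo E0hi E001 E1ge0 Eout dX0 dX1 cX2 X0lo X0hi X001 Xout X1b X2b r0 d1r.
move=> H; apply: le_trans H _; rewrite lerD2l.
set T := (X in X <= _); have -> : T = Q / r.
  have -> : T = U * (2 * (CX * (16 + 2 * n%:R) / r ^+ 2 * (r ^+ m)^-1 +
      2 * (n%:R * (4 * CX / r * (3 * ((1 + n%:R) * (r * r ^+ m)^-1)))))) *
      (4 ^+ n * (r * r ^+ m)).
    have r4 : 2 * (2 * r) = 4 * r by ring.
    by rewrite /T /n r4 exprMn [r ^+ m.+1]exprS.
  by rewrite /Q; field; rewrite !expf_neq0 ?gt_eqF.
rewrite ler_pdivrMr //; apply: le_trans (ler_norm _) _.
by rewrite /r mulrDr [eps * (_ / _)]mulrC divfK ?gt_eqF // lerDr mulr_ge0 ?ltW.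
Qed.

(** Let the bump shrink to the origin, where [dir_deriv l h] is continuous, and
    then let [d1] tend to [d]. *)
Lemma half_space_gradient_bound (m : nat) (d : R) (nu l : 'rV[R]_m.+1)
    (h : 'rV[R]_m.+1 -> R) (U : R) :
  (0 < m)%N -> 0 < d -> sq nu = 1 -> sq l = 1 ->
  harmonic_on [set y | - d < dot y nu] h ->
  (forall y, - d < dot y nu -> `|h y| <= U) ->
  `|dir_deriv l h 0| * omega R m.+1 <= U * (d^-1 * kappa R m * omega R m).
Proof.
move=> m0 d0 nu1 l1 hD hU.
have D0 : - d < dot 0 nu by rewrite dot0l oppr_lt0.
have U0 : 0 <= U by exact: le_trans (normr_ge0 _) (hU _ D0).
have om0 := omega_gt0 R m.
have cG : {for 0, continuous (dir_deriv l h)}.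
  have [[_ H] _] := hD.
  have cj j : l 0 j *: partial j h y @[y --> (0 : 'rV[R]_m.+1)] --> l 0 j *: partial j h 0.
    have [_ [cj _]] := H j; exact: (@cvgZl_tmp _ _ _ _ (nbhs_filter _) _ _ _ (cj _ D0)).
  exact: continuous_at_sum cj.
have near_d1 d1 : 0 < d1 -> d1 < d ->
    `|dir_deriv l h 0| * omega R m.+1 <= U * (d1^-1 * kappa R m * omega R m).
  move=> d10 d1d; apply/ler_addgt0Pr => eps eps0.
  pose ep := eps / omega R m.+1; have ep0 : 0 < ep by rewrite divr_gt0.
  have [dt /= dt0 hdt] : exists2 dt : R, 0 < dt &
      forall y, `|y| < dt -> `|dir_deriv l h y - dir_deriv l h 0| <= ep.
    have /cvgrPdist_le /(_ _ ep0) /nbhs_ballP [dt /= dt0 H] := cG.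
    exists dt => // y yd; rewrite distrC; apply: H.
    by rewrite -ball_normE /= sub0r normrN.
  pose dl := Num.min d1 (dt / 2).
  have dl0 : 0 < dl by rewrite lt_min d10 divr_gt0.
  have dld1 : dl <= d1 by rewrite ge_min lexx.
  have dldt : dl < dt.
    by apply: le_lt_trans (_ : dt / 2 < dt); [rewrite ge_min lexx orbT|lra].
  have [C [C0 CI cW IW]] := smoothed_gradient_bound m0 dl0 dld1 d1d nu1 l1 hD hU.
  set W := fun y : 'rV[R]_m.+1 => C * bump 4 (dl ^+ 2) y.
  have W0 y : 0 <= W y by rewrite mulr_ge0 // exprn_ge0 // sqrtr_ge0.
  have dE : Num.sqrt (dl ^+ 2) = dl by rewrite sqrtr_sqr ger0_norm // ltW.
  have cb : csupp (2 * d1) (@bump R m.+1 4 (dl ^+ 2)).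
    by apply: csupp_le (csupp_bump _ 3 _); rewrite dE; lra.
  have cWc := csuppZ C cb.
  have cpm a := csuppZ a cWc.
  have d120 : 0 <= 2 * d1 by rewrite mulr_ge0 // ltW.
  have IWc a : int_rV (fun y : 'rV[R]_m.+1 => a * (C * bump 4 (dl ^+ 2) y)) = a * omega R m.+1.
    by rewrite (int_rVZ _ d120 cWc) (int_rVZ _ d120 cb) CI.
  have close y : `|dir_deriv l h y * W y - dir_deriv l h 0 * W y| <= ep * W y.
    rewrite -mulrBl normrM (ger0_norm (W0 y)).
    have [H|H] := ltP `|y| dt; first by rewrite ler_wpM2r // hdt.
    suff -> : W y = 0 by rewrite !mulr0.
    rewrite /W /bump ler0_sqrtr ?expr0n ?mulr0 // subr_le0 -[leRHS]sqr_sqrtr ?sq_ge0 //.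
    rewrite lerXn2r ?nnegrE ?sqrtr_ge0 ?(ltW dl0) //.
    by apply: le_trans (norm_le_sqrt_sq y); apply: le_trans (ltW dldt) H.
  have lo : (dir_deriv l h 0 - ep) * omega R m.+1 <= int_rV (fun y => dir_deriv l h y * W y).
    rewrite -IWc; apply: le_int_rV d120 (cpm _) cW _ => y.
    by have := close y; rewrite ler_norml -/(W y) => /andP[+ _]; rewrite mulrBl; lra.
  have hi : int_rV (fun y => dir_deriv l h y * W y) <= (dir_deriv l h 0 + ep) * omega R m.+1.
    rewrite -IWc; apply: le_int_rV d120 cW (cpm _) _ => y.
    by have := close y; rewrite ler_norml -/(W y) => /andP[_]; rewrite mulrDl; lra.
  move: IW lo hi; rewrite mulrBl mulrDl -/W /ep divfK ?gt_eqF // ler_norml => /andP[A1 A2] lo hi.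
  by rewrite -[X in _ * X](ger0_norm (ltW om0)) -normrM ler_norml; apply/andP; split; lra.
set P := kappa R m * omega R m.
have P0 : 0 <= P.
  rewrite !mulr_ge0 ?invr_ge0 ?exprn_ge0 ?sqrtr_ge0 //.
  by case: (m) m0 => // k _; exact: ltW (omega_gt0 R k).
have near' d1 : 0 < d1 -> d1 < d -> d1 * (`|dir_deriv l h 0| * omega R m.+1) <= U * P.
  move=> d10 d1d; have := near_d1 d1 d10 d1d; rewrite -mulrA -/P => H.
  by rewrite -(ler_pM2l d10) in H; apply: le_trans H _; rewrite mulrCA mulVKf ?gt_eqF.
set Y := _ * _ in near' *; rewrite -mulrA -/P mulrCA mulrC ler_pdivlMr // leNgt.
apply/negP => YP'; have YP : U * P < d * Y by rewrite [d * Y]mulrC.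
have UP0 : 0 <= U * P by exact: mulr_ge0.
have Y0 : 0 < Y by rewrite -(pmulr_rgt0 _ d0); exact: le_lt_trans UP0 YP.
have q : U * P / Y < d by rewrite ltr_pdivrMr.
have q0 : 0 <= U * P / Y by rewrite divr_ge0 // ltW.
have := near' ((U * P / Y + d) / 2); have -> : (U * P / Y + d) / 2 * Y = (U * P + d * Y) / 2.
  by field; rewrite gt_eqF.
move=> H; have := H ltac:(lra) ltac:(lra); lra.
Qed.
End HalfSpace.

(** * Operations on harmonic functions *)

Lemma continuous_at_lin (R : realType) (U : topologicalType) (f g : U -> R) a x :
  {for x, continuous f} -> {for x, continuous g} ->
  {for x, continuous (fun y => a * f y + g y)}.
Proof. by move=> cf cg; exact: (cvgD (cvgM (cvg_cst a) cf) cg). Qed.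

Section HarmonicClosure.
Variables (R : realType) (n : nat).
Implicit Types (D : set 'rV[R]_n) (f g : 'rV[R]_n -> R).

Lemma near_open D (P : 'rV[R]_n -> Prop) y : open D -> D y -> (forall z, D z -> P z) ->
  \forall z \near y, P z.
Proof. by move=> oD Dy DP; apply: filterS DP _; exact: open_nbhs_nbhs. Qed.

Lemma near_eq_continuous f g y : (\near y, f y = g y) ->
  {for y, continuous f} -> {for y, continuous g}.
Proof.
move=> E cf; have fg := nbhs_singleton E.
have H : f @ y --> g y by rewrite -fg; exact: cf.
exact: cvg_trans (near_eq_cvg E) H.
Qed.

(** Continuity and partial derivatives at a point of an open set only see the
    function near that point. *)
Lemma class_C_eq k D f g : open D -> (forall y, D y -> f y = g y) ->
  class_C k D f -> class_C k D g.
Proof.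
move=> oD; elim: k f g => [|k IH] f g E [cf H]; have nE z (Dz : D z) := near_open oD Dz E; split => //.
- by move=> y Dy; exact: near_eq_continuous (nE y Dy) (cf y Dy).
- by move=> y Dy; exact: near_eq_continuous (nE y Dy) (cf y Dy).
move=> j; have [df cj] := H j; split => [y Dy|].
  by apply: near_eq_derivable (df y Dy); exact: nE.
by apply: IH cj => y Dy; apply: near_eq_derive; exact: nE.
Qed.

Lemma class_C_lin k D (a : R) f g : open D -> class_C k D f -> class_C k D g ->
  class_C k D (fun y => a * f y + g y).
Proof.
move=> oD; elim: k f g => [|k IH] f g [cf Hf] [cg Hg]; split => //.
- by move=> y Dy; exact: continuous_at_lin (cf y Dy) (cg y Dy).
- by move=> y Dy; exact: continuous_at_lin (cf y Dy) (cg y Dy).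
move=> j; have [df cjf] := Hf j; have [dg cjg] := Hg j.
have dfg y (Dy : D y) : is_derive y (delta_mx 0 j) (fun y => a * f y + g y)
    (a * partial j f y + partial j g y).
  apply: isd_add; last exact: derivableP (dg y Dy).
  by apply: isd_eq (isd_mul (isd_cst _ _ a) (derivableP (df y Dy))) _; rewrite mul0r add0r.
split=> [y Dy|]; first by case: (dfg y Dy).
by apply: class_C_eq (IH _ _ cjf cjg) => // y Dy; case: (dfg y Dy).
Qed.

Lemma harmonic_lin D (a : R) f g : open D -> harmonic_on D f -> harmonic_on D g ->
  harmonic_on D (fun y => a * f y + g y).
Proof.
move=> oD [cf hf] [cg hg]; split; first exact: class_C_lin.
move=> y Dy.
transitivity (a * (\sum_j partial j (partial j f) y) + \sum_j partial j (partial j g) y).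
  2: by rewrite hf // hg // mulr0 addr0.
rewrite mulr_sumr -big_split /=; apply: eq_bigr => j _.
have dlin (p q : 'rV[R]_n -> R) z : derivable p z (delta_mx 0 j) ->
    derivable q z (delta_mx 0 j) ->
    partial j (fun y => a * p y + q y) z = a * partial j p z + partial j q z.
  move=> dp dq; apply: derive_val; apply: isd_add; last exact: derivableP.
  by apply: isd_eq (isd_mul (isd_cst _ _ a) (derivableP dp)) _; rewrite mul0r add0r.
have [dfj [_ /(_ j) [d2f _]]] := cf.2 j; have [dgj [_ /(_ j) [d2g _]]] := cg.2 j.
rewrite -dlin; [|exact: d2f|exact: d2g].
apply: near_eq_derive; apply: near_open Dy _ => // z Dz.
by apply: dlin; [exact: dfj|exact: dgj].
Qed.

Lemma harmonic_zero D : harmonic_on D (fun=> 0 : R).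
Proof.
have p0 j : partial j (fun _ : 'rV[R]_n => 0 : R) = fun=> 0.
  by apply/funext => y; exact: derive_cst.
split; last by move=> y _; rewrite big1 // => j _; rewrite !p0.
elim: 2%N => [|k IH]; (split; first by move=> y _; exact: (@cst_continuous 'rV[R]_n R 0 y)) => // j.
by rewrite p0; split => // y _; exact: derivable_cst.
Qed.

Lemma harmonic_sum D (I : finType) (c : I -> R) (F : I -> 'rV[R]_n -> R) : open D ->
  (forall i, harmonic_on D (F i)) -> harmonic_on D (fun y => \sum_i c i * F i y).
Proof.
move=> oD hF; suff H (s : seq I) : harmonic_on D (fun y => \sum_(i <- s) c i * F i y).
  exact: H.
elim: s => [|i s IH].
  by have -> : (fun y => \sum_(i <- [::]) c i * F i y) = fun=> 0;
    [apply/funext => y; rewrite big_nil|exact: harmonic_zero].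
have -> : (fun y => \sum_(k <- i :: s) c k * F k y) =
    fun y => c i * F i y + \sum_(k <- s) c k * F k y.
  by apply/funext => y; rewrite big_cons.
exact: harmonic_lin.
Qed.

Lemma partial_shift (W : normedModType R) (f : 'rV[R]_n -> W) j a y :
  partial j (fun z => f (a + z)) y = partial j f (a + y).
Proof.
rewrite /partial /derive.
suff -> : (fun t : R => t^-1 *: (((fun z => f (a + z)) \o shift y) (t *: delta_mx 0 j) - f (a + y)))
  = (fun t : R => t^-1 *: ((f \o shift (a + y)) (t *: delta_mx 0 j) - f (a + y))) by [].
by apply/funext => t /=; rewrite addrCA.
Qed.

Lemma class_C_shift k D f a : class_C k D f ->
  class_C k [set y | D (a + y)] (fun y => f (a + y)).
Proof.
have cs : continuous (fun z : 'rV[R]_n => a + z).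
  by apply: contV_add; [exact: cst_continuous|exact: cont_id].
elim: k f => [|k IH] f [cf H]; split => //.
- by move=> y Dy; exact: continuous_comp (cs y) (cf _ Dy).
- by move=> y Dy; exact: continuous_comp (cs y) (cf _ Dy).
move=> j; have [df cj] := H j; split=> [y Dy|]; last first.
  have -> : partial j (fun z => f (a + z)) = fun z => partial j f (a + z).
    by apply/funext => y; exact: partial_shift.
  exact: IH.
have := df _ Dy; rewrite /derivable.
suff -> : (fun t : R => t^-1 *: ((f \o shift (a + y)) (t *: delta_mx 0 j) - f (a + y)))
  = (fun t : R => t^-1 *: (((fun z => f (a + z)) \o shift y) (t *: delta_mx 0 j) - f (a + y))) by [].
by apply/funext => t /=; rewrite addrCA.
Qed.

Lemma harmonic_shift D f a : harmonic_on D f ->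
  harmonic_on [set y | D (a + y)] (fun y => f (a + y)).
Proof.
move=> [cf hf]; split; first exact: class_C_shift.
move=> y Dy; rewrite -[RHS](hf _ Dy); apply: eq_bigr => j _.
rewrite (_ : partial j (fun z => f (a + z)) = fun z => partial j f (a + z)).
  by rewrite partial_shift.
by apply/funext => z; rewrite partial_shift.
Qed.

Lemma dir_deriv_shift (W : normedModType R) l (f : 'rV[R]_n -> W) a y :
  dir_deriv l (fun z => f (a + z)) y = dir_deriv l f (a + y).
Proof. by apply: eq_bigr => j _; rewrite partial_shift. Qed.

Lemma harmonic_sub D D' f : D' `<=` D -> harmonic_on D f -> harmonic_on D' f.
Proof.
move=> DD [cf hf]; split; last by move=> y /DD; exact: hf.
elim: 2%N f {hf} cf => [|k IH] f [cf H]; (split; first by move=> y /DD; exact: cf) => // j.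
by have [df cj] := H j; split => [y /DD|]; [exact: df|exact: IH].
Qed.

End HarmonicClosure.

(** * The complement of a convex set *)

Section ConvexComplement.
Variables (R : realType) (n : nat).
Implicit Types (x y : 'rV[R]_n).

Lemma nearest_point (K : set 'rV[R]_n) x : closed K -> K !=set0 ->
  exists2 xi, K xi & forall y, K y -> sq (x - xi) <= sq (x - y).
Proof.
move=> clK [y0 Ky0]; pose M := `|x| + Num.sqrt (sq (x - y0)).
pose A := K `&` [set y : 'rV[R]_n | `|y| <= M].
have far y : M < `|y| -> sq (x - y0) <= sq (x - y).
  move=> My; rewrite -ler_sqrt ?sq_ge0 //; apply: le_trans (norm_le_sqrt_sq _).
  have := ler_normB x (x - y); rewrite opprB addrC subrK; rewrite /M in My; lra.
have cA : compact A.
  by rewrite /A setIC; apply: compact_closedI clK; exact: compact_ball_rV.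
have Ay0 : A y0.
  split=> //=; have := norm_le_sqrt_sq (x - y0); have := ler_normB x (x - y0).
  by rewrite opprB addrC subrK /M; lra.
have cf : continuous (fun y => sq (x - y)).
  apply: (@cont_comp _ _ _ (fun y : 'rV[R]_n => x - y)); last exact: cont_sq.
  by apply: contV_sub; [exact: cst_continuous|exact: cont_id].
have [|xi /set_mem [Kxi _] hxi] := compact_EVT_min (ex_intro _ _ Ay0) cA (f := fun y => sq (x - y)).
  exact: continuous_subspaceT.
have hxi' y : A y -> sq (x - xi) <= sq (x - y) by move=> Ay; apply: hxi; exact: mem_set.
exists xi => // y Ky; have [My|My] := leP `|y| M; first exact: hxi'.
exact: le_trans (hxi' _ Ay0) (far _ My).
Qed.

Lemma sqBZ x y t : sq (x - t *: y) = sq x - 2 * t * dot y x + t ^+ 2 * sq y.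
Proof. by rewrite !sqE dotBl !dotBr !dotZl !dotZr (dotC x y); ring. Qed.

(** The segment from [xi] to [y] stays in the closure by convexity, and its
    points near [xi] would be closer to [x] if the angle at [xi] were acute. *)
Lemma nearest_point_obtuse (G : set 'rV[R]_n) x xi : convex_set G -> closure G xi ->
  (forall y, closure G y -> sq (x - xi) <= sq (x - y)) ->
  forall y, closure G y -> dot (y - xi) (x - xi) <= 0.
Proof.
move=> cG cxi hxi; have inG y : G y -> dot (y - xi) (x - xi) <= 0.
  move=> Gy; have zG (t : R) : 0 < t -> t < 1 -> closure G (t *: y + (1 - t) *: xi).
    move=> t0 t1 B nB.
    have cf : continuous (fun z : 'rV[R]_n => t *: y + (1 - t) *: z).
      apply: contV_add; first exact: cst_continuous.
      by apply: contV_scale; [exact: cst_continuous|exact: cont_id].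
    have [z [Gz Bz]] := cxi _ (cf xi _ nB).
    exists (t *: y + (1 - t) *: z); split=> //.
    have := cG y z (Itv01 (ltW t0) (ltW t1)) (mem_set Gy) (mem_set Gz).
    by move/set_mem.
  have key (t : R) : 0 < t -> t < 1 -> 2 * dot (y - xi) (x - xi) <= t * sq (y - xi).
    move=> t0 t1; have := hxi _ (zG t t0 t1).
    have -> : x - (t *: y + (1 - t) *: xi) = (x - xi) - t *: (y - xi).
      by apply/matrixP => i j; rewrite !mxE; ring.
    by rewrite sqBZ => H; rewrite -(ler_pM2l t0); lra.
  set p := dot _ _ in key *; set q := sq _ in key.
  have q0 : 0 <= q := sq_ge0 _.
  rewrite leNgt; apply/negP => p0.
  pose t := Num.min 2^-1 (p / (q + 1)).
  have t0 : 0 < t by rewrite lt_min invr_gt0 ltr0n divr_gt0 // ltr_wpDl.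
  have t1 : t < 1 by rewrite gt_min invf_lt1 // ltr1n.
  have tp : t * (q + 1) <= p.
    by rewrite -ler_pdivlMr ?ltr_wpDl // ge_min lexx orbT.
  have := key t t0 t1; lra.
move=> y cy; have cl : closed [set y | dot (y - xi) (x - xi) <= 0].
  apply: (@closed_comp _ _ (fun y : 'rV[R]_n => dot (y - xi) (x - xi)) [set z : R | z <= 0]).
    move=> z _; apply: (@cont_comp _ _ _ (fun y : 'rV[R]_n => y - xi) (fun y => dot y (x - xi))).
      by apply: contV_sub; [exact: cont_id|exact: cst_continuous].
    exact: cont_dot.
  exact: closed_le.
by move: (closure_subset inG cy); rewrite -(closure_id _).1.
Qed.

(** The hyperplane through the nearest point [xi] of the closure, orthogonal to
    x - xi, has the closure on one side. As [xi] lies on the boundary of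
    [Omega] and that boundary is part of the closure, |x - xi| is the distance
    to it. *)
Lemma supporting_half_space (G Omega : set 'rV[R]_n) x :
  G !=set0 -> convex_set G -> Omega = ~` closure G -> Omega x ->
  exists nu : 'rV[R]_n, [/\ sq nu = 1, 0 < boundary_dist Omega x &
    forall y, - boundary_dist Omega x < dot y nu -> Omega (x + y)].
Proof.
move=> [g0 Gg0] cG OE Ox.
have clG : closed (closure G) by exact: closed_closure.
have oO : open Omega by rewrite OE; exact: closed_openC.
have iO : interior Omega = Omega by apply/interior_id.
have [|xi Kxi hxi] := nearest_point x clG; first by exists g0; exact: subset_closure.
have obt := nearest_point_obtuse cG Kxi hxi.
pose d := enorm (x - xi); have dE : d = Num.sqrt (sq (x - xi)) by [].
have d0 : 0 < d.
  rewrite dE sqrtr_gt0 lt_neqAle sq_ge0 andbT eq_sym; apply/eqP => /sq0_eq0 /subr0_eq e.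
  by move: Ox; rewrite OE e.
pose nu := d^-1 *: (x - xi).
have sqd : sq (x - xi) = d ^+ 2 by rewrite dE sqr_sqrtr ?sq_ge0.
have nu1 : sq nu = 1 by rewrite sqZ sqd exprVn mulVf // expf_neq0 // gt_eqF.
have half y : 0 < dot (y - xi) (x - xi) -> Omega y.
  by move=> H; rewrite OE => /obt; rewrite leNgt H.
have xnu : dot (x - xi) (x - xi) = d ^+ 2 by rewrite -sqE.
have bxi : boundary Omega xi.
  split; last by rewrite iO OE => /(_ Kxi).
  move=> B nB.
  have cf : continuous (fun t : R => xi + t *: (x - xi)).
    apply: contV_add; first exact: cst_continuous.
    by apply: contV_scale; [exact: cont_id|exact: cst_continuous].
  have nB' : nbhs (xi + (0 : R) *: (x - xi)) B by rewrite scale0r addr0.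
  have /nbhs_ballP [e /= e0 he] := cf 0 _ nB'.
  exists (xi + (e / 2) *: (x - xi)); split.
    by apply: half; rewrite addrC addKr dotZl xnu mulr_gt0 ?divr_gt0 ?exprn_gt0.
  apply: he; rewrite -ball_normE /= sub0r normrN ger0_norm; last by rewrite divr_ge0 // ltW.
  lra.
have bd : boundary_dist Omega x = d.
  apply/eqP; rewrite eq_le; apply/andP; split.
    apply: ge_inf; last by exists xi.
    by exists 0 => _ [y _ <-]; exact: sqrtr_ge0.
  apply: lb_le_inf; first by exists d; exists xi.
  move=> _ [y [_ yO] <-]; rewrite dE ler_sqrt ?sq_ge0 //; apply: hxi.
  by apply: contrapT => ny; apply: yO; rewrite iO OE.
exists nu; rewrite bd; split => // y H; apply: half.
have -> : x + y - xi = (x - xi) + y by rewrite addrAC.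
rewrite dotDl xnu; move: H; rewrite dotZr => H.
have : - d * d < d^-1 * dot y (x - xi) * d by rewrite ltr_pM2r.
by rewrite mulrAC mulVf ?gt_eqF // mul1r; lra.
Qed.
End ConvexComplement.

(** * Vector fields *)

Section VectorField.
Variable R : realType.

Lemma powR_half (a : R) k : 0 <= a -> a `^ (k%:R / 2) = Num.sqrt a ^+ k.
Proof. by move=> a0; rewrite mulrC powRrM powR12_sqrt // powR_mulrn ?sqrtr_ge0. Qed.

Lemma grad_constE m : grad_const R m.+1 = kappa R m * omega R m / omega R m.+1.
Proof.
rewrite /grad_const /kappa /= !powR_half ?ler0n //.
by field; rewrite expf_neq0 ?sqrtr_eq0 -?ltNge ?ltr0n // gt_eqF ?omega_gt0.
Qed.

(** Translate [x] to the origin and restrict [h] to the supporting half-space. *)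
Lemma scalar_gradient_bound m (G Omega : set 'rV[R]_m.+1) (h : 'rV[R]_m.+1 -> R) U x l :
  (0 < m)%N -> G !=set0 -> convex_set G -> Omega = ~` closure G -> Omega x -> sq l = 1 ->
  harmonic_on Omega h -> (forall y, Omega y -> `|h y| <= U) ->
  `|dir_deriv l h x| <= grad_const R m.+1 / boundary_dist Omega x * U.
Proof.
move=> m0 G0 cG OE Ox l1 hh hU.
have [nu [nu1 d0 half]] := supporting_half_space G0 cG OE Ox.
have hs := harmonic_sub half (harmonic_shift x hh).
have hUs y : - boundary_dist Omega x < dot y nu -> `|h (x + y)| <= U.
  by move=> /half /hU.
have := half_space_gradient_bound m0 d0 nu1 l1 hs hUs.
rewrite dir_deriv_shift addr0 grad_constE -ler_pdivlMr ?omega_gt0 //.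
by congr (_ <= _); field; rewrite !gt_eqF ?omega_gt0.
Qed.

Lemma dot_dir_deriv n m (u : 'rV[R]_n -> 'rV[R]_m) (e : 'rV[R]_m) l x :
  (forall i j, derivable (fun y => u y 0 i) x (delta_mx 0 j)) ->
  dir_deriv l (fun y => \sum_i e 0 i * u y 0 i) x = dot e (dir_deriv l u x).
Proof.
move=> du.
have dmx j : partial j u x = \row_i partial j (fun y => u y 0 i) x.
  rewrite /partial derive_mx; first by apply/rowP => i; rewrite !mxE.
  by apply/derivable_mxP => i k; rewrite (ord1 i).
have dlin j : partial j (fun y => \sum_i e 0 i * u y 0 i) x =
    \sum_i e 0 i * partial j (fun y => u y 0 i) x.
  apply: derive_val; apply: isd_sum => i.
  by apply: isd_eq (isd_mul (isd_cst _ _ _) (derivableP (du i j))) _; rewrite mul0r add0r.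
rewrite /dir_deriv /dot.
transitivity (\sum_j \sum_i l 0 j * (e 0 i * partial j (fun y => u y 0 i) x)).
  by apply: eq_bigr => j _; rewrite dlin -mulr_sumr.
rewrite exchange_big; apply: eq_bigr => i _; rewrite summxE mulr_sumr.
by apply: eq_bigr => j _; rewrite dmx !mxE mulrCA.
Qed.

Lemma continuous_enorm_dir_deriv n m (u : 'rV[R]_n -> 'rV[R]_m) x :
  continuous (fun l => enorm (dir_deriv l u x)).
Proof.
apply: (@cont_comp _ _ _ (fun l => sq (dir_deriv l u x)) Num.sqrt).
  apply: cont_sum => i; apply: cont_exp.
  have -> : (fun l : 'rV[R]_n => dir_deriv l u x 0 i) =
      fun l => \sum_j l 0 j * partial j u x 0 i.
    by apply/funext => l; rewrite summxE; apply: eq_bigr => j _; rewrite mxE.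
  by apply: cont_sum => j; apply: cont_mul; [exact: cont_coord|exact: cont_cst].
exact: sqrt_continuous.
Qed.

Lemma compact_unit_sphere n : compact (@unit_sphere R n).
Proof.
apply: (@subclosed_compact _ _ [set y : 'rV[R]_n | `|y| <= 1]).
- apply: (@closed_comp _ _ (@enorm R n) [set z : R | z = 1]).
    move=> y _; apply: (@cont_comp _ _ _ (@sq R n) Num.sqrt); first exact: cont_sq.
    exact: sqrt_continuous.
  exact: closed_eq.
- exact: compact_ball_rV.
- by move=> y /= y1; rewrite -y1; exact: norm_le_sqrt_sq.
Qed.

Lemma enorm_le_sup n m (D : set 'rV[R]_n) (u : 'rV[R]_n -> 'rV[R]_m) y :
  (forall i : 'I_m, [bounded u y 0 i | y in D]) -> D y ->
  enorm (u y) <= sup [set enorm (u y) | y in D].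
Proof.
move=> bu Dy; apply: ub_le_sup; last by exists y.
have B i : exists M, forall y, D y -> `|u y 0 i| <= M.
  have [M [_ HM]] := bu i; exists (M + 1) => z Dz.
  by apply: HM Dz; rewrite ltrDl.
have [M HM] := choice B.
exists (m%:R * \sum_i M i) => _ [z Dz <-].
apply: le_trans (sqrt_sq_le_norm _) _; rewrite ler_wpM2l //.
have M0 i : 0 <= M i by exact: le_trans (normr_ge0 _) (HM i z Dz).
apply: norm_rV_le => [|i]; first exact: sumr_ge0.
by rewrite (bigD1 i) //= ler_wpDr ?sumr_ge0 // HM.
Qed.

End VectorField.

Theorem proposition2 (R : realType) (n m : nat) (hn : (2 <= n)%N)
  (hm : (1 <= m)%N) (G Omega : set 'rV[R]_n)
  (domG : domain G) (cvxG : convex_set G) (OmegaE : Omega = ~` closure G)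
  (u : 'rV[R]_n -> 'rV[R]_m)
  (harm_u : forall i : 'I_m, harmonic_on Omega (fun y => u y 0 i))
  (bnd_u : forall i : 'I_m, [bounded u y 0 i | y in Omega])
  (x : 'rV[R]_n) (xOmega : Omega x) :
  exists2 M : R,
    is_maximum [set enorm (dir_deriv l u x) | l in @unit_sphere R n] M &
    M <= grad_const R n / boundary_dist Omega x *
         sup [set enorm (u y) | y in Omega].
Proof.
case: n hn G Omega domG cvxG OmegaE u harm_u bnd_u x xOmega => [//|k] hn.
move=> G Omega [G0 _ _] cG OE u hu bu x Ox.
pose U := sup [set enorm (u y) | y in Omega].
have uU y : Omega y -> enorm (u y) <= U by exact: enorm_le_sup.
have oO : open Omega by rewrite OE; apply: closed_openC; exact: closed_closure.
have du (i : 'I_m) (j : 'I_k.+1) : derivable (fun y => u y 0 i) x (delta_mx 0 j).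
  by have [[_ /(_ j) [d _]] _] := hu i; exact: d.
have bound l : unit_sphere l ->
    enorm (dir_deriv l u x) <= grad_const R k.+1 / boundary_dist Omega x * U.
  move=> l1; have l1' : sq l = 1.
    by rewrite -[sq l]sqr_sqrtr ?sq_ge0 // -/(enorm l) l1 expr1n.
  set w := dir_deriv l u x.
  have dirb (e : 'rV[R]_m) : enorm e <= 1 ->
      `|dot e w| <= grad_const R k.+1 / boundary_dist Omega x * U.
    move=> e1; rewrite -dot_dir_deriv //.
    apply: (scalar_gradient_bound _ G0 cG OE Ox l1') => //; first exact: harmonic_sum.
    move=> y Oy; apply: le_trans (dot_le e (u y)) _.
    rewrite -[leRHS]mul1r; apply: ler_pM; rewrite ?sqrtr_ge0 //; exact: uU.
  have [w0|w0] := eqVneq (enorm w) 0.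
    rewrite w0; apply: le_trans (dirb 0 _); first exact: normr_ge0.
    by rewrite /enorm big1 ?sqrtr0 // => j _; rewrite mxE expr0n.
  (* the field is tested against the direction of [w] itself *)
  have wE : dot w w = enorm w ^+ 2 by rewrite sqr_sqrtr ?sq_ge0 // -sqE.
  have wp : 0 < enorm w by rewrite lt_neqAle eq_sym w0 sqrtr_ge0.
  have := dirb ((enorm w)^-1 *: w).
  rewrite dotZl wE expr2 mulKf // ger0_norm ?(ltW wp) //; apply.
  by rewrite /enorm -/(sq _) sqZ sqrtrM ?sqr_ge0 // sqrtr_sqr normfV ger0_norm ?(ltW wp) // mulVf.
have S0 : @unit_sphere R k.+1 !=set0.
  exists (delta_mx 0 0); rewrite /unit_sphere /= /enorm -/(sq _).
  by rewrite sqE dot_delta mxE !eqxx sqrtr1.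
have [|l0 /set_mem Sl0 hl0] := compact_EVT_max S0 (@compact_unit_sphere R k.+1)
    (f := fun l => enorm (dir_deriv l u x)).
  by apply: continuous_subspaceT; exact: continuous_enorm_dir_deriv.
exists (enorm (dir_deriv l0 u x)); last exact: bound.
split; first by exists l0.
by move=> _ [l Sl <-]; apply: hl0; exact: mem_set.
Qed.
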